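(* Let $\alpha$, $\zeta_*$, $\tau$, $\theta$ be as below, and extend $\tau,\theta$ from $[0,\pi/2]$ to $[0,\pi]$ by $\tau(\pi/2+\sigma)=\tau(\pi/2-\sigma)$, $\theta(\pi/2+\sigma)=-\theta(\pi/2-\sigma)$ for $\sigma\in[0,\pi/2]$. Then $\tau$ and $\theta$ are real-analytic on $(0,\pi)$.
   Context: $L^2=L^2(0,\pi/2)$. The kernel is $K(s,\sigma)=\log\Big|\frac{\sin(s+\sigma)}{\sin(s-\sigma)}\Big|$ and $(Hw)(\sigma)=\frac1\pi\int_0^{\pi/2}K(s,\sigma)\,w(s)\,ds$. For $\alpha>0$, $\varPhi(\zeta)(\sigma)=\frac{3}{\alpha\pi}\,\frac{\sin(\sigma+\frac13(H\zeta)(\sigma))\cot\sigma}{\exp\int_0^\sigma\zeta\,ds}$, $\sigma\in(0,\pi/2]$. Let $\alpha\geqslant\frac2\pi\big(1+\frac{1}{3\sqrt\pi}\big)$, let $\zeta_*\in L^2$ be a non-negative solution of $\zeta_*=\varPhi(\zeta_* )$ with $\|\zeta_*\|\leqslant\frac{9\sqrt\pi}2$ and $0\le\sigma+\frac13(H\zeta_* )(\sigma)\le\pi$, and set $\theta=\frac13H\zeta_*$, $\tau(\sigma)=\log\frac\pi2+\frac13\int_0^\sigma\zeta_*(s)\,ds$ on $[0,\pi/2]$. Equivalently, $\tau$ and $\theta$ satisfy on $(0,\pi/2)$ the equation $e^{3\tau(\sigma)}\tau'(\sigma)=\frac{\pi^2}{8\alpha}\sin(\sigma+\theta(\sigma))\cot\sigma$,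 and (extended to the whole circle by the symmetries $\tau(-\sigma)=\tau(\sigma)$, $\theta(-\sigma)=-\theta(\sigma)$, $\tau(\sigma+\pi)=\tau(\sigma)$, $\theta(\sigma+\pi)=\theta(\sigma)$ in addition to the reflection about $\pi/2$) are the boundary traces of a harmonic function and its harmonic conjugate in the unit disk. *)

(* Defs.v *)
From Stdlib Require Import Reals Lra List.
Import ListNotations.
Open Scope R_scope.

(** Henstock–Kurzweil (gauge) integral on a compact interval [a,b], a <= b.
    A tagged division of [a,b] is a list of pairs (t_i, x_i): tag t_i and
    right endpoint x_i of the i-th subinterval, starting from a. *)
Fixpoint fine (delta : R -> R) (a b : R) (P : list (R * R)) : Prop :=
  match P with
  | nil => a = b
  | (t, x) :: P' =>
      a < x /\ a <= t <= x /\ t - delta t < a /\ x < t + delta t /\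
      fine delta x b P'
  end.

Fixpoint rsum (f : R -> R) (a : R) (P : list (R * R)) : R :=
  match P with
  | nil => 0
  | (t, x) :: P' => f t * (x - a) + rsum f x P'
  end.

Definition HK_integral (f : R -> R) (a b I : R) : Prop :=
  a <= b /\
  forall eps : R, 0 < eps ->
    exists delta : R -> R, (forall x, 0 < delta x) /\
      forall P, fine delta a b P -> Rabs (rsum f a P - I) < eps.

Definition Kker (s sigma : R) : R :=
  ln (Rabs (sin (s + sigma) / sin (s - sigma))).

Definition real_analytic_on (f : R -> R) (a b : R) : Prop :=
  forall x, a < x < b ->
    exists r : R, 0 < r /\
      exists c : nat -> R,
        forall y, Rabs (y - x) < r -> Pser c (y - x) (f y).

(* Main.v *)
(** In the variable [T = cot sigma] the kernel becomes [ln |(T + t) / (T - t)|], so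
    [- 3 PI theta(T)] is the logarithmic potential of the odd density
    [w = zeta / (1 + T^2)] on the whole line, and [w] is an explicit function of [T],
    [theta] and the primitive of [w].  Near a point [T0] deform the line by
    [psi_lam(T) = T + lam * phi(T)] with a bump [phi] supported in a short interval [[a, b]].
    Since [psi_lam(T) - psi_lam(t) = (T - t) (1 + lam q(T, t))] with [|q| <= 1], the deformed
    kernel is [ln |T - t| + ln (1 + lam q)], a power series in [lam] with bounded continuous
    coefficients.  The pulled-back density therefore solves a fixed point equation depending
    analytically on [lam], and the logarithmic singularity being integrable, the fixed point
    map is a contraction when [b - a] is small, both for bounded functions and in the
    Banach algebra of power series in [lam] with summable coefficients.  The Picard iterates
    are power series converging to the given solution, so [theta] and [tau] are power series
    in [lam] at [psi_lam(T0) = T0 + lam * phi(T0)], that is, analytic at [T0].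

    No regularity of [zeta] is assumed beyond square integrability: the Cauchy-Schwarz
    inequality for the gauge integral makes [theta] Hoelder continuous, whence [zeta] is
    continuous and all further integrals are Riemann integrals. *)

Require Import Defs.
From Stdlib Require Import Reals Lra Lia List Classical IndefiniteDescription Factorial.
From Coquelicot Require Import Coquelicot.
Open Scope R_scope.

(** A real parameter [lam] replaces complexification: [AnF] with its weighted l^1 norm plays the
    part of bounded holomorphic functions of [lam]. The obstacle is that the potential is global and
    singular while the contraction has to be local. The unknown is therefore the difference [V]
    between pulled-back and original density, which vanishes off [a, b]; the rest of the line enters
    only through the fixed term [Efar], controlled by the mass of |w|, at most 2 [Ih 0]. What
    shrinks with b - a is the logarithmic potential over [a, b], of size sqrt (b - a), and the
    integral in the exponent. The remaining constants depend neither on T0 nor on b - a, so the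
    interval can be chosen last. After the change of variable the singular kernel is never
    integrated directly: ln |x| is replaced by [lreg n], smooth at scale 4^-n, and the line by
    [-n, n] with the same n, so that one limit removes both. The bound 1/4 on [lam] keeps 1 + lam q
    within [3/4, 5/4]. *)

Notation Cont f := (forall x : R, continuous f x).

(** * Gauge integral: fine divisions, comparison, linearity, exceptional points *)

Lemma fine_le (delta : R -> R) (P : list (R * R)) (a b : R) :
  fine delta a b P -> a <= b.
Proof.
  revert a; induction P as [|[t x] P IH]; simpl; intros a H.
  - lra.
  - destruct H as (H1 & _ & _ & _ & H5). apply IH in H5. lra.
Qed.

Lemma fine_mono (d d' : R -> R) (P : list (R * R)) (a b : R) :
  (forall x, d x <= d' x) -> fine d a b P -> fine d' a b P.
Proof.
  intros Hd; revert a; induction P as [|[t x] P IH]; simpl; intros a H; [exact H|].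
  destruct H as (H1 & H2 & H3 & H4 & H5). specialize (Hd t).
  repeat split; try lra. now apply IH.
Qed.

Lemma fine_app (d : R -> R) (P Q : list (R * R)) (a b c : R) :
  fine d a b P -> fine d b c Q -> fine d a c (P ++ Q).
Proof.
  revert a; induction P as [|[t x] P IH]; simpl; intros a HP HQ.
  - now subst.
  - intuition.
Qed.

Lemma rsum_app (d : R -> R) (f : R -> R) (P Q : list (R * R)) (a b : R) :
  fine d a b P -> rsum f a (P ++ Q) = rsum f a P + rsum f b Q.
Proof.
  revert a; induction P as [|[t x] P IH]; simpl; intros a HP.
  - subst; lra.
  - destruct HP as (_ & _ & _ & _ & H). rewrite (IH x H). lra.
Qed.

(** Supremum argument: one more interval tagged at the supremum [m] of the reachable right ends
    would pass beyond [m] unless [m = b]. *)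
Lemma cousin (d : R -> R) (a b : R) :
  (forall x, 0 < d x) -> a <= b -> exists P, fine d a b P.
Proof.
  intros Hd Hab.
  set (E := fun x => a <= x <= b /\ exists P, fine d a x P).
  assert (Ea : E a) by (split; [lra | exists nil; reflexivity]).
  destruct (completeness E) as [m [Hub Hlub]].
  { exists b. intros x [Hx _]. lra. }
  { now exists a. }
  assert (Ham : a <= m) by now apply Hub.
  assert (Hmb : m <= b) by (apply Hlub; intros x [Hx _]; lra).
  pose proof (Hd m) as Hdm.
  assert (Hy : exists y, E y /\ m - d m < y).
  { apply NNPP; intros Hn.
    assert (m <= m - d m); [|lra].
    apply Hlub; intros y Hy. apply Rnot_lt_le; intros Hlt.
    apply Hn; now exists y. }
  destruct Hy as (y & (Hyab & P & HP) & Hym).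
  assert (y <= m) by (apply Hub; split; [lra | now exists P]).
  set (z := Rmin b (m + d m / 2)).
  assert (Hz1 : z <= b) by apply Rmin_l.
  assert (Hz2 : z <= m + d m / 2) by apply Rmin_r.
  assert (Hz3 : m <= z) by (apply Rmin_glb; lra).
  destruct (Rlt_or_le y z) as [Hyz|Hyz].
  - assert (HE : E z).
    { split; [lra|]. exists (P ++ (m, z) :: nil).
      apply fine_app with y; [exact HP|]. simpl. repeat split; lra. }
    assert (z <= m) by now apply Hub.
    assert (z = b).
    { unfold z in *. unfold Rmin in *. destruct (Rle_dec b (m + d m / 2)); lra. }
    destruct HE as [_ HE]. now rewrite H1 in HE.
  - assert (z = b).
    { unfold z in *. unfold Rmin in *. destruct (Rle_dec b (m + d m / 2)); lra. }
    assert (y = b) by lra. subst y. now exists P.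
Qed.

Lemma gauge_min (d1 d2 : R -> R) :
  (forall x, 0 < d1 x) -> (forall x, 0 < d2 x) ->
  exists d, (forall x, 0 < d x) /\ (forall x, d x <= d1 x) /\ (forall x, d x <= d2 x).
Proof.
  intros H1 H2. exists (fun x => Rmin (d1 x) (d2 x)). repeat split; intros x.
  - now apply Rmin_pos.
  - apply Rmin_l.
  - apply Rmin_r.
Qed.

Lemma rsum_ext (d : R -> R) (f g : R -> R) (P : list (R * R)) (a b : R) :
  fine d a b P -> (forall x, a <= x <= b -> f x = g x) -> rsum f a P = rsum g a P.
Proof.
  revert a; induction P as [|[t x] P IH]; simpl; intros a HP H; [reflexivity|].
  destruct HP as (H1 & H2 & _ & _ & H5). pose proof (fine_le _ _ _ _ H5).
  rewrite (H t) by lra. rewrite (IH x H5); [reflexivity|]. intros; apply H; lra.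
Qed.

Lemma rsum_le (d : R -> R) (f g : R -> R) (P : list (R * R)) (a b : R) :
  fine d a b P -> (forall x, a <= x <= b -> f x <= g x) -> rsum f a P <= rsum g a P.
Proof.
  revert a; induction P as [|[t x] P IH]; simpl; intros a HP H; [lra|].
  destruct HP as (H1 & H2 & _ & _ & H5). pose proof (fine_le _ _ _ _ H5).
  assert (f t <= g t) by (apply H; lra).
  assert (rsum f x P <= rsum g x P) by (apply IH; auto; intros; apply H; lra).
  nra.
Qed.

Lemma rsum_lin (f g : R -> R) (u v : R) (P : list (R * R)) (a : R) :
  rsum (fun x => u * f x + v * g x) a P = u * rsum f a P + v * rsum g a P.
Proof.
  revert a; induction P as [|[t x] P IH]; simpl; intros a; [ring|].
  rewrite IH. ring.
Qed.

Lemma HK_common_gauge (f g : R -> R) (a b I J eps : R) :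
  HK_integral f a b I -> HK_integral g a b J -> 0 < eps ->
  exists d, (forall x, 0 < d x) /\ forall P, fine d a b P ->
    - eps < rsum f a P - I < eps /\ - eps < rsum g a P - J < eps.
Proof.
  intros [_ HI] [_ HJ] Heps.
  destruct (HI eps Heps) as (d1 & Hd1 & H1). destruct (HJ eps Heps) as (d2 & Hd2 & H2).
  destruct (gauge_min d1 d2 Hd1 Hd2) as (d & Hd & L1 & L2).
  exists d; split; [exact Hd|]. intros P HP.
  specialize (H1 P (fine_mono _ _ _ _ _ L1 HP)). specialize (H2 P (fine_mono _ _ _ _ _ L2 HP)).
  apply Rabs_def2 in H1. apply Rabs_def2 in H2. lra.
Qed.

Lemma HK_le (f g : R -> R) (a b I J : R) :
  (forall x, a <= x <= b -> f x <= g x) ->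
  HK_integral f a b I -> HK_integral g a b J -> I <= J.
Proof.
  intros He HI HJ. apply le_epsilon; intros eps Heps.
  destruct (HK_common_gauge f g a b I J (eps / 2) HI HJ ltac:(lra)) as (d & Hd & H).
  destruct (cousin d a b Hd (proj1 HI)) as [P HP].
  specialize (H P HP). pose proof (rsum_le d f g P a b HP He). lra.
Qed.

Lemma HK_unique (f : R -> R) (a b I J : R) :
  HK_integral f a b I -> HK_integral f a b J -> I = J.
Proof. intros HI HJ. apply Rle_antisym; apply (HK_le f f a b); auto; intros; lra. Qed.

Lemma HK_ext (f g : R -> R) (a b I : R) :
  (forall x, a <= x <= b -> f x = g x) -> HK_integral f a b I -> HK_integral g a b I.
Proof.
  intros He [Hab HI]; split; [exact Hab|]. intros eps Heps.
  destruct (HI eps Heps) as (d & Hd & H). exists d; split; [exact Hd|].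
  intros P HP. rewrite <- (rsum_ext d f g P a b HP He). now apply H.
Qed.

Lemma HK_lin (f g : R -> R) (a b u v I J : R) :
  HK_integral f a b I -> HK_integral g a b J ->
  HK_integral (fun x => u * f x + v * g x) a b (u * I + v * J).
Proof.
  intros HI HJ; split; [exact (proj1 HI)|]. intros eps Heps.
  set (c := Rabs u + Rabs v + 1).
  assert (Hc : 0 < c) by (unfold c; pose proof (Rabs_pos u); pose proof (Rabs_pos v); lra).
  destruct (HK_common_gauge f g a b I J (eps / c) HI HJ ltac:(now apply Rdiv_lt_0_compat)) as (d & Hd & H).
  exists d; split; [exact Hd|]. intros P HP. rewrite rsum_lin. destruct (H P HP) as [H1 H2].
  replace (u * rsum f a P + v * rsum g a P - (u * I + v * J))
    with (u * (rsum f a P - I) + v * (rsum g a P - J)) by ring.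
  eapply Rle_lt_trans; [apply Rabs_triang|]. rewrite !Rabs_mult.
  pose proof (Rabs_pos u). pose proof (Rabs_pos v).
  assert (Rabs u * Rabs (rsum f a P - I) <= Rabs u * (eps / c)) by (apply Rmult_le_compat_l, Rabs_le; lra).
  assert (Rabs v * Rabs (rsum g a P - J) <= Rabs v * (eps / c)) by (apply Rmult_le_compat_l, Rabs_le; lra).
  assert (eps = c * (eps / c)) by (field; lra).
  unfold c in *. nra.
Qed.

Lemma HK_abs_le (f g : R -> R) (a b I J : R) :
  (forall x, a <= x <= b -> Rabs (f x) <= g x) ->
  HK_integral f a b I -> HK_integral g a b J -> Rabs I <= J.
Proof.
  intros He HI HJ. apply Rabs_le; split.
  - assert (H : HK_integral (fun x => (-1) * f x + 0 * f x) a b ((-1) * I + 0 * I)) by now apply HK_lin.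
    assert ((-1) * I + 0 * I <= J); [|lra].
    apply (HK_le _ _ a b _ _) with (2 := H) (3 := HJ).
    intros x Hx. specialize (He x Hx). apply Rabs_le_between in He. lra.
  - apply (HK_le _ _ a b _ _) with (2 := HI) (3 := HJ).
    intros x Hx. specialize (He x Hx). apply Rabs_le_between in He. lra.
Qed.

(* The tag [p] may occur several times; its contributions are summed by
   comparing with the increments of [M] clamped to a small window around [p]. *)
Lemma HK_FTC_except (F f M : R -> R) (a b p : R) :
  a <= b ->
  (forall x, a <= x <= b -> x <> p -> is_derive F x (f x)) ->
  (forall x y, x <= y -> Rabs (F y - F x) <= M y - M x) ->
  continuous M p ->
  HK_integral f a b (F b - F a).
Proof.
  intros Hab HF HM HMc. split; [exact Hab|]. intros eps Heps.
  set (e1 := eps / (2 * (b - a + 1))).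
  assert (He1 : 0 < e1) by (apply Rdiv_lt_0_compat; lra).
  assert (Hst : forall x, exists d, 0 < d /\ (a <= x <= b -> x <> p ->
     forall y z, y <= x <= z -> x - d < y -> z < x + d ->
       Rabs (f x * (z - y) - (F z - F y)) <= e1 * (z - y))).
  { intros x. destruct (classic (a <= x <= b /\ x <> p)) as [[Hx Hp]|Hn].
    - specialize (HF x Hx Hp). apply is_derive_Reals in HF.
      destruct (HF e1 He1) as [d Hd]. exists d. split; [apply cond_pos|].
      intros _ _ y z Hyz H1 H2.
      assert (Hb : forall v, Rabs (v - x) < d -> Rabs (F v - F x - f x * (v - x)) <= e1 * Rabs (v - x)).
      { intros v Hv. destruct (Req_dec v x) as [->|Hvx].
        - replace (F x - F x - f x * (x - x)) with 0 by ring.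
          rewrite Rabs_R0. apply Rmult_le_pos; [lra | apply Rabs_pos].
        - specialize (Hd (v - x) ltac:(lra) Hv).
          replace (x + (v - x)) with v in Hd by ring.
          replace (F v - F x - f x * (v - x)) with (((F v - F x) / (v - x) - f x) * (v - x)) by (field; lra).
          rewrite Rabs_mult. apply Rmult_le_compat_r; [apply Rabs_pos | lra]. }
      assert (By := Hb y). assert (Bz := Hb z).
      rewrite (Rabs_left1 (y - x)) in By by lra.
      rewrite (Rabs_right (z - x)) in Bz by lra.
      specialize (By ltac:(lra)). specialize (Bz ltac:(lra)).
      apply Rabs_le_between in By. apply Rabs_le_between in Bz.
      apply Rabs_le. lra.
    - exists 1. split; [lra|]. intros; exfalso; tauto. }
  (* [Q] dominates the increments of [F] through [M], and the terms tagged at [p] through the slope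
     [Rabs (f p)]. By continuity at [p] it varies by less than eps / 4 over the window; the other
     tags cost at most eps / 2. *)
  set (Q := fun x => M x + Rabs (f p) * x).
  assert (HQ : exists dp, 0 < dp /\ forall x, Rabs (x - p) < 2 * dp -> Rabs (Q x - Q p) < eps / 8).
  { assert (HQc : continuous Q p).
    { apply (continuous_plus M (fun x => Rabs (f p) * x)); [exact HMc|].
      apply (continuous_mult (fun _ => Rabs (f p)) (fun x => x)); [apply continuous_const | apply continuous_id]. }
    assert (He : 0 < eps / 8) by lra.
    destruct (proj1 (filterlim_locally Q (Q p)) HQc (mkposreal _ He)) as [d Hd].
    exists (d / 2). split; [pose proof (cond_pos d); lra|].
    intros x Hx. apply (Hd x). unfold ball; simpl; unfold AbsRing_ball, abs, minus, plus, opp; simpl.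
    replace (x + - p) with (x - p) by ring. lra. }
  destruct HQ as (dp & Hdp & HQ).
  assert (HQm : forall x y, x <= y -> Q x <= Q y).
  { intros x y Hxy. unfold Q. specialize (HM x y Hxy). pose proof (Rabs_pos (F y - F x)).
    pose proof (Rabs_pos (f p)). nra. }
  destruct (functional_choice _ Hst) as [d0 Hd0].
  set (d := fun x => if Req_dec_T x p then dp else d0 x).
  exists d. split.
  { intros x. unfold d. destruct (Req_dec_T x p); [exact Hdp | apply Hd0]. }
  set (cl := fun x => Rmax (p - dp) (Rmin (p + dp) x)).
  assert (Hclm : forall x y, x <= y -> cl x <= cl y).
  { intros x y Hxy. unfold cl. apply Rle_max_compat_l. apply Rle_min_compat_l. exact Hxy. }
  assert (Key : forall P a', a <= a' -> fine d a' b P ->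
    Rabs (rsum f a' P - (F b - F a')) <= e1 * (b - a') + (Q (cl b) - Q (cl a'))).
  { induction P as [|[t x] P IH]; simpl; intros a' Ha' HP.
    - subst a'. replace (0 - (F b - F b)) with 0 by ring. rewrite Rabs_R0. lra.
    - destruct HP as (H1 & H2 & H3 & H4 & H5).
      pose proof (fine_le _ _ _ _ H5) as H6.
      specialize (IH x ltac:(lra) H5).
      replace (f t * (x - a') + rsum f x P - (F b - F a'))
        with ((f t * (x - a') - (F x - F a')) + (rsum f x P - (F b - F x))) by ring.
      eapply Rle_trans; [apply Rabs_triang|].
      assert (Rabs (f t * (x - a') - (F x - F a')) <= e1 * (x - a') + (Q (cl x) - Q (cl a'))); [|lra].
      pose proof (HQm _ _ (Hclm a' x ltac:(lra))).
      unfold d in H3, H4. destruct (Req_dec_T t p) as [->|Htp].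
      + assert (E1 : cl x = x).
        { unfold cl. rewrite Rmin_right by lra. apply Rmax_right. lra. }
        assert (E2 : cl a' = a').
        { unfold cl. rewrite Rmin_right by lra. apply Rmax_right. lra. }
        rewrite E1, E2. unfold Q. specialize (HM a' x ltac:(lra)).
        assert (Rabs (f p * (x - a') - (F x - F a')) <= Rabs (f p) * (x - a') + Rabs (F x - F a')).
        { unfold Rminus at 1. eapply Rle_trans; [apply Rabs_triang|]. rewrite Rabs_Ropp, Rabs_mult.
          rewrite (Rabs_right (x - a')) by lra. lra. }
        assert (0 <= e1 * (x - a')) by (apply Rmult_le_pos; lra). lra.
      + destruct (Hd0 t) as [_ Hd1].
        specialize (Hd1 ltac:(lra) Htp a' x ltac:(lra) ltac:(lra) ltac:(lra)). lra. }
  intros P HP. eapply Rle_lt_trans; [apply Key; [lra | exact HP]|].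
  assert (Hcl : forall x, Rabs (cl x - p) < 2 * dp).
  { intros x. apply Rabs_def1.
    - unfold cl. assert (Rmax (p - dp) (Rmin (p + dp) x) <= p + dp); [|lra].
      apply Rmax_lub; [lra | apply Rmin_l].
    - unfold cl. pose proof (Rmax_l (p - dp) (Rmin (p + dp) x)). lra. }
  pose proof (HQ _ (Hcl a)) as Qa. pose proof (HQ _ (Hcl b)) as Qb.
  apply Rabs_def2 in Qa. apply Rabs_def2 in Qb.
  assert (e1 * (b - a) <= eps / 2).
  { assert (e1 * (2 * (b - a + 1)) = eps) by (unfold e1; field; lra). nra. }
  lra.
Qed.

(** The difference of the two integrands has the primitive 0 off [p]. This disposes of the arbitrary
    values that [ln] and division take at singular points. *)
Lemma HK_except_point (f g : R -> R) (a b p I : R) :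
  (forall x, a <= x <= b -> x <> p -> f x = g x) ->
  HK_integral f a b I -> HK_integral g a b I.
Proof.
  intros Hfg HI.
  set (h := fun x => if Req_dec_T x p then g p - f p else 0).
  assert (Hh : HK_integral h a b (0 - 0)).
  { apply (HK_FTC_except (fun _ => 0) h (fun _ => 0) a b p).
    - apply HI.
    - intros x _ Hx. unfold h. destruct (Req_dec_T x p); [contradiction|]. apply (is_derive_const 0 x).
    - intros x y _. rewrite Rminus_0_r, Rabs_R0. lra.
    - apply continuous_const. }
  apply HK_ext with (fun x => 1 * f x + 1 * h x).
  - intros x Hx. unfold h. destruct (Req_dec_T x p) as [->|Hxp]; [ring|].
    rewrite (Hfg x Hx Hxp). ring.
  - replace I with (1 * I + 1 * (0 - 0)) by ring. now apply HK_lin.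
Qed.

(** * Continuous integrands, additivity, and approximation near the left end *)

Lemma ex_RInt_cont (f : R -> R) (a b : R) :
  Cont f -> ex_RInt f a b.
Proof. intros Hf. apply (ex_RInt_continuous f). intros; apply Hf. Qed.

Lemma is_derive_RInt_cont (f : R -> R) (a x : R) :
  Cont f -> is_derive (fun x => RInt f a x) x (f x).
Proof.
  intros Hf. apply (is_derive_RInt f (fun x => RInt f a x) a x); [|apply Hf].
  exists (mkposreal 1 Rlt_0_1). intros y _. apply (RInt_correct (V := R_CompleteNormedModule)). now apply ex_RInt_cont.
Qed.

Lemma continuous_RInt_cont (f : R -> R) (a x : R) :
  Cont f -> continuous (fun x => RInt f a x) x.
Proof.
  intros Hf. apply (ex_derive_continuous (K := R_AbsRing) (V := R_NormedModule)).
  exists (f x). now apply is_derive_RInt_cont.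
Qed.

Lemma continuous_Rabs_comp (f : R -> R) (x : R) :
  continuous f x -> continuous (fun x => Rabs (f x)) x.
Proof. intros H. apply (continuous_comp f Rabs); [exact H | apply continuous_Rabs]. Qed.

Lemma RInt_Chasles_minus (f : R -> R) (a x y : R) :
  Cont f -> RInt f a y - RInt f a x = RInt f x y.
Proof.
  intros Hf. rewrite <- (RInt_Chasles f a x y) by now apply ex_RInt_cont.
  unfold plus; simpl. ring.
Qed.

Lemma HK_continuous (f : R -> R) (a b : R) :
  a <= b -> Cont f -> HK_integral f a b (RInt f a b).
Proof.
  intros Hab Hf.
  assert (Ha : forall x, continuous (fun x => Rabs (f x)) x) by (intros; now apply continuous_Rabs_comp).
  rewrite <- (RInt_Chasles_minus f a) by exact Hf.
  (* Nothing is exceptional at [a]; it merely fills the slot of the exceptional point. *)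
  apply (HK_FTC_except (fun x => RInt f a x) f (fun x => RInt (fun x => Rabs (f x)) a x) a b a Hab).
  - intros x _ _. now apply is_derive_RInt_cont.
  - intros x y Hxy. rewrite !RInt_Chasles_minus by assumption.
    apply abs_RInt_le; [exact Hxy | now apply ex_RInt_cont].
  - now apply continuous_RInt_cont.
Qed.

Lemma HK_Chasles (f : R -> R) (a b c I J K : R) :
  HK_integral f a b I -> HK_integral f b c J -> HK_integral f a c K -> K = I + J.
Proof.
  intros [Hab HI] [Hbc HJ] [_ HK]. apply cond_eq; intros eps Heps.
  destruct (HI (eps / 3)) as (d1 & Hd1 & H1); [lra|].
  destruct (HJ (eps / 3)) as (d2 & Hd2 & H2); [lra|].
  destruct (HK (eps / 3)) as (d3 & Hd3 & H3); [lra|].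
  destruct (gauge_min d1 d3 Hd1 Hd3) as (e1 & He1 & L1 & L13).
  destruct (gauge_min d2 d3 Hd2 Hd3) as (e2 & He2 & L2 & L23).
  destruct (cousin e1 a b He1 Hab) as [P HP].
  destruct (cousin e2 b c He2 Hbc) as [Q HQ].
  specialize (H1 P (fine_mono _ _ _ _ _ L1 HP)).
  specialize (H2 Q (fine_mono _ _ _ _ _ L2 HQ)).
  specialize (H3 (P ++ Q) (fine_app _ _ _ _ _ _ (fine_mono _ _ _ _ _ L13 HP) (fine_mono _ _ _ _ _ L23 HQ))).
  rewrite (rsum_app _ f P Q a b HP) in H3.
  apply Rabs_def2 in H1. apply Rabs_def2 in H2. apply Rabs_def2 in H3. apply Rabs_def1; lra.
Qed.

(* A one-interval piece tagged at the left end [a] bridges the gap between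
   [a, b] and [x, b], so no integrability of [f] on subintervals is required. *)
Lemma HK_approx (f h : R -> R) (a b I H : R) :
  HK_integral f a b I -> HK_integral h a b H ->
  (forall x, a <= x <= b -> 0 <= h x) ->
  forall eps, 0 < eps -> exists eta, 0 < eta /\
    forall x g G k, a < x < a + eta -> x <= b -> 0 <= k -> HK_integral g x b G ->
      (forall s, x <= s <= b -> Rabs (f s - g s) <= k * h s) ->
      Rabs (I - G) <= eps + k * (H + eps).
Proof.
  intros [Hab HI] [_ HH] Hh eps Heps.
  destruct (HI (eps / 3)) as (d1 & Hd1 & H1); [lra|].
  destruct (HH eps) as (d2 & Hd2 & H2); [lra|].
  destruct (gauge_min d1 d2 Hd1 Hd2) as (e1 & He1 & L1 & L2).
  (* Makes the term [f a * (x - a)] of the bridging interval at most eps / 3. *)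
  set (m := eps / (3 * (Rabs (f a) + 1))).
  pose proof (Rabs_pos (f a)) as Hfa.
  assert (Hm : 0 < m) by (apply Rdiv_lt_0_compat; lra).
  exists (Rmin (e1 a) m). split; [apply Rmin_pos; [apply He1 | exact Hm]|].
  intros x g G k Hx Hxb Hk [_ HG] Hfg.
  pose proof (Rmin_l (e1 a) m) as Hmn1. pose proof (Rmin_r (e1 a) m) as Hmn2.
  destruct (HG (eps / 3)) as (d3 & Hd3 & H3); [lra|].
  destruct (gauge_min e1 d3 He1 Hd3) as (e2 & He2 & L12 & L3).
  destruct (cousin e2 x b He2 Hxb) as [P HP].
  assert (HQ : fine e1 a b ((a, x) :: P)).
  { simpl. pose proof (He1 a). repeat split; try lra. now apply (fine_mono e2). }
  specialize (H1 _ (fine_mono _ _ _ _ _ L1 HQ)).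
  specialize (H2 _ (fine_mono _ _ _ _ _ L2 HQ)).
  specialize (H3 _ (fine_mono _ _ _ _ _ L3 HP)).
  simpl in H1, H2.
  assert (Hd : Rabs (rsum f x P - rsum g x P) <= k * rsum h x P).
  { replace (k * rsum h x P) with (k * rsum h x P + 0 * rsum h x P) by ring.
    rewrite <- rsum_lin. apply Rabs_le. split.
    - assert (H5 : rsum (fun y => 1 * g y + (-1) * f y) x P <= rsum (fun y => k * h y + 0 * h y) x P).
      { apply (rsum_le e2 _ _ P x b HP). intros s Hs. specialize (Hfg s Hs).
        apply Rabs_le_between in Hfg. lra. }
      rewrite (rsum_lin g f) in H5. lra.
    - assert (H5 : rsum (fun y => 1 * f y + (-1) * g y) x P <= rsum (fun y => k * h y + 0 * h y) x P).
      { apply (rsum_le e2 _ _ P x b HP). intros s Hs. specialize (Hfg s Hs).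
        apply Rabs_le_between in Hfg. lra. }
      rewrite (rsum_lin f g) in H5. lra. }
  assert (Hha : 0 <= h a * (x - a)) by (apply Rmult_le_pos; [apply Hh; lra | lra]).
  assert (Hf1 : Rabs (f a * (x - a)) <= eps / 3).
  { rewrite Rabs_mult. rewrite (Rabs_right (x - a)) by lra.
    assert (m * (3 * (Rabs (f a) + 1)) = eps) by (unfold m; field; lra). nra. }
  apply Rabs_def2 in H1. apply Rabs_def2 in H2. apply Rabs_def2 in H3.
  assert (k * rsum h x P <= k * (H + eps)) by (apply Rmult_le_compat_l; lra).
  apply Rabs_le_between in Hd. apply Rabs_le_between in Hf1.
  apply Rabs_le. lra.
Qed.

(** * Continuity rules and clamping *)

Lemma continuous_eps (f : R -> R) (x : R) :
  continuous f x <->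
  forall eps, 0 < eps -> exists d, 0 < d /\ forall y, Rabs (y - x) < d -> Rabs (f y - f x) < eps.
Proof.
  split.
  - intros H eps Heps.
    destruct (proj1 (filterlim_locally f (f x)) H (mkposreal _ Heps)) as [d Hd].
    exists d. split; [apply cond_pos|]. intros y Hy. exact (Hd y Hy).
  - intros H. apply filterlim_locally. intros eps.
    destruct (H eps (cond_pos eps)) as (d & Hd & Hy).
    exists (mkposreal d Hd). intros y Hyd. apply Hy. exact Hyd.
Qed.

Lemma continuous_lipschitz (f : R -> R) (L x : R) :
  (forall y, Rabs (f y - f x) <= L * Rabs (y - x)) -> continuous f x.
Proof.
  intros H. apply continuous_eps. intros eps Heps.
  assert (HL : 0 < Rabs L + 1) by (pose proof (Rabs_pos L); lra).
  exists (eps / (Rabs L + 1)). split; [now apply Rdiv_lt_0_compat|].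
  intros y Hy. eapply Rle_lt_trans; [apply H|].
  pose proof (Rabs_pos (y - x)). pose proof (Rle_abs L).
  assert (eps = (Rabs L + 1) * (eps / (Rabs L + 1))) by (field; lra). nra.
Qed.

Lemma cont_plus (f g : R -> R) (x : R) :
  continuous f x -> continuous g x -> continuous (fun x => f x + g x) x.
Proof. intros; now apply (continuous_plus (K := R_AbsRing) (V := R_NormedModule) f g). Qed.

Lemma cont_mult (f g : R -> R) (x : R) :
  continuous f x -> continuous g x -> continuous (fun x => f x * g x) x.
Proof. intros; now apply (continuous_mult (K := R_AbsRing) f g). Qed.

Lemma cont_opp (f : R -> R) (x : R) :
  continuous f x -> continuous (fun x => - f x) x.
Proof. intros; now apply (continuous_opp (K := R_AbsRing) (V := R_NormedModule) f). Qed.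

Lemma cont_minus (f g : R -> R) (x : R) :
  continuous f x -> continuous g x -> continuous (fun x => f x - g x) x.
Proof. intros; apply cont_plus; [assumption | now apply cont_opp]. Qed.

Lemma cont_const (c x : R) : continuous (fun _ : R => c) x.
Proof. apply continuous_const. Qed.

Lemma cont_id (x : R) : continuous (fun y : R => y) x.
Proof. apply continuous_id. Qed.

Lemma cont_pow (f : R -> R) (n : nat) (x : R) :
  continuous f x -> continuous (fun x => f x ^ n) x.
Proof.
  intros H; induction n as [|n IH]; simpl; [apply cont_const | now apply cont_mult].
Qed.

Lemma cont_comp (g f : R -> R) (x : R) :
  continuous f x -> continuous g (f x) -> continuous (fun x => g (f x)) x.
Proof. intros; now apply (continuous_comp f g). Qed.

Lemma cont_sum (f : nat -> R -> R) (n : nat) (x : R) :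
  (forall k, continuous (f k) x) -> continuous (fun x => sum_f_R0 (fun k => f k x) n) x.
Proof.
  intros H; induction n as [|n IH]; simpl; [apply H | apply cont_plus; auto].
Qed.

Create HintDb cont.

Ltac cont := intros; repeat match goal with
  | |- continuous (fun _ => ?c) _ => apply cont_const
  | |- continuous (fun x => x) _ => apply cont_id
  | |- continuous (fun x => @?f x + @?g x) _ => apply (cont_plus f g)
  | |- continuous (fun x => @?f x - @?g x) _ => apply (cont_minus f g)
  | |- continuous (fun x => @?f x * @?g x) _ => apply (cont_mult f g)
  | |- continuous (fun x => - @?f x) _ => apply (cont_opp f)
  | |- continuous (fun x => Rabs (@?f x)) _ => apply (continuous_Rabs_comp f)
  end; auto with cont.

(** Composition with it extends a function controlled only on [a, b] to one continuous on the whole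
    line, the form in which integrands are handled below. *)
Definition clamp (a b t : R) : R := Rmax a (Rmin b t).

Lemma clamp_in (a b t : R) : a <= b -> a <= clamp a b t <= b.
Proof.
  intros H; unfold clamp; split; [apply Rmax_l|].
  apply Rmax_lub; [exact H | apply Rmin_l].
Qed.

Lemma clamp_id (a b t : R) : a <= t <= b -> clamp a b t = t.
Proof. intros H; unfold clamp. rewrite Rmin_right by lra. apply Rmax_right; lra. Qed.

Lemma clamp_cont (a b t : R) : continuous (clamp a b) t.
Proof.
  apply (continuous_lipschitz _ 1). intros y. rewrite Rmult_1_l.
  unfold clamp, Rmax, Rmin. 
  repeat destruct Rle_dec; unfold Rabs; repeat destruct Rcase_abs; lra.
Qed.

#[export] Hint Resolve clamp_cont : cont.

(** * Numerical series, domination and termwise integration *)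

Lemma ser_eps (a : nat -> R) (l : R) :
  is_series a l <->
  forall eps, 0 < eps -> exists N, forall n, (N <= n)%nat -> Rabs (sum_f_R0 a n - l) < eps.
Proof.
  split.
  - intros H eps Heps. apply is_series_Reals in H. destruct (H eps Heps) as [N HN].
    exists N. intros n Hn. now apply (HN n).
  - intros H. apply is_series_Reals. intros eps Heps. destruct (H eps Heps) as [N HN].
    exists N. intros n Hn. now apply (HN n).
Qed.

Lemma ser_plus (a b : nat -> R) (la lb : R) :
  is_series a la -> is_series b lb -> is_series (fun n => a n + b n) (la + lb).
Proof. intros; now apply (is_series_plus (K := R_AbsRing) (V := R_NormedModule) a b). Qed.

Lemma ser_scal (a : nat -> R) (c l : R) :
  is_series a l -> is_series (fun n => c * a n) (c * l).
Proof. intros; now apply (is_series_scal (K := R_AbsRing) (V := R_NormedModule) c a). Qed.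

Lemma ser_opp (a : nat -> R) (l : R) :
  is_series a l -> is_series (fun n => - a n) (- l).
Proof. intros; now apply (is_series_opp (K := R_AbsRing) (V := R_NormedModule) a). Qed.

Lemma ser_ext (a b : nat -> R) (l : R) :
  (forall n, a n = b n) -> is_series a l -> is_series b l.
Proof. intros; now apply (is_series_ext a). Qed.

Lemma ser_uniq (a : nat -> R) (l l' : R) : is_series a l -> is_series a l' -> l = l'.
Proof. intros H H'. rewrite <- (is_series_unique _ _ H). now apply is_series_unique. Qed.

Lemma ser_pos_part (a : nat -> R) (l : R) (n : nat) :
  (forall n, 0 <= a n) -> is_series a l -> sum_f_R0 a n <= l.
Proof.
  intros Ha H. apply is_series_Reals in H. apply (sum_incr a n l); [|exact Ha].
  intros eps Heps. destruct (H eps Heps) as [N HN]. now exists N.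
Qed.

Lemma ser_pos_bdd (a : nat -> R) (M : R) :
  (forall n, 0 <= a n) -> (forall n, sum_f_R0 a n <= M) ->
  exists l, is_series a l /\ 0 <= l <= M.
Proof.
  intros Ha HM.
  destruct (ex_finite_lim_seq_incr (sum_f_R0 a) M) as [l Hl].
  - intros n. simpl. specialize (Ha (S n)). lra.
  - exact HM.
  - assert (Hs : is_series a l).
    { apply ser_eps. intros eps Heps. apply is_lim_seq_spec in Hl.
      destruct (Hl (mkposreal _ Heps)) as [N HN]. exists N. intros n Hn. now apply HN. }
    exists l. split; [exact Hs|]. split.
    + pose proof (ser_pos_part a l 0 Ha Hs). simpl in H. specialize (Ha 0%nat). lra.
    + apply le_epsilon; intros eps Heps. apply ser_eps with (eps := eps) in Hs; [|exact Heps].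
      destruct Hs as [N HN]. specialize (HN N (Nat.le_refl N)). specialize (HM N).
      apply Rabs_def2 in HN. lra.
Qed.

Lemma ser_le (a b : nat -> R) (la lb : R) :
  (forall n, a n <= b n) -> is_series a la -> is_series b lb -> la <= lb.
Proof.
  intros Hab Ha Hb. apply le_epsilon; intros eps Heps.
  destruct (proj1 (ser_eps _ _) Ha (eps / 2)) as [N HN]; [lra|].
  destruct (proj1 (ser_eps _ _) Hb (eps / 2)) as [N' HN']; [lra|].
  specialize (HN (max N N') (Nat.le_max_l _ _)). specialize (HN' (max N N') (Nat.le_max_r _ _)).
  pose proof (sum_growing a b (max N N') Hab).
  apply Rabs_def2 in HN. apply Rabs_def2 in HN'. lra.
Qed.

Lemma ser_dom (a b : nat -> R) (B : R) :
  (forall n, Rabs (a n) <= b n) -> is_series b B ->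
  exists l, is_series a l /\ Rabs l <= B.
Proof.
  intros Hab Hb.
  assert (Hex : ex_series a).
  { apply (ex_series_le (K := R_AbsRing) (V := R_CompleteNormedModule) a b Hab). now exists B. }
  destruct Hex as [l Hl]. exists l. split; [exact Hl|].
  apply Rabs_le. split.
  - assert (- l <= B); [|lra].
    apply (ser_le (fun n => - a n) b); [|now apply ser_opp | exact Hb].
    intros n. specialize (Hab n). apply Rabs_le_between in Hab. lra.
  - apply (ser_le a b); [|assumption | assumption].
    intros n. specialize (Hab n). apply Rabs_le_between in Hab. lra.
Qed.

Lemma ser_tail (a b : nat -> R) (l B : R) (n : nat) :
  (forall n, Rabs (a n) <= b n) -> is_series b B -> is_series a l ->
  Rabs (l - sum_f_R0 a n) <= B - sum_f_R0 b n.
Proof.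
  intros Hab Hb Ha.
  assert (Hs : forall m, Rabs (sum_f_R0 a (m + n) - sum_f_R0 a n) <= sum_f_R0 b (m + n) - sum_f_R0 b n).
  { induction m as [|m IH]; simpl.
    - rewrite Rminus_diag, Rabs_R0. lra.
    - replace (sum_f_R0 a (m + n) + a (S (m + n)) - sum_f_R0 a n)
        with ((sum_f_R0 a (m + n) - sum_f_R0 a n) + a (S (m + n))) by ring.
      eapply Rle_trans; [apply Rabs_triang|]. specialize (Hab (S (m + n))). lra. }
  apply le_epsilon; intros eps Heps.
  destruct (proj1 (ser_eps _ _) Ha (eps / 2)) as [N HN]; [lra|].
  destruct (proj1 (ser_eps _ _) Hb (eps / 2)) as [N' HN']; [lra|].
  set (m := (N + N')%nat).
  specialize (HN (m + n)%nat ltac:(lia)). specialize (HN' (m + n)%nat ltac:(lia)).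
  specialize (Hs m). apply Rabs_le_between in Hs.
  apply Rabs_def2 in HN. apply Rabs_def2 in HN'. apply Rabs_le. lra.
Qed.

Lemma ser_geom_bound (a : nat -> R) (l C q : R) :
  0 <= q < 1 -> (forall n, Rabs (sum_f_R0 a n - l) <= C * q ^ n) -> is_series a l.
Proof.
  intros Hq H. apply ser_eps. intros eps Heps.
  assert (HC : 0 < Rabs C + 1) by (pose proof (Rabs_pos C); lra).
  destruct (pow_lt_1_zero q ltac:(rewrite Rabs_right; lra) (eps / (Rabs C + 1))) as [N HN].
  { now apply Rdiv_lt_0_compat. }
  exists N. intros n Hn. specialize (HN n ltac:(lia)). eapply Rle_lt_trans; [apply H|].
  assert (Hqn : 0 <= q ^ n) by (apply pow_le; lra).
  rewrite Rabs_right in HN by lra. pose proof (Rle_abs C).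
  assert (eps = (Rabs C + 1) * (eps / (Rabs C + 1))) by (field; lra). nra.
Qed.

Lemma ser_geom (M q : R) : 0 <= q < 1 -> is_series (fun n => M * q ^ n) (M / (1 - q)).
Proof.
  intros Hq. unfold Rdiv. apply ser_scal. apply is_series_geom. rewrite Rabs_right; lra.
Qed.

Lemma ser_sum_swap (x : nat -> nat -> R) (l : nat -> R) (N : nat) :
  (forall k, is_series (fun n => x n k) (l k)) ->
  is_series (fun n => sum_f_R0 (fun k => x n k) N) (sum_f_R0 l N).
Proof.
  intros H; induction N as [|N IH]; simpl; [apply H | apply ser_plus; auto].
Qed.

Lemma sum_scal (c : R) (a : nat -> R) (n : nat) :
  sum_f_R0 (fun k => c * a k) n = c * sum_f_R0 a n.
Proof. symmetry. rewrite scal_sum. apply sum_eq. intros; ring. Qed.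

Lemma geom_part (q : R) (n : nat) : q <> 1 -> / (1 - q) - sum_f_R0 (fun k => q ^ k) n = q ^ S n / (1 - q).
Proof. intros Hq. rewrite tech3 by exact Hq. field. lra. Qed.

Lemma RInt_sum (f : nat -> R -> R) (x0 x1 : R) (n : nat) :
  (forall k x, continuous (f k) x) ->
  RInt (fun x => sum_f_R0 (fun k => f k x) n) x0 x1 = sum_f_R0 (fun k => RInt (f k) x0 x1) n.
Proof.
  intros Hf. induction n as [|n IH]; simpl; [reflexivity|]. rewrite <- IH.
  apply (RInt_plus (V := R_CompleteNormedModule) (fun x => sum_f_R0 (fun k => f k x) n) (f (S n)));
    apply ex_RInt_cont; [intros x; apply cont_sum; intros; apply Hf | apply Hf].
Qed.

(** Weierstrass test. The existential form hands over a sum continuous on all of R, although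
    convergence is known only on [x0, x1]. *)
Lemma series_continuous (f : nat -> R -> R) (b : nat -> R) (B x0 x1 : R) :
  x0 <= x1 ->
  (forall n x, continuous (f n) x) ->
  (forall n x, x0 <= x <= x1 -> Rabs (f n x) <= b n) -> is_series b B ->
  exists F, (forall x, continuous F x) /\
    (forall x, x0 <= x <= x1 -> is_series (fun n => f n x) (F x)) /\
    (forall x, x0 <= x <= x1 -> Rabs (F x) <= B) /\
    is_series (fun n => RInt (f n) x0 x1) (RInt F x0 x1).
Proof.
  intros Hx Hf Hb HB.
  set (F := fun x => Series (fun n => f n (clamp x0 x1 x))).
  assert (HF : forall x, is_series (fun n => f n (clamp x0 x1 x)) (F x) /\ Rabs (F x) <= B).
  { intros x. destruct (ser_dom (fun n => f n (clamp x0 x1 x)) b B) as (l & Hl & Hl2); [|exact HB|].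
    - intros n. apply Hb. now apply clamp_in.
    - unfold F. rewrite (is_series_unique _ _ Hl). now split. }
  assert (HT : forall x n, Rabs (F x - sum_f_R0 (fun k => f k (clamp x0 x1 x)) n) <= B - sum_f_R0 b n).
  { intros x n. apply ser_tail; [|exact HB | apply HF]. intros k. apply Hb. now apply clamp_in. }
  assert (HFc : forall x, continuous F x).
  { intros x. apply continuous_eps. intros eps Heps.
    destruct (proj1 (ser_eps _ _) HB (eps / 4)) as [N HN]; [lra|].
    specialize (HN N (Nat.le_refl N)). apply Rabs_def2 in HN.
    assert (Hc : continuous (fun x => sum_f_R0 (fun k => f k (clamp x0 x1 x)) N) x).
    { apply (cont_sum (fun k x => f k (clamp x0 x1 x))). intros k.
      apply (cont_comp (f k) (clamp x0 x1)); [apply clamp_cont | apply Hf]. }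
    apply continuous_eps with (eps := eps / 4) in Hc; [|lra].
    destruct Hc as (d & Hd & Hc). exists d. split; [exact Hd|]. intros y Hy.
    specialize (Hc y Hy). pose proof (HT x N) as T1. pose proof (HT y N) as T2.
    apply Rabs_def2 in Hc. apply Rabs_le_between in T1. apply Rabs_le_between in T2.
    apply Rabs_def1; lra. }
  exists F. split; [exact HFc|]. split; [|split].
  - intros x Hxx. destruct (HF x) as [H _]. now rewrite clamp_id in H.
  - intros x _. apply HF.
  - apply ser_eps. intros eps Heps.
    assert (He : 0 < eps / (x1 - x0 + 1)) by (apply Rdiv_lt_0_compat; lra).
    destruct (proj1 (ser_eps _ _) HB _ He) as [N HN]. exists N. intros n Hn.
    specialize (HN n Hn).
    assert (Hcs : Cont (fun x => sum_f_R0 (fun k => f k x) n)).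
    { intros x. apply cont_sum. intros k. apply Hf. }
    rewrite <- RInt_sum by exact Hf.
    rewrite <- (RInt_minus (V := R_CompleteNormedModule) (fun x => sum_f_R0 (fun k => f k x) n) F)
      by (apply ex_RInt_cont; assumption).
    eapply Rle_lt_trans.
    + apply (abs_RInt_le_const _ x0 x1 (eps / (x1 - x0 + 1))); [exact Hx| |].
      * apply ex_RInt_cont. intros x. apply cont_minus; [apply Hcs | apply HFc].
      * intros x Hxx. specialize (HT x n). rewrite clamp_id in HT by exact Hxx.
        apply Rabs_def2 in HN. apply Rabs_le_between in HT. apply Rabs_le.
        unfold minus, plus, opp; simpl. lra.
    + assert (eps = (x1 - x0 + 1) * (eps / (x1 - x0 + 1))) by (field; lra). nra.
Qed.

(** * Families of power series *)

(* [u t mu] is, for [t] in [[a, b]], the sum of a power series in [mu] with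
   coefficients continuous in [t] and weighted l^1-norm at most [M] on the disc
   of radius [r]. *)
Definition AnF (a b r : R) (u : R -> R -> R) (M : R) : Prop :=
  exists c : nat -> R -> R,
    (forall k x, continuous (c k) x) /\
    (forall t n, a <= t <= b -> sum_f_R0 (fun k => Rabs (c k t) * r ^ k) n <= M) /\
    (forall t mu, a <= t <= b -> Rabs mu < r -> is_series (fun k => c k t * mu ^ k) (u t mu)).

Section AnF.
Variables a b r : R.
Hypothesis Hab : a <= b.
Hypothesis Hr : 0 < r.

Notation An := (AnF a b r).

Lemma AnF_ext (u v : R -> R -> R) (M : R) :
  (forall t mu, a <= t <= b -> Rabs mu < r -> u t mu = v t mu) -> An u M -> An v M.
Proof.
  intros He (c & H1 & H2 & H3). exists c. split; [exact H1 | split; [exact H2|]].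
  intros t mu Ht Hmu. rewrite <- He by assumption. now apply H3.
Qed.

Lemma AnF_le (u : R -> R -> R) (M M' : R) : M <= M' -> An u M -> An u M'.
Proof.
  intros He (c & H1 & H2 & H3). exists c. split; [exact H1 | split; [|exact H3]].
  intros t n Ht. specialize (H2 t n Ht). lra.
Qed.

Lemma coef_bound (c : nat -> R -> R) (M : R) :
  (forall t n, a <= t <= b -> sum_f_R0 (fun k => Rabs (c k t) * r ^ k) n <= M) ->
  forall t k, a <= t <= b -> Rabs (c k t) * r ^ k <= M.
Proof.
  intros H t k Ht. specialize (H t k Ht). eapply Rle_trans; [|exact H].
  assert (Hp : forall j, 0 <= Rabs (c j t) * r ^ j).
  { intros j. apply Rmult_le_pos; [apply Rabs_pos | apply pow_le; lra]. }
  destruct k as [|k]; simpl; [lra|]. pose proof (cond_pos_sum _ k Hp). simpl in *. lra.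
Qed.

Lemma term_bound (x M mu : R) (k : nat) :
  Rabs x * r ^ k <= M -> Rabs (x * mu ^ k) <= M * (Rabs mu / r) ^ k.
Proof.
  intros H. rewrite Rabs_mult, <- RPow_abs. unfold Rdiv. rewrite Rpow_mult_distr, pow_inv.
  assert (0 < r ^ k) by now apply pow_lt.
  assert (0 <= Rabs mu ^ k) by (apply pow_le, Rabs_pos).
  replace (Rabs x * Rabs mu ^ k) with (Rabs x * r ^ k * (Rabs mu ^ k * / r ^ k)) by (field; lra).
  apply Rmult_le_compat_r; [|exact H].
  apply Rmult_le_pos; [assumption|]. left. now apply Rinv_0_lt_compat.
Qed.

Lemma ratio_lt (mu : R) : Rabs mu < r -> 0 <= Rabs mu / r < 1.
Proof.
  intros H. split.
  - apply Rmult_le_pos; [apply Rabs_pos|]. left. now apply Rinv_0_lt_compat.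
  - apply Rmult_lt_reg_r with r; [exact Hr|]. unfold Rdiv. rewrite Rmult_assoc, Rinv_l by lra. lra.
Qed.

Lemma AnF_nonneg (u : R -> R -> R) (M : R) : An u M -> 0 <= M.
Proof.
  intros (c & _ & H & _). specialize (H a 0%nat ltac:(lra)). simpl in H.
  pose proof (Rabs_pos (c 0%nat a)). lra.
Qed.

Lemma AnF_bound (u : R -> R -> R) (M t mu : R) :
  An u M -> a <= t <= b -> Rabs mu < r -> Rabs (u t mu) <= M.
Proof.
  intros (c & _ & H2 & H3) Ht Hmu.
  destruct (ser_pos_bdd (fun k => Rabs (c k t) * r ^ k) M) as (l & Hl & Hl2).
  - intros k. apply Rmult_le_pos; [apply Rabs_pos | apply pow_le; lra].
  - intros n; now apply H2.
  - destruct (ser_dom (fun k => c k t * mu ^ k) (fun k => Rabs (c k t) * r ^ k) l) as (l' & Hl' & Hl'2).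
    + intros k. rewrite Rabs_mult, <- RPow_abs. apply Rmult_le_compat_l; [apply Rabs_pos|].
      apply pow_incr. split; [apply Rabs_pos | lra].
    + exact Hl.
    + rewrite (ser_uniq _ _ _ (H3 t mu Ht Hmu) Hl'). lra.
Qed.

(** A family is pinned down only for [t] in [a, b]; [v] is a representative continuous everywhere,
    as the rules for [RInt] demand. *)
Lemma AnF_continuous (u : R -> R -> R) (M mu : R) :
  An u M -> Rabs mu < r ->
  exists v, Cont v /\ forall t, a <= t <= b -> v t = u t mu.
Proof.
  intros (c & H1 & H2 & H3) Hmu.
  destruct (series_continuous (fun k t => c k t * mu ^ k) (fun k => M * (Rabs mu / r) ^ k) (M / (1 - Rabs mu / r)) a b Hab)
    as (F & HF & HF2 & _ & _).
  - intros n x. cont.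
  - intros n x Hx. apply term_bound. now apply (coef_bound c M H2).
  - apply ser_geom. now apply ratio_lt.
  - exists F. split; [exact HF|]. intros t Ht.
    apply (ser_uniq _ _ _ (HF2 t Ht)). now apply H3.
Qed.

Lemma AnF_fun (f : R -> R) (M : R) :
  Cont f -> (forall t, a <= t <= b -> Rabs (f t) <= M) ->
  An (fun t _ => f t) M.
Proof.
  intros Hf HM. exists (fun k t => match k with O => f t | _ => 0 end). split; [|split].
  - intros [|k] x; [apply Hf | apply cont_const].
  - intros t n Ht. replace (sum_f_R0 _ n) with (Rabs (f t)); [now apply HM|].
    induction n as [|n IH]; simpl; [ring|]. rewrite <- IH, Rabs_R0. ring.
  - intros t mu Ht Hmu. apply (ser_geom_bound _ _ 0 0); [lra|]. intros n.
    replace (sum_f_R0 _ n) with (f t); [rewrite Rminus_diag, Rabs_R0; lra|].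
    induction n as [|n IH]; simpl; [ring|]. rewrite <- IH. ring.
Qed.

Lemma AnF_const (x M : R) : Rabs x <= M -> An (fun _ _ => x) M.
Proof. intros H. apply (AnF_fun (fun _ => x)); [intros; apply cont_const | auto]. Qed.

Lemma AnF_id : An (fun _ mu => mu) r.
Proof.
  exists (fun k _ => match k with 1%nat => 1 | _ => 0 end). split; [|split].
  - intros k x. destruct k as [|[|k]]; apply cont_const.
  - intros t n Ht.
    assert (E : forall n, sum_f_R0 (fun k => Rabs (match k with 1%nat => 1 | _ => 0 end) * r ^ k) (S n) = r).
    { induction n0 as [|n0 IH]; [simpl; rewrite Rabs_R0, Rabs_R1; ring|].
      rewrite tech5, IH. rewrite Rabs_R0. ring. }
    destruct n; [simpl; rewrite Rabs_R0; lra | rewrite E; lra].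
  - intros t mu Ht Hmu.
    assert (E : forall n, sum_f_R0 (fun k => (match k with 1%nat => 1 | _ => 0 end) * mu ^ k) (S n) = mu).
    { induction n as [|n IH]; [simpl; ring|]. rewrite tech5, IH. ring. }
    apply ser_eps. intros eps Heps. exists 1%nat. intros [|n] Hn; [lia|].
    rewrite E, Rminus_diag, Rabs_R0. exact Heps.
Qed.

Lemma AnF_plus (u v : R -> R -> R) (M M' : R) :
  An u M -> An v M' -> An (fun t mu => u t mu + v t mu) (M + M').
Proof.
  intros (c & H1 & H2 & H3) (c' & H1' & H2' & H3').
  exists (fun k t => c k t + c' k t). split; [|split].
  - intros k x. now apply cont_plus.
  - intros t n Ht. specialize (H2 t n Ht). specialize (H2' t n Ht).
    eapply Rle_trans; [|apply Rplus_le_compat; [exact H2 | exact H2']].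
    rewrite <- sum_plus. apply sum_growing. intros k.
    rewrite <- Rmult_plus_distr_r. apply Rmult_le_compat_r; [apply pow_le; lra | apply Rabs_triang].
  - intros t mu Ht Hmu. apply ser_ext with (fun k => c k t * mu ^ k + c' k t * mu ^ k).
    + intros; ring.
    + apply ser_plus; auto.
Qed.

(** Cauchy product: the weighted l^1 norm is submultiplicative, which makes the families a Banach
    algebra. *)
Lemma AnF_mult (u v : R -> R -> R) (M M' : R) :
  An u M -> An v M' -> An (fun t mu => u t mu * v t mu) (M * M').
Proof.
  intros Hu Hv.
  pose proof (AnF_nonneg _ _ Hu) as HM. pose proof (AnF_nonneg _ _ Hv) as HM'.
  destruct Hu as (c & H1 & H2 & H3). destruct Hv as (c' & H1' & H2' & H3').
  exists (fun k t => sum_f_R0 (fun i => c i t * c' (k - i)%nat t) k). split; [|split].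
  - intros k x. apply (cont_sum (fun i t => c i t * c' (k - i)%nat t)). intros i. now apply cont_mult.
  - intros t n Ht.
    assert (Hp : forall (c : nat -> R -> R) k, 0 <= Rabs (c k t) * r ^ k).
    { intros c0 k. apply Rmult_le_pos; [apply Rabs_pos | apply pow_le; lra]. }
    destruct (ser_pos_bdd (fun k => Rabs (c k t) * r ^ k) M) as (l & Hl & Hl2); [apply Hp | intros; now apply H2|].
    destruct (ser_pos_bdd (fun k => Rabs (c' k t) * r ^ k) M') as (l' & Hl' & Hl2'); [apply Hp | intros; now apply H2'|].
    pose proof (is_series_mult_pos _ _ _ _ Hl Hl' (Hp c) (Hp c')) as Hm.
    eapply Rle_trans; [|apply Rmult_le_compat; [| |apply (proj2 Hl2) | apply (proj2 Hl2')]]; [|tauto | tauto].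
    eapply Rle_trans; [|apply (ser_pos_part _ _ n) with (2 := Hm)].
    + apply sum_growing. intros k.
      eapply Rle_trans; [apply Rmult_le_compat_r; [apply pow_le; lra | apply Rsum_abs]|].
      rewrite Rmult_comm, scal_sum. apply sum_Rle. intros i Hi.
      rewrite Rabs_mult. replace (r ^ k) with (r ^ i * r ^ (k - i)).
      * right; ring.
      * rewrite <- pow_add. f_equal. lia.
    + intros k. apply cond_pos_sum. intros i. apply Rmult_le_pos; apply Hp.
  - intros t mu Ht Hmu.
    assert (Ha : forall (c : nat -> R -> R) (M : R),
      (forall t n, a <= t <= b -> sum_f_R0 (fun k => Rabs (c k t) * r ^ k) n <= M) ->
      ex_series (fun k => Rabs (c k t * mu ^ k))).
    { intros c0 M0 Hc0. destruct (ser_dom (fun k => Rabs (c0 k t * mu ^ k)) (fun k => M0 * (Rabs mu / r) ^ k) (M0 / (1 - Rabs mu / r))) as (l & Hl & _).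
      - intros k. rewrite Rabs_Rabsolu. apply term_bound. now apply (coef_bound c0 M0 Hc0).
      - apply ser_geom. now apply ratio_lt.
      - now exists l. }
    pose proof (is_series_mult _ _ _ _ (H3 t mu Ht Hmu) (H3' t mu Ht Hmu) (Ha c M H2) (Ha c' M' H2')) as Hm.
    revert Hm. apply ser_ext. intros k. rewrite Rmult_comm, scal_sum. apply sum_eq. intros i Hi.
    replace (mu ^ k) with (mu ^ i * mu ^ (k - i)); [ring|]. rewrite <- pow_add. f_equal. lia.
Qed.

Lemma AnF_scal (x : R) (u : R -> R -> R) (M : R) :
  An u M -> An (fun t mu => x * u t mu) (Rabs x * M).
Proof. intros H. apply (AnF_mult (fun _ _ => x)); [apply AnF_const; lra | exact H]. Qed.

Lemma AnF_opp (u : R -> R -> R) (M : R) : An u M -> An (fun t mu => - u t mu) M.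
Proof.
  intros H. apply (AnF_scal (-1)) in H. apply AnF_le with (M' := M) in H.
  - revert H. apply AnF_ext. intros; ring.
  - rewrite Rabs_left; lra.
Qed.

Lemma AnF_minus (u v : R -> R -> R) (M M' : R) :
  An u M -> An v M' -> An (fun t mu => u t mu - v t mu) (M + M').
Proof. intros Hu Hv. apply (AnF_plus u (fun t mu => - v t mu)); [exact Hu | now apply AnF_opp]. Qed.

Lemma AnF_pow (u : R -> R -> R) (M : R) (n : nat) : An u M -> An (fun t mu => u t mu ^ n) (M ^ n).
Proof.
  intros H; induction n as [|n IH]; simpl.
  - apply AnF_const. rewrite Rabs_R1; lra.
  - now apply AnF_mult.
Qed.

(** Completeness of the algebra: the coefficients are summed separately, and each sum is continuous
    by the Weierstrass test since |c n k| <= M n / r^k. *)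
Lemma AnF_series (u : nat -> R -> R -> R) (U : R -> R -> R) (M : nat -> R) (S : R) :
  (forall n, An (u n) (M n)) -> is_series M S ->
  (forall t mu, a <= t <= b -> Rabs mu < r -> is_series (fun n => u n t mu) (U t mu)) ->
  An U S.
Proof.
  intros Hu HM HU.
  destruct (functional_choice _ Hu) as [c Hc]. clear Hu.
  assert (Hcb : forall n k t, a <= t <= b -> Rabs (c n k t) <= M n * (/ r) ^ k).
  { intros n k t Ht. destruct (Hc n) as (_ & H2 & _).
    pose proof (coef_bound _ _ H2 t k Ht) as Hk. rewrite pow_inv.
    assert (0 < r ^ k) by now apply pow_lt.
    apply Rmult_le_reg_r with (r ^ k); [assumption|]. rewrite Rmult_assoc, Rinv_l by lra. lra. }
  assert (HC : forall k, exists C : R -> R, Cont C /\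
     forall t, a <= t <= b -> is_series (fun n => c n k t) (C t)).
  { intros k.
    destruct (series_continuous (fun n t => c n k t) (fun n => (/ r) ^ k * M n) ((/ r) ^ k * S) a b Hab)
      as (F & HF & HF2 & _ & _).
    - intros n x. destruct (Hc n) as (H1 & _). apply H1.
    - intros n x Hx. rewrite Rmult_comm. now apply Hcb.
    - now apply ser_scal.
    - exists F. now split. }
  destruct (functional_choice _ HC) as [C HCC]. exists C. split; [|split].
  - intros k x. apply HCC.
  - intros t n Ht.
    assert (Habs : forall k, exists l, is_series (fun n => Rabs (c n k t)) l /\ Rabs (C k t) <= l).
    { intros k.
      destruct (ser_dom (fun n => Rabs (c n k t)) (fun n => (/ r) ^ k * M n) ((/ r) ^ k * S)) as (l & Hl & _).
      - intros m. rewrite Rabs_Rabsolu, Rmult_comm. now apply Hcb.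
      - now apply ser_scal.
      - exists l. split; [exact Hl|].
        destruct (ser_dom (fun n => c n k t) (fun n => Rabs (c n k t)) l) as (l' & Hl' & Hb'); [intros; lra | exact Hl|].
        now rewrite (ser_uniq _ _ _ (proj2 (HCC k) t Ht) Hl'). }
    destruct (functional_choice _ Habs) as [L HL].
    apply Rle_trans with (sum_f_R0 (fun k => L k * r ^ k) n).
    + apply sum_growing. intros k. apply Rmult_le_compat_r; [apply pow_le; lra | apply HL].
    + apply (ser_le (fun m => sum_f_R0 (fun k => Rabs (c m k t) * r ^ k) n) M).
      * intros m. destruct (Hc m) as (_ & H2 & _). now apply H2.
      * apply (ser_sum_swap (fun m k => Rabs (c m k t) * r ^ k) (fun k => L k * r ^ k)). intros k.
        rewrite Rmult_comm. apply ser_ext with (fun m => r ^ k * Rabs (c m k t)); [intros; ring|].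
        apply ser_scal. apply HL.
      * exact HM.
  (* Interchange of the two sums: cutting [u n] at order K costs at most M n q^(K+1) / (1 - q),
     which sums over n to a quantity geometric in K. *)
  - intros t mu Ht Hmu. pose proof (ratio_lt mu Hmu) as Hq. set (q := Rabs mu / r) in *.
    apply (ser_geom_bound _ _ (S * (q / (1 - q))) q); [exact Hq|]. intros K.
    assert (H1 : is_series (fun n => sum_f_R0 (fun k => c n k t * mu ^ k) K) (sum_f_R0 (fun k => C k t * mu ^ k) K)).
    { apply (ser_sum_swap (fun n k => c n k t * mu ^ k) (fun k => C k t * mu ^ k)). intros k.
      rewrite Rmult_comm. apply ser_ext with (fun m => mu ^ k * c m k t); [intros; ring|].
      apply ser_scal. now apply HCC. }
    assert (H2 := ser_plus _ _ _ _ H1 (ser_opp _ _ (HU t mu Ht Hmu))).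
    destruct (ser_dom (fun n => sum_f_R0 (fun k => c n k t * mu ^ k) K + - u n t mu) (fun n => q ^ (1 + K) / (1 - q) * M n) (q ^ (1 + K) / (1 - q) * S)) as (l & Hl & Hlb).
    + intros n. destruct (Hc n) as (_ & G2 & G3).
      assert (T := ser_tail (fun k => c n k t * mu ^ k) (fun k => M n * q ^ k) (u n t mu) (M n / (1 - q)) K).
      rewrite Rabs_minus_sym in T. eapply Rle_trans; [apply T|].
      * intros k. apply term_bound. now apply (coef_bound _ _ G2).
      * now apply ser_geom.
      * now apply G3.
      * rewrite sum_scal. unfold Rdiv at 1. rewrite <- Rmult_minus_distr_l, geom_part by lra.
        right; simpl; ring.
    + now apply ser_scal.
    + change (sum_f_R0 (fun k => C k t * mu ^ k) K - U t mu) with (sum_f_R0 (fun k => C k t * mu ^ k) K + - U t mu).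
      rewrite (ser_uniq _ _ _ H2 Hl). eapply Rle_trans; [exact Hlb|]. right. simpl. field. lra.
Qed.

End AnF.

(* [ring] reads the carrier off the left-hand side, which for a bare [RInt] is
   a normed module and not [R]. *)
Ltac ringR := match goal with |- @eq _ ?x ?y => apply (Rplus_eq_reg_l 0 x y); ring end.

(** * Elementary functions and integral operators acting on families *)

Lemma inv_fact_pos (n : nat) : 0 < / INR (fact n).
Proof. apply Rinv_0_lt_compat, INR_fact_lt_0. Qed.

Lemma inv_fact_le (n m : nat) : (n <= m)%nat -> / INR (fact m) <= / INR (fact n).
Proof. intros H. apply Rinv_le_contravar; [apply INR_fact_lt_0 | apply le_INR, fact_le, H]. Qed.

Lemma exp_opp_le (x : R) : 0 <= x -> 0 < exp (- x) <= 1.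
Proof.
  intros H. split; [apply exp_pos|]. rewrite <- exp_0.
  destruct H as [H| <-]; [left; apply exp_increasing; lra | rewrite Ropp_0; lra].
Qed.

Lemma exp_series (x : R) : is_series (fun k => / INR (fact k) * x ^ k) (exp x).
Proof. apply is_series_Reals. unfold exp. exact (proj2_sig (exist_exp x)). Qed.

Lemma cos_series (x : R) : is_series (fun k => cos_n k * (x * x) ^ k) (cos x).
Proof. unfold cos. destruct (exist_cos (Rsqr x)) as [l Hl]. apply is_series_Reals. exact Hl. Qed.

Lemma sin_series (x : R) : is_series (fun k => x * (sin_n k * (x * x) ^ k)) (sin x).
Proof.
  unfold sin. destruct (exist_sin (Rsqr x)) as [l Hl]. apply ser_scal. apply is_series_Reals. exact Hl.
Qed.

Lemma cos_n_bound (n : nat) : Rabs (cos_n n) <= / INR (fact n).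
Proof.
  unfold cos_n, Rdiv. rewrite Rabs_mult, pow_1_abs, Rmult_1_l.
  rewrite Rabs_right by (left; apply inv_fact_pos). apply inv_fact_le. lia.
Qed.

Lemma sin_n_bound (n : nat) : Rabs (sin_n n) <= / INR (fact n).
Proof.
  unfold sin_n, Rdiv. rewrite Rabs_mult, pow_1_abs, Rmult_1_l.
  rewrite Rabs_right by (left; apply inv_fact_pos). apply inv_fact_le. lia.
Qed.

Lemma lipschitz_derive (f df : R -> R) (L : R) :
  (forall x, is_derive f x (df x)) -> (forall x, Rabs (df x) <= L) ->
  forall x y, Rabs (f x - f y) <= L * Rabs (x - y).
Proof.
  intros Hf HL x y. destruct (MVT_gen f y x df) as (c & _ & Hc).
  - intros; apply Hf.
  - intros z _. apply continuity_pt_filterlim.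
    apply (ex_derive_continuous (K := R_AbsRing) (V := R_NormedModule)). now exists (df z).
  - rewrite Hc, Rabs_mult. apply Rmult_le_compat_r; [apply Rabs_pos | apply HL].
Qed.

Lemma cont_derive (f : R -> R) (x l : R) : is_derive f x l -> continuous f x.
Proof.
  intros H. apply (ex_derive_continuous (K := R_AbsRing) (V := R_NormedModule)). now exists l.
Qed.

Lemma RInt_is_derive (F f : R -> R) (a b : R) :
  (forall x, is_derive F x (f x)) -> Cont f -> RInt f a b = F b - F a.
Proof.
  intros HF Hf. apply (is_RInt_unique (V := R_CompleteNormedModule)).
  apply (is_RInt_derive (V := R_CompleteNormedModule) F f); intros; auto.
Qed.

Lemma cont_bounded (f : R -> R) (a b : R) :
  a <= b -> Cont f -> exists K, forall t, a <= t <= b -> Rabs (f t) <= K.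
Proof.
  intros Hab Hf. destruct (continuity_ab_maj (fun x => Rabs (f x)) a b Hab) as (m & Hm & _).
  - intros c _. apply continuity_pt_filterlim. now apply continuous_Rabs_comp.
  - exists (Rabs (f m)). exact Hm.
Qed.

Lemma RInt_mono (f g : R -> R) (a b : R) :
  a <= b -> Cont f -> Cont g ->
  (forall x, a <= x <= b -> f x <= g x) -> RInt f a b <= RInt g a b.
Proof.
  intros Hab Hf Hg H. apply RInt_le; [exact Hab | now apply ex_RInt_cont | now apply ex_RInt_cont|].
  intros; apply H; lra.
Qed.

Lemma RInt_abs_mono (f g : R -> R) (a b : R) :
  a <= b -> Cont f -> Cont g ->
  (forall x, a <= x <= b -> Rabs (f x) <= g x) -> Rabs (RInt f a b) <= RInt g a b.
Proof.
  intros Hab Hf Hg H. eapply Rle_trans; [apply abs_RInt_le; [exact Hab | now apply ex_RInt_cont]|].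
  apply RInt_mono; auto. intros; now apply continuous_Rabs_comp.
Qed.

Lemma RInt_scalR (f : R -> R) (u a b : R) :
  Cont f -> RInt (fun x => u * f x) a b = u * RInt f a b.
Proof.
  intros Hf. now rewrite (RInt_scal (V := R_CompleteNormedModule) f) by now apply ex_RInt_cont.
Qed.

Lemma RInt_minusR (f g : R -> R) (a b : R) :
  Cont f -> Cont g ->
  RInt (fun x => f x - g x) a b = RInt f a b - RInt g a b.
Proof.
  intros Hf Hg. now rewrite (RInt_minus (V := R_CompleteNormedModule) f g) by now apply ex_RInt_cont.
Qed.

Lemma RInt_plusR (f g : R -> R) (a b : R) :
  Cont f -> Cont g ->
  RInt (fun x => f x + g x) a b = RInt f a b + RInt g a b.
Proof.
  intros Hf Hg. now rewrite (RInt_plus (V := R_CompleteNormedModule) f g) by now apply ex_RInt_cont.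
Qed.

Lemma RInt_const_R (c a b : R) : RInt (fun _ => c) a b = c * (b - a).
Proof. rewrite (RInt_const (V := R_CompleteNormedModule)). unfold scal; simpl; unfold mult; simpl. ring. Qed.

Lemma RInt_nonneg (f : R -> R) (a b : R) :
  a <= b -> Cont f -> (forall x, 0 <= f x) -> 0 <= RInt f a b.
Proof.
  intros Hab Hf H. rewrite <- (Rmult_0_l (b - a)), <- RInt_const_R.
  apply RInt_mono; auto. intros; apply cont_const.
Qed.

Lemma RInt_eq (f g : R -> R) (a b : R) :
  (forall x, f x = g x) -> RInt f a b = RInt g a b.
Proof. intros H. apply RInt_ext. intros x _. apply H. Qed.

Lemma RInt_ext_in (f g : R -> R) (a b : R) :
  a <= b -> (forall x, a <= x <= b -> f x = g x) -> RInt f a b = RInt g a b.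
Proof.
  intros Hab H. apply RInt_ext. intros x. rewrite Rmin_left, Rmax_right by lra. intros; apply H; lra.
Qed.

Section Entire.
Variables a b r : R.
Hypothesis Hab : a <= b.
Hypothesis Hr : 0 < r.

Lemma AnF_exp (u : R -> R -> R) (M : R) :
  AnF a b r u M -> AnF a b r (fun t mu => exp (u t mu)) (exp M).
Proof.
  intros Hu.
  apply (AnF_series a b r Hab Hr (fun k t mu => / INR (fact k) * u t mu ^ k) _ (fun k => / INR (fact k) * M ^ k)).
  - intros n. apply AnF_le with (Rabs (/ INR (fact n)) * M ^ n).
    + rewrite Rabs_right by (left; apply inv_fact_pos). lra.
    + apply AnF_scal; auto. now apply AnF_pow.
  - apply exp_series.
  - intros; apply exp_series.
Qed.

(** The point is the factor [M]: a small exponent gives a small family, as differences of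
    exponentials require. It comes from pulling one [u] out of each term and from 1/(k+1)! <=
    1/k!. *)
Lemma AnF_expm1 (u : R -> R -> R) (M : R) :
  AnF a b r u M -> AnF a b r (fun t mu => exp (u t mu) - 1) (M * exp M).
Proof.
  intros Hu. pose proof (AnF_nonneg a b r Hab u M Hu) as HM.
  apply (AnF_series a b r Hab Hr (fun k t mu => / INR (fact (S k)) * u t mu ^ S k) _ (fun k => M * (/ INR (fact k) * M ^ k))).
  - intros n. apply AnF_le with (Rabs (/ INR (fact (S n))) * M ^ S n).
    + rewrite Rabs_right by (left; apply inv_fact_pos). rewrite <- tech_pow_Rmult. assert (0 <= M * M ^ n) by (apply Rmult_le_pos; [exact HM | now apply pow_le]).
      pose proof (inv_fact_le n (S n) ltac:(lia)). nra.
    + apply AnF_scal; auto. now apply AnF_pow.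
  - apply ser_scal. apply exp_series.
  - intros t mu _ _.
    apply (is_series_incr_1 (K := R_AbsRing) (V := R_NormedModule) (fun k => / INR (fact k) * u t mu ^ k)).
    unfold plus; simpl. replace (exp (u t mu) - 1 + / 1 * 1) with (exp (u t mu)) by field.
    apply exp_series.
Qed.

(** The series runs in u^2 with coefficients of size 1/(2n)! <= 1/n!, hence [exp (M * M)] in place
    of the sharper cosh M. *)
Lemma AnF_cos (u : R -> R -> R) (M : R) :
  AnF a b r u M -> AnF a b r (fun t mu => cos (u t mu)) (exp (M * M)).
Proof.
  intros Hu. pose proof (AnF_nonneg a b r Hab u M Hu) as HM.
  apply (AnF_series a b r Hab Hr (fun k t mu => cos_n k * (u t mu * u t mu) ^ k) _ (fun k => / INR (fact k) * (M * M) ^ k)).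
  - intros n. apply AnF_le with (Rabs (cos_n n) * (M * M) ^ n).
    + apply Rmult_le_compat_r; [apply pow_le; nra | apply cos_n_bound].
    + apply AnF_scal; auto. apply AnF_pow; auto. now apply AnF_mult.
  - apply exp_series.
  - intros; apply cos_series.
Qed.

Lemma AnF_sin (u : R -> R -> R) (M : R) :
  AnF a b r u M -> AnF a b r (fun t mu => sin (u t mu)) (M * exp (M * M)).
Proof.
  intros Hu. pose proof (AnF_nonneg a b r Hab u M Hu) as HM.
  apply (AnF_series a b r Hab Hr (fun k t mu => u t mu * (sin_n k * (u t mu * u t mu) ^ k)) _ (fun k => M * (/ INR (fact k) * (M * M) ^ k))).
  - intros n. apply AnF_le with (M * (Rabs (sin_n n) * (M * M) ^ n)).
    + apply Rmult_le_compat_l; [exact HM|].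
      apply Rmult_le_compat_r; [apply pow_le; nra | apply sin_n_bound].
    + apply AnF_mult; auto. apply AnF_scal; auto. apply AnF_pow; auto. now apply AnF_mult.
  - apply ser_scal. apply exp_series.
  - intros; apply sin_series.
Qed.

Lemma AnF_inv (u : R -> R -> R) :
  AnF a b r u (/ 2) -> AnF a b r (fun t mu => / (1 + u t mu)) 2.
Proof.
  intros Hu.
  apply (AnF_series a b r Hab Hr (fun k t mu => (- u t mu) ^ k) _ (fun k => 1 * (/ 2) ^ k)).
  - intros n. rewrite Rmult_1_l. apply AnF_pow; auto. now apply AnF_opp.
  - pose proof (ser_geom 1 (/ 2) ltac:(lra)) as H.
    assert (E : 1 / (1 - / 2) = 2) by field. now rewrite E in H.
  - intros t mu Ht Hmu. replace (1 + u t mu) with (1 - (- u t mu)) by ring.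
    apply is_series_geom. rewrite Rabs_Ropp.
    pose proof (AnF_bound a b r Hr u (/ 2) t mu Hu Ht Hmu). lra.
Qed.

Lemma AnF_volterra (u : R -> R -> R) (M : R) :
  AnF a b r u M -> AnF a b r (fun T mu => RInt (fun t => u t mu) a T) ((b - a) * M).
Proof.
  intros Hu. pose proof (AnF_nonneg a b r Hab u M Hu) as HM.
  destruct Hu as (c & H1 & H2 & H3).
  exists (fun k T => RInt (c k) a T). split; [|split].
  - intros k x. now apply continuous_RInt_cont.
  - intros T n HT.
    apply Rle_trans with (sum_f_R0 (fun k => RInt (fun t => Rabs (c k t) * r ^ k) a T) n).
    + apply sum_growing. intros k.
      rewrite (RInt_eq (fun t => Rabs (c k t) * r ^ k) (fun t => r ^ k * Rabs (c k t))) by (intros; ring).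
      rewrite RInt_scalR by (intros; now apply continuous_Rabs_comp). rewrite Rmult_comm.
      apply Rmult_le_compat_l; [apply pow_le; lra|]. apply abs_RInt_le; [lra | now apply ex_RInt_cont].
    + assert (Hc : forall k x, continuous (fun t => Rabs (c k t) * r ^ k) x).
      { intros. cont. }
      rewrite <- (RInt_sum (fun k t => Rabs (c k t) * r ^ k)) by exact Hc.
      apply Rle_trans with (RInt (fun _ => M) a T).
      * apply RInt_mono; [lra | intros; now apply cont_sum | intros; apply cont_const|].
        intros x Hx. apply H2. lra.
      * rewrite RInt_const_R. nra.
  - intros T mu HT Hmu.
    destruct (series_continuous (fun k t => c k t * mu ^ k) (fun k => M * (Rabs mu / r) ^ k) (M / (1 - Rabs mu / r)) a T)
      as (F & HF & HF2 & _ & HF3).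
    + lra.
    + intros n x. cont.
    + intros n x Hx. apply term_bound; [exact Hr|]. apply (coef_bound a b r Hr c M H2). lra.
    + apply ser_geom. now apply ratio_lt.
    + rewrite (RInt_ext_in (fun t => u t mu) F) ; [|lra|].
      * revert HF3. apply ser_ext. intros k.
        rewrite (RInt_eq (fun t => c k t * mu ^ k) (fun t => mu ^ k * c k t)) by (intros; ring).
        rewrite RInt_scalR by apply H1. ring.
      * intros x Hx. apply (ser_uniq (fun k => c k x * mu ^ k)); [apply H3; auto; lra | apply HF2; lra].
Qed.

(* The kernel is only required to be Lipschitz in its first argument, which is
   all that continuity of the coefficients needs. *)
Lemma AnF_kernel (a' b' L bd : R) (k u : R -> R -> R) (M : R) :
  a' <= b' -> 
  (forall T t, continuous (k T) t) ->
  (forall T T' t, a' <= t <= b' -> Rabs (k T t - k T' t) <= L * Rabs (T - T')) ->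
  (forall T, a <= T <= b -> RInt (fun t => Rabs (k T t)) a' b' <= bd) ->
  AnF a' b' r u M ->
  AnF a b r (fun T mu => RInt (fun t => k T t * u t mu) a' b') (bd * M).
Proof.
  intros Hab' Hk HL Hbd Hu. pose proof (AnF_nonneg a' b' r Hab' u M Hu) as HM.
  destruct Hu as (c & H1 & H2 & H3).
  assert (Hkc : forall T j x, continuous (fun t => k T t * c j t) x) by (intros; apply cont_mult; auto).
  exists (fun j T => RInt (fun t => k T t * c j t) a' b'). split; [|split].
  - intros j T. apply (continuous_lipschitz _ (L * RInt (fun t => Rabs (c j t)) a' b')). intros T'.
    rewrite <- RInt_minusR by apply Hkc.
    replace (L * RInt (fun t => Rabs (c j t)) a' b' * Rabs (T' - T))
      with ((L * Rabs (T' - T)) * RInt (fun t => Rabs (c j t)) a' b') by ring.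
    assert (Hca : Cont (fun t => Rabs (c j t))) by (intros; now apply continuous_Rabs_comp).
    rewrite <- RInt_scalR by exact Hca.
    apply RInt_abs_mono; [exact Hab' | | |].
    + intros; apply cont_minus; apply Hkc.
    + cont.
    + intros t Ht. rewrite <- Rmult_minus_distr_r, Rabs_mult.
      apply Rmult_le_compat_r; [apply Rabs_pos | now apply HL].
  - intros T n HT.
    assert (Hc : forall j x, continuous (fun t => Rabs (c j t) * r ^ j) x).
    { intros. cont. }
    assert (Hka : Cont (fun t => Rabs (k T t))) by (intros; now apply continuous_Rabs_comp).
    assert (Hkc2 : forall j x, continuous (fun t => Rabs (k T t) * (Rabs (c j t) * r ^ j)) x).
    { intros; apply cont_mult; auto. }
    apply Rle_trans with (sum_f_R0 (fun j => RInt (fun t => Rabs (k T t) * (Rabs (c j t) * r ^ j)) a' b') n).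
    + apply sum_growing. intros j.
      rewrite <- (Rabs_right (r ^ j)) at 1 by (left; now apply pow_lt).
      rewrite <- Rabs_mult, Rmult_comm, <- RInt_scalR by apply Hkc.
      apply RInt_abs_mono; auto.
      * cont.
      * intros t Ht. rewrite !Rabs_mult. rewrite (Rabs_right (r ^ j)) by (left; now apply pow_lt). right; ring.
    + rewrite <- (RInt_sum (fun j t => Rabs (k T t) * (Rabs (c j t) * r ^ j))) by exact Hkc2.
      apply Rle_trans with (RInt (fun t => M * Rabs (k T t)) a' b').
      * apply RInt_mono; [exact Hab' | intros; now apply cont_sum | cont|].
        intros t Ht. rewrite sum_scal. rewrite Rmult_comm.
        apply Rmult_le_compat_r; [apply Rabs_pos | now apply H2].
      * rewrite RInt_scalR by exact Hka. rewrite Rmult_comm. apply Rmult_le_compat_r; [exact HM | now apply Hbd].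
  - intros T mu HT Hmu.
    destruct (cont_bounded (k T) a' b' Hab' (Hk T)) as [K HK].
    destruct (series_continuous (fun j t => k T t * c j t * mu ^ j) (fun j => (K * M) * (Rabs mu / r) ^ j) (K * M / (1 - Rabs mu / r)) a' b')
      as (F & HF & HF2 & _ & HF3).
    + exact Hab'.
    + intros n x. cont.
    + intros n x Hx. apply term_bound; [exact Hr|]. rewrite Rabs_mult, Rmult_assoc.
      apply Rmult_le_compat; [apply Rabs_pos | | now apply HK | now apply (coef_bound a' b' r Hr c M H2)].
      apply Rmult_le_pos; [apply Rabs_pos | apply pow_le; lra].
    + apply ser_geom. now apply ratio_lt.
    + rewrite (RInt_ext_in (fun t => k T t * u t mu) F) ; [|lra|].
      * revert HF3. apply ser_ext. intros j.
        rewrite (RInt_eq (fun t => k T t * c j t * mu ^ j) (fun t => mu ^ j * (k T t * c j t))) by (intros; ring).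
        rewrite RInt_scalR by apply Hkc. ring.
      * intros x Hx. apply (ser_uniq (fun j => k T x * c j x * mu ^ j)); [|now apply HF2].
        apply ser_ext with (fun j => k T x * (c j x * mu ^ j)); [intros; ring|].
        apply ser_scal. now apply H3.
Qed.

End Entire.

(** * Logarithmic series and the regular part of the deformed kernel *)

Lemma ln1p_series (x : R) : Rabs x < 1 ->
  is_series (fun n => (-1) ^ n / INR (S n) * x ^ S n) (ln (1 + x)).
Proof.
  intros Hx. apply Rabs_def2 in Hx.
  (* The geometric series of 1 / (1 + s) is integrated termwise over an ordered interval; (0, x) and
     (x, 0) then serve the two signs of x. *)
  assert (Hcase : forall lo hi, lo <= 0 <= hi -> -1 < lo -> hi < 1 ->
    is_series (fun n => (-1) ^ n / INR (S n) * (hi ^ S n - lo ^ S n)) (ln (1 + hi) - ln (1 + lo))).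
  { intros lo hi Hlh Hlo Hhi. set (q := Rmax hi (- lo)).
    assert (Hq : 0 <= q < 1).
    { unfold q. split; [eapply Rle_trans; [|apply Rmax_l]; lra | apply Rmax_lub_lt; lra]. }
    destruct (series_continuous (fun n s => (- s) ^ n) (fun n => 1 * q ^ n) (1 / (1 - q)) lo hi)
      as (F & HF & HF2 & _ & HF3).
    - lra.
    - intros n s. apply (cont_pow (fun s => - s)). apply cont_opp, cont_id.
    - intros n s Hs. rewrite Rmult_1_l, <- RPow_abs, Rabs_Ropp. apply pow_incr. split; [apply Rabs_pos|].
      unfold q. apply Rabs_le. pose proof (Rmax_l hi (- lo)). pose proof (Rmax_r hi (- lo)). lra.
    - now apply ser_geom.
    - replace (ln (1 + hi) - ln (1 + lo)) with (RInt F lo hi).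
      + revert HF3. apply ser_ext. intros n.
        rewrite (RInt_is_derive (fun s => (-1) ^ n / INR (S n) * s ^ S n)); [ring| |].
        * intros s. auto_derive; [exact I|]. 
          replace (- s) with (-1 * s) by ring. rewrite Rpow_mult_distr.
          change (match n with 0%nat => 1 | S _ => INR n + 1 end) with (INR (S n)).
          field. apply not_0_INR. lia.
        * intros s. apply (cont_pow (fun s => - s)). apply cont_opp, cont_id.
      + apply (is_RInt_unique (V := R_CompleteNormedModule)).
        apply (is_RInt_ext (V := R_NormedModule) (fun s => / (1 + s))).
        * intros s. rewrite Rmin_left, Rmax_right by lra. intros Hs.
          symmetry. apply (ser_uniq (fun n => (- s) ^ n)); [apply HF2; lra|].
          replace (1 + s) with (1 - (- s)) by ring. apply is_series_geom.
          rewrite Rabs_Ropp. apply Rabs_def1; lra.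
        * apply (is_RInt_derive (V := R_CompleteNormedModule) (fun s => ln (1 + s)) (fun s => / (1 + s))).
          -- intros s. rewrite Rmin_left, Rmax_right by lra. intros Hs. auto_derive; [lra | field; lra].
          -- intros s. rewrite Rmin_left, Rmax_right by lra. intros Hs.
             apply (cont_derive _ s (- / (1 + s) ^ 2)). auto_derive; [lra | field; lra]. }
  assert (Hz : forall n, 0 ^ S n = 0) by (intros; simpl; ring).
  destruct (Rle_or_lt 0 x) as [H|H].
  - specialize (Hcase 0 x ltac:(lra) ltac:(lra) ltac:(lra)).
    rewrite Rplus_0_r, ln_1, Rminus_0_r in Hcase. revert Hcase. apply ser_ext. intros n. rewrite Hz. ring.
  - specialize (Hcase x 0 ltac:(lra) ltac:(lra) ltac:(lra)).
    rewrite Rplus_0_r, ln_1 in Hcase. apply ser_opp in Hcase.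
    replace (- (0 - ln (1 + x))) with (ln (1 + x)) in Hcase by ring.
    revert Hcase. apply ser_ext. intros n. rewrite Hz. ring.
Qed.

Lemma pow_diff_le (x y : R) (n : nat) :
  Rabs x <= 1 -> Rabs y <= 1 -> Rabs (x ^ n - y ^ n) <= INR n * Rabs (x - y).
Proof.
  intros Hx Hy. induction n as [|n IH].
  - simpl. rewrite Rminus_diag, Rabs_R0. lra.
  - replace (x ^ S n - y ^ S n) with (x * (x ^ n - y ^ n) + (x - y) * y ^ n) by (simpl; ring).
    eapply Rle_trans; [apply Rabs_triang|]. rewrite !Rabs_mult, S_INR.
    assert (Rabs (y ^ n) <= 1).
    { rewrite <- RPow_abs. rewrite <- (pow1 n). apply pow_incr. split; [apply Rabs_pos | exact Hy]. }
    pose proof (Rabs_pos (x - y)). pose proof (Rabs_pos (x ^ n - y ^ n)). pose proof (Rabs_pos (y ^ n)).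
    pose proof (Rabs_pos x). nra.
Qed.

(** Expanding the logarithm in powers of [l mu], each coefficient is an integral operator with
    kernel q^(n+1) g, of norm at most [bd] because |q| <= 1. It serves twice: with [g = w], [u = 1]
    for the far field and with [g = 1], [u] the unknown for the near field. *)
Lemma AnF_logker (a b r a' b' L bd M : R) (q u : R -> R -> R) (g l : R -> R) :
  a <= b -> 0 < r -> a' <= b' ->
  (forall T t, continuous (q T) t) -> (forall T t, Rabs (q T t) <= 1) ->
  (forall T T' t, Rabs (q T t - q T' t) <= L * Rabs (T - T')) ->
  Cont g -> RInt (fun t => Rabs (g t)) a' b' <= bd ->
  AnF a' b' r u M -> AnF a b r (fun _ mu => l mu) (/ 4) ->
  AnF a b r (fun T mu => RInt (fun t => ln (1 + l mu * q T t) * (g t * u t mu)) a' b') (bd * M).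
Proof.
  intros Hab Hr Hab' Hq Hq1 HqL Hg Hbd Hu Hl.
  pose proof (AnF_nonneg a' b' r Hab' u M Hu) as HM.
  assert (Hga : Cont (fun t => Rabs (g t))) by (intros; now apply continuous_Rabs_comp).
  assert (Hbd0 : 0 <= bd).
  { eapply Rle_trans; [|exact Hbd]. apply RInt_nonneg; auto. intros; apply Rabs_pos. }
  destruct (cont_bounded g a' b' Hab' Hg) as [G HG].
  assert (Hqg : forall n T x, continuous (fun t => q T t ^ n * g t) x).
  { intros. apply cont_mult; [apply cont_pow, Hq | apply Hg]. }
  assert (Hqp : forall n T t, Rabs (q T t ^ n) <= 1).
  { intros n T t. rewrite <- RPow_abs. rewrite <- (pow1 n). apply pow_incr. split; [apply Rabs_pos | apply Hq1]. }
  assert (Hn1 : forall n, Rabs ((-1) ^ n / INR (S n)) <= 1).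
  { intros n. unfold Rdiv. rewrite Rabs_mult, pow_1_abs, Rmult_1_l. 
    assert (1 <= INR (S n)) by (rewrite S_INR; pose proof (pos_INR n); lra).
    rewrite Rabs_right by (left; apply Rinv_0_lt_compat; lra).
    rewrite <- Rinv_1. apply Rinv_le_contravar; lra. }
  (* The powers (1/4)^(n+1) sum to 1/3, so the stated bound has room to spare. *)
  apply AnF_le with (bd * M * / 4 / (1 - / 4)); [nra|].
  apply (AnF_series a b r Hab Hr
    (fun n T mu => (-1) ^ n / INR (S n) * (l mu ^ S n * RInt (fun t => (q T t ^ S n * g t) * u t mu) a' b')) _
    (fun n => (bd * M * / 4) * (/ 4) ^ n)).
  - intros n. apply AnF_le with (Rabs ((-1) ^ n / INR (S n)) * ((/ 4) ^ S n * (bd * M))).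
    + assert (0 <= (/ 4) ^ S n * (bd * M)).
      { apply Rmult_le_pos; [apply pow_le; lra | now apply Rmult_le_pos]. }
      specialize (Hn1 n). replace (bd * M * / 4 * (/ 4) ^ n) with ((/ 4) ^ S n * (bd * M)) by (simpl; ring). nra.
    + apply AnF_scal; auto. apply AnF_mult; auto.
      * apply (AnF_pow a b r Hab Hr (fun _ mu => l mu)). exact Hl.
      * apply (AnF_kernel a b r Hr a' b' (INR (S n) * L * G) bd (fun T t => q T t ^ S n * g t)); auto.
        -- intros T T' t Ht. rewrite <- Rmult_minus_distr_r, Rabs_mult.
           pose proof (pow_diff_le (q T t) (q T' t) (S n) (Hq1 T t) (Hq1 T' t)) as Hp.
           specialize (HqL T T' t). specialize (HG t Ht).
           pose proof (Rabs_pos (g t)). pose proof (pos_INR (S n)).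
           assert (INR (S n) * Rabs (q T t - q T' t) <= INR (S n) * (L * Rabs (T - T'))) by (apply Rmult_le_compat_l; assumption).
           replace (INR (S n) * L * G * Rabs (T - T')) with (INR (S n) * (L * Rabs (T - T')) * G) by ring.
           apply Rmult_le_compat; [apply Rabs_pos | apply Rabs_pos | lra | exact HG].
        -- intros T HT. eapply Rle_trans; [|exact Hbd].
           apply RInt_mono; auto.
           ++ intros; apply continuous_Rabs_comp. apply (Hqg (S n)).
           ++ intros t Ht. rewrite Rabs_mult. pose proof (Rabs_pos (g t)). specialize (Hqp (S n) T t). nra.
  - apply ser_geom. lra.
  - intros T mu HT Hmu.
    destruct (AnF_continuous a' b' r Hab' Hr u M mu Hu Hmu) as (v & Hv & Hvu).
    assert (Hlm : Rabs (l mu) <= / 4) by exact (AnF_bound a b r Hr _ _ a mu Hl ltac:(lra) Hmu).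
    destruct (series_continuous (fun n t => (-1) ^ n / INR (S n) * (l mu * q T t) ^ S n * (g t * v t)) (fun n => (/ 4 * (G * M)) * (/ 4) ^ n) ((/ 4 * (G * M)) / (1 - / 4)) a' b')
      as (F & HF & HF2 & _ & HF3).
    + exact Hab'.
    + intros n t. apply cont_mult; [|cont].
      cont. apply (cont_pow (fun t => l mu * q T t)).
      cont.
    + intros n t Ht. rewrite Rabs_mult.
      replace (/ 4 * (G * M) * (/ 4) ^ n) with (((/ 4) ^ S n) * (G * M)) by (simpl; ring).
      apply Rmult_le_compat; [apply Rabs_pos | apply Rabs_pos | |].
      * rewrite Rabs_mult. rewrite <- (Rmult_1_l ((/ 4) ^ S n)).
        apply Rmult_le_compat; [apply Rabs_pos | apply Rabs_pos | apply Hn1|].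
        rewrite <- RPow_abs. apply pow_incr. split; [apply Rabs_pos|]. rewrite Rabs_mult.
        specialize (Hq1 T t). pose proof (Rabs_pos (q T t)). pose proof (Rabs_pos (l mu)). nra.
      * rewrite Rabs_mult. apply Rmult_le_compat; [apply Rabs_pos | apply Rabs_pos | now apply HG|].
        rewrite Hvu by exact Ht. now apply (AnF_bound a' b' r Hr u).
    + apply ser_geom; lra.
    + rewrite (RInt_ext_in _ F); [|exact Hab'|].
      * revert HF3. apply ser_ext. intros n.
        rewrite (RInt_ext_in (fun t => q T t ^ S n * g t * u t mu) (fun t => q T t ^ S n * g t * v t)); [|exact Hab' | intros; now rewrite Hvu].
        rewrite <- Rmult_assoc. rewrite <- RInt_scalR.
        -- apply RInt_eq. intros t. rewrite Rpow_mult_distr. ring.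
        -- intros t. apply cont_mult; [apply (Hqg (S n)) | apply Hv].
      * intros t Ht. apply (ser_uniq (fun n => (-1) ^ n / INR (S n) * (l mu * q T t) ^ S n * (g t * v t))); [|now apply HF2].
        rewrite Hvu by exact Ht. rewrite (Rmult_comm (ln _)).
        apply ser_ext with (fun n => (g t * u t mu) * ((-1) ^ n / INR (S n) * (l mu * q T t) ^ S n)); [intros; ring|].
        apply ser_scal. apply ln1p_series. rewrite Rabs_mult.
        specialize (Hq1 T t). pose proof (Rabs_pos (q T t)). pose proof (Rabs_pos (l mu)). nra.
Qed.

(** * The logarithmic potential *)

(** Smooth even substitute for ln |x|, accurate for |x| well above 4^-n. The geometric scale makes
    consecutive differences summable. *)
Definition lreg (n : nat) (x : R) : R := / 2 * ln (x ^ 2 + (/ 16) ^ n).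

Lemma lreg_arg_pos (n : nat) (x : R) : 0 < x ^ 2 + (/ 16) ^ n.
Proof. assert (0 < (/ 16) ^ n) by (apply pow_lt; lra). nra. Qed.

Lemma lreg_derive (n : nat) (x : R) : is_derive (lreg n) x (x / (x ^ 2 + (/ 16) ^ n)).
Proof.
  pose proof (lreg_arg_pos n x) as Hp. unfold lreg. auto_derive; [exact Hp|].
  simpl in *. field. lra.
Qed.

Lemma lreg_cont (n : nat) (x : R) : continuous (lreg n) x.
Proof. exact (cont_derive _ _ _ (lreg_derive n x)). Qed.

Lemma lreg_shift_cont (n : nat) (T t : R) : continuous (fun t => lreg n (T - t)) t.
Proof.
  apply (cont_comp (lreg n) (fun t => T - t)); [|apply lreg_cont].
  cont.
Qed.

#[export] Hint Resolve lreg_cont lreg_shift_cont : cont.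

Lemma lreg_lip (n : nat) (x y : R) : Rabs (lreg n x - lreg n y) <= (1 + 16 ^ n) * Rabs (x - y).
Proof.
  apply (lipschitz_derive (lreg n) (fun x => x / (x ^ 2 + (/ 16) ^ n))); [apply lreg_derive|].
  intros z. pose proof (lreg_arg_pos n z) as Hp.
  assert (H16 : 0 < (/ 16) ^ n) by (apply pow_lt; lra).
  assert (E : (/ 16) ^ n * 16 ^ n = 1) by (rewrite <- Rpow_mult_distr, Rinv_l by lra; apply pow1).
  assert (0 < 16 ^ n) by (apply pow_lt; lra).
  unfold Rdiv. rewrite Rabs_mult, (Rabs_right (/ _)) by (left; now apply Rinv_0_lt_compat).
  apply Rmult_le_reg_r with (z ^ 2 + (/ 16) ^ n); [exact Hp|].
  rewrite Rmult_assoc, Rinv_l, Rmult_1_r by lra.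
  rewrite <- (pow2_abs z). pose proof (Rabs_pos z). set (w := Rabs z) in *.
  assert (0 <= 16 ^ n * w ^ 2) by (apply Rmult_le_pos; [lra | nra]).
  destruct (Rle_or_lt w 1); nra.
Qed.

Lemma ln_le_minus (x : R) : 0 < x -> ln x <= x - 1.
Proof. intros H. rewrite <- (ln_exp (x - 1)). apply ln_le; [exact H|]. pose proof (exp_ineq1_le (x - 1)). lra. Qed.

Lemma ln_nonneg (x : R) : 1 <= x -> 0 <= ln x.
Proof. intros H. rewrite <- ln_1. apply ln_le; lra. Qed.

(** What ln y <= y - 1 yields for the ratio of the arguments of two consecutive [lreg]: a Cauchy
    kernel of width 4^-(n+1). *)
Definition kdiff (n : nat) (x : R) : R := 15 / 32 * (/ 16) ^ n / (x ^ 2 + (/ 16) ^ S n).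

Lemma lreg_diff_bound (n : nat) (x : R) : Rabs (lreg (S n) x - lreg n x) <= kdiff n x.
Proof.
  pose proof (lreg_arg_pos n x) as H1. pose proof (lreg_arg_pos (S n) x) as H2.
  assert (He : 0 < (/ 16) ^ n) by (apply pow_lt; lra).
  unfold lreg, kdiff. rewrite <- Rmult_minus_distr_l, <- ln_div by assumption.
  assert (Hq : ln ((x ^ 2 + (/ 16) ^ S n) / (x ^ 2 + (/ 16) ^ n)) <= 0).
  { rewrite <- ln_1. apply ln_le; [now apply Rdiv_lt_0_compat|].
    apply Rmult_le_reg_r with (x ^ 2 + (/ 16) ^ n); [exact H1|].
    unfold Rdiv. rewrite Rmult_assoc, Rinv_l by lra. simpl. lra. }
  rewrite Rabs_left1 by lra.
  rewrite ln_div in * by assumption.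
  assert (Hl := ln_le_minus ((x ^ 2 + (/ 16) ^ n) / (x ^ 2 + (/ 16) ^ S n)) ltac:(now apply Rdiv_lt_0_compat)).
  rewrite ln_div in Hl by assumption.
  replace ((x ^ 2 + (/ 16) ^ n) / (x ^ 2 + (/ 16) ^ S n) - 1)
    with (15 / 16 * (/ 16) ^ n / (x ^ 2 + (/ 16) ^ S n)) in Hl by (change ((/ 16) ^ S n) with (/ 16 * (/ 16) ^ n) in *; field; lra).
  replace (15 / 32 * (/ 16) ^ n / (x ^ 2 + (/ 16) ^ S n)) with (/ 2 * (15 / 16 * (/ 16) ^ n / (x ^ 2 + (/ 16) ^ S n))) by (field; lra).
  lra.
Qed.

Lemma cont_cauchy (c e T t : R) : 0 < e -> continuous (fun t => c / ((T - t) ^ 2 + e)) t.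
Proof.
  intros He. assert (Hp : 0 < (T - t) ^ 2 + e) by (pose proof (pow2_ge_0 (T - t)); lra).
  apply (cont_derive _ t (c * (2 * (T - t)) / ((T - t) ^ 2 + e) ^ 2)).
  auto_derive; [simpl in *; lra|]. simpl in *. field. lra.
Qed.

Lemma kdiff_cont (n : nat) (T t : R) : continuous (fun t => kdiff n (T - t)) t.
Proof. apply (cont_cauchy (15 / 32 * (/ 16) ^ n)). apply pow_lt; lra. Qed.

Lemma kdiff_max (n : nat) (x : R) : kdiff n x <= 15 / 2.
Proof.
  unfold kdiff. assert (He : 0 < (/ 16) ^ n) by (apply pow_lt; lra).
  pose proof (lreg_arg_pos (S n) x) as H2.
  apply Rmult_le_reg_r with (x ^ 2 + (/ 16) ^ S n); [exact H2|].
  unfold Rdiv at 1. rewrite (Rmult_assoc _ (/ (x ^ 2 + _))), Rinv_l by lra. simpl. nra.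
Qed.

Lemma pow16_4 (n : nat) : (/ 16) ^ n = (/ 4) ^ n * (/ 4) ^ n.
Proof. rewrite <- Rpow_mult_distr. f_equal. lra. Qed.

Lemma RInt_atan_kernel (c e T a b : R) : 0 < e -> 0 <= c -> a <= b ->
  RInt (fun t => c / ((T - t) ^ 2 + e ^ 2)) a b <= 4 * c / e.
Proof.
  intros He Hc Hab.
  assert (Hp : forall t, 0 < (T - t) ^ 2 + e ^ 2) by (intros; pose proof (pow2_ge_0 (T - t)); nra).
  rewrite (RInt_is_derive (fun t => - (c / e) * atan ((T - t) / e))).
  - pose proof (atan_bound ((T - b) / e)). pose proof (atan_bound ((T - a) / e)).
    pose proof PI_4. assert (0 <= c / e) by (apply Rmult_le_pos; [exact Hc | left; now apply Rinv_0_lt_compat]).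
    replace (4 * c / e) with (c / e * 4) by (field; lra).
    match goal with |- ?x <= _ => replace x with (c / e * (atan ((T - a) / e) - atan ((T - b) / e))) by ring end.
    apply Rmult_le_compat_l; lra.
  - intros t. specialize (Hp t). auto_derive; [exact I|]. simpl in *. unfold Rsqr. field.
    repeat split; lra.
  - intros t. apply cont_cauchy. now apply pow_lt.
Qed.

Lemma sq_le_le (x y : R) : 0 <= y -> x * x <= y * y -> x <= y.
Proof. intros. nra. Qed.

(** Geometric mean of two bounds: 15/2 (b - a) from the maximum of the kernel and 15/2 4^-n from its
    mass. Neither alone is both small with b - a and summable in n. *)
Lemma kdiff_RInt (n : nat) (T a b : R) : a <= b ->
  RInt (fun t => kdiff n (T - t)) a b <= 15 / 2 * sqrt (b - a) * (/ 2) ^ n.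
Proof.
  intros Hab.
  assert (H1 : RInt (fun t => kdiff n (T - t)) a b <= 15 / 2 * (b - a)).
  { apply Rle_trans with (RInt (fun _ => 15 / 2) a b).
    - apply RInt_mono; [exact Hab | apply kdiff_cont | intros; apply cont_const | intros; apply kdiff_max].
    - rewrite RInt_const_R. lra. }
  assert (He : 0 < (/ 4) ^ n) by (apply pow_lt; lra).
  assert (H2 : RInt (fun t => kdiff n (T - t)) a b <= 15 / 2 * (/ 4) ^ n).
  { rewrite (RInt_eq _ (fun t => (15 / 32 * (/ 16) ^ n) / ((T - t) ^ 2 + (/ 4 * (/ 4) ^ n) ^ 2))).
    - eapply Rle_trans; [apply RInt_atan_kernel; [lra | | exact Hab]|].
      + rewrite pow16_4. nra.
      + rewrite pow16_4. right. field. lra.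
    - intros t. unfold kdiff. rewrite (pow16_4 (S n)). change ((/ 4) ^ S n) with (/ 4 * (/ 4) ^ n). f_equal. f_equal. ring. }
  assert (H0 : 0 <= RInt (fun t => kdiff n (T - t)) a b).
  { apply RInt_nonneg; [exact Hab | apply kdiff_cont|].
    intros t. eapply Rle_trans; [apply Rabs_pos | apply lreg_diff_bound]. }
  assert (H3 : 0 < (/ 2) ^ n) by (apply pow_lt; lra).
  apply sq_le_le.
  - pose proof (sqrt_pos (b - a)). apply Rmult_le_pos; [apply Rmult_le_pos; lra | lra].
  - replace (15 / 2 * sqrt (b - a) * (/ 2) ^ n * (15 / 2 * sqrt (b - a) * (/ 2) ^ n))
      with ((15 / 2 * (sqrt (b - a) * sqrt (b - a))) * (15 / 2 * ((/ 2) ^ n * (/ 2) ^ n))) by ring.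
    rewrite sqrt_sqrt by lra. rewrite <- Rpow_mult_distr. replace (/ 2 * / 2) with (/ 4) by lra.
    apply Rmult_le_compat; lra.
Qed.

Lemma lreg_diff_RInt (n : nat) (T a b : R) : a <= b ->
  RInt (fun t => Rabs (lreg (S n) (T - t) - lreg n (T - t))) a b <= 15 / 2 * sqrt (b - a) * (/ 2) ^ n.
Proof.
  intros Hab. eapply Rle_trans; [|apply (kdiff_RInt n T a b Hab)].
  apply RInt_mono; [exact Hab | | apply kdiff_cont | intros; apply lreg_diff_bound].
  intros x. apply continuous_Rabs_comp. apply cont_minus; apply lreg_shift_cont.
Qed.

(** The potential of [v] over [a, b] with kernel ln |T - t|, encoded as a telescoping series of
    Riemann integrals with smooth kernels, so that [AnF_series] applies. *)
Definition Lop (a b : R) (v : R -> R) (T : R) : R :=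
  RInt (fun t => lreg 0 (T - t) * v t) a b +
  Series (fun n => RInt (fun t => (lreg (S n) (T - t) - lreg n (T - t)) * v t) a b).

Lemma Lop_ext (a b : R) (v v' : R -> R) (T : R) :
  a <= b -> (forall t, a <= t <= b -> v t = v' t) -> Lop a b v T = Lop a b v' T.
Proof.
  intros Hab H. unfold Lop. f_equal.
  - apply RInt_ext_in; [exact Hab|]. intros; now rewrite H.
  - apply Series_ext. intros n. apply RInt_ext_in; [exact Hab|]. intros; now rewrite H.
Qed.

Lemma Lop_series (a b : R) (v : R -> R) (T : R) :
  a <= b -> Cont v ->
  is_series (fun n => RInt (fun t => (lreg (S n) (T - t) - lreg n (T - t)) * v t) a b)
    (Series (fun n => RInt (fun t => (lreg (S n) (T - t) - lreg n (T - t)) * v t) a b)).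
Proof.
  intros Hab Hv. destruct (cont_bounded v a b Hab Hv) as [K HK].
  assert (HK0 : 0 <= K) by (eapply Rle_trans; [apply Rabs_pos | apply (HK a); lra]).
  destruct (ser_dom (fun n => RInt (fun t => (lreg (S n) (T - t) - lreg n (T - t)) * v t) a b)
    (fun n => (K * (15 / 2 * sqrt (b - a))) * (/ 2) ^ n) ((K * (15 / 2 * sqrt (b - a))) / (1 - / 2))) as (l & Hl & _).
  - intros n.
    assert (Hc : Cont (fun t => lreg (S n) (T - t) - lreg n (T - t)))
      by (intros; apply cont_minus; apply lreg_shift_cont).
    apply Rle_trans with (RInt (fun t => K * Rabs (lreg (S n) (T - t) - lreg n (T - t))) a b).
    + apply RInt_abs_mono; [exact Hab | | |].
      * cont.
      * cont.
      * intros t Ht. rewrite Rabs_mult, Rmult_comm. apply Rmult_le_compat_r; [apply Rabs_pos | now apply HK].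
    + rewrite RInt_scalR by (intros; now apply continuous_Rabs_comp).
      rewrite Rmult_assoc. apply Rmult_le_compat_l; [exact HK0 | now apply lreg_diff_RInt].
  - apply ser_geom. lra.
  - rewrite (is_series_unique _ _ Hl). exact Hl.
Qed.

Lemma Lop_lim (a b : R) (v : R -> R) (T : R) :
  a <= b -> Cont v ->
  is_lim_seq (fun n => RInt (fun t => lreg n (T - t) * v t) a b) (Lop a b v T).
Proof.
  intros Hab Hv. apply is_lim_seq_incr_1. apply is_lim_seq_spec. intros eps.
  destruct (proj1 (ser_eps _ _) (Lop_series a b v T Hab Hv) eps (cond_pos eps)) as [N HN].
  exists N. intros n Hn. specialize (HN n Hn). unfold Lop.
  assert (E : forall n, RInt (fun t => lreg (S n) (T - t) * v t) a b =
    RInt (fun t => lreg 0 (T - t) * v t) a b +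
    sum_f_R0 (fun n => RInt (fun t => (lreg (S n) (T - t) - lreg n (T - t)) * v t) a b) n :> R).
  { assert (Hl : forall n x, continuous (fun t => lreg n (T - t) * v t) x)
      by (cont).
    assert (D : forall n, RInt (fun t => (lreg (S n) (T - t) - lreg n (T - t)) * v t) a b =
       RInt (fun t => lreg (S n) (T - t) * v t) a b - RInt (fun t => lreg n (T - t) * v t) a b :> R).
    { intros m. rewrite <- RInt_minusR by apply Hl. apply RInt_eq. intros; ringR. }
    induction n0 as [|m IH]; [simpl sum_f_R0; rewrite D; ringR|].
    rewrite tech5, <- Rplus_assoc, <- IH, D. ringR. }
  rewrite E. match goal with |- Rabs ?x < _ => match type of HN with Rabs ?y < _ => replace x with y by ring end end.
  exact HN.
Qed.

Lemma AnF_Lop (a b r : R) (u : R -> R -> R) (M : R) :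
  a <= b -> b - a <= 1 -> 0 < r -> AnF a b r u M ->
  AnF a b r (fun T mu => Lop a b (fun t => u t mu) T) (16 * sqrt (b - a) * M).
Proof.
  intros Hab Hab1 Hr Hu. pose proof (AnF_nonneg a b r Hab u M Hu) as HM.
  assert (Hs : b - a <= sqrt (b - a)).
  { apply sq_le_le; [apply sqrt_pos|]. rewrite sqrt_sqrt by lra. nra. }
  (* The first part is [lreg 0], at most 1 in size here, with b - a <= sqrt (b - a); the 15 is the
     sum of the 15/2 (1/2)^n. *)
  replace (16 * sqrt (b - a) * M) with (sqrt (b - a) * M + 15 * sqrt (b - a) * M) by ring.
  apply AnF_plus; auto.
  - apply (AnF_kernel a b r Hr a b (1 + 16 ^ 0) (sqrt (b - a)) (fun T t => lreg 0 (T - t))); auto.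
    + intros; apply lreg_shift_cont.
    + intros T T' t _. replace (T - T') with ((T - t) - (T' - t)) by ring. apply lreg_lip.
    + intros T HT. apply Rle_trans with (RInt (fun _ => 1) a b).
      * apply RInt_mono; [exact Hab | intros; apply continuous_Rabs_comp, lreg_shift_cont | intros; apply cont_const|].
        intros t Ht. unfold lreg. simpl ((/ 16) ^ 0).
        assert (-1 <= T - t <= 1) by lra.
        assert (0 <= (T - t) ^ 2 <= 1) by (set (z := T - t) in *; split; nra).
        assert (0 <= ln ((T - t) ^ 2 + 1)) by (apply ln_nonneg; lra).
        pose proof (ln_le_minus ((T - t) ^ 2 + 1) ltac:(lra)).
        rewrite Rabs_right by lra. lra.
      * rewrite RInt_const_R. lra.
  - apply (AnF_series a b r Hab Hr (fun n T mu => RInt (fun t => (lreg (S n) (T - t) - lreg n (T - t)) * u t mu) a b) _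
      (fun n => (15 / 2 * sqrt (b - a) * M) * (/ 2) ^ n)).
    + intros n. replace (15 / 2 * sqrt (b - a) * M * (/ 2) ^ n) with ((15 / 2 * sqrt (b - a) * (/ 2) ^ n) * M) by ring.
      apply (AnF_kernel a b r Hr a b ((1 + 16 ^ S n) + (1 + 16 ^ n)) _ (fun T t => lreg (S n) (T - t) - lreg n (T - t))); auto.
      * intros; apply cont_minus; apply lreg_shift_cont.
      * intros T T' t _. pose proof (lreg_lip (S n) (T - t) (T' - t)) as L1. pose proof (lreg_lip n (T - t) (T' - t)) as L2.
        replace (T - t - (T' - t)) with (T - T') in * by ring.
        match goal with |- Rabs ?x <= _ => replace x with ((lreg (S n) (T - t) - lreg (S n) (T' - t)) + - (lreg n (T - t) - lreg n (T' - t))) by ring end.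
        eapply Rle_trans; [apply Rabs_triang|]. rewrite Rabs_Ropp. lra.
      * intros T HT. now apply lreg_diff_RInt.
    + pose proof (ser_geom (15 / 2 * sqrt (b - a) * M) (/ 2) ltac:(lra)) as H.
      replace (15 / 2 * sqrt (b - a) * M / (1 - / 2)) with (15 * sqrt (b - a) * M) in H by field. exact H.
    + intros T mu HT Hmu. destruct (AnF_continuous a b r Hab Hr u M mu Hu Hmu) as (v & Hv & Hvu).
      assert (E : forall n, RInt (fun t => (lreg (S n) (T - t) - lreg n (T - t)) * v t) a b =
        RInt (fun t => (lreg (S n) (T - t) - lreg n (T - t)) * u t mu) a b).
      { intros n. apply RInt_ext_in; [exact Hab|]. intros t Ht. now rewrite Hvu. }
      pose proof (Lop_series a b v T Hab Hv) as HS.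
      rewrite (Series_ext _ _ E) in HS. now apply ser_ext with (2 := HS).
Qed.

(** * Deformations of the line *)

Lemma pos_sq_derive (x : R) : is_derive (fun x => Rmax 0 x ^ 2) x (2 * Rmax 0 x).
Proof.
  apply is_derive_Reals. intros eps Heps. exists (mkposreal eps Heps). intros h Hh Hhe. simpl in Hhe.
  replace ((Rmax 0 (x + h) ^ 2 - Rmax 0 x ^ 2) / h - 2 * Rmax 0 x)
    with ((Rmax 0 (x + h) ^ 2 - Rmax 0 x ^ 2 - 2 * Rmax 0 x * h) / h) by (field; exact Hh).
  eapply Rle_lt_trans; [|exact Hhe]. unfold Rdiv. rewrite Rabs_mult, Rabs_inv.
  assert (Hp : 0 < Rabs h) by now apply Rabs_pos_lt.
  apply Rmult_le_reg_r with (Rabs h); [exact Hp|]. rewrite Rmult_assoc, Rinv_l, Rmult_1_r by lra.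
  replace (Rabs h * Rabs h) with (h ^ 2) by (rewrite <- pow2_abs; ring).
  unfold Rmax. destruct (Rle_dec 0 (x + h)); destruct (Rle_dec 0 x); apply Rabs_le; split; nra.
Qed.

(** Through [clamp], which is 1-Lipschitz, the bump estimates reduce to polynomial inequalities on
    [-1, 1]. *)
Lemma bump_profile (y : R) :
  Rmax 0 (1 - y ^ 2) = 1 - clamp (-1) 1 y ^ 2 /\
  y * Rmax 0 (1 - y ^ 2) = clamp (-1) 1 y * (1 - clamp (-1) 1 y ^ 2).
Proof.
  unfold clamp. destruct (Rle_or_lt y (-1)) as [H|H].
  - rewrite (Rmin_right 1 y), (Rmax_left (-1) y) by lra. rewrite Rmax_left by nra. lra.
  - destruct (Rle_or_lt y 1) as [H'|H'].
    + rewrite (Rmin_right 1 y), (Rmax_right (-1) y) by lra. rewrite Rmax_right by nra. lra.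
    + rewrite (Rmin_left 1 y), (Rmax_right (-1) 1) by lra. rewrite Rmax_left by nra. lra.
Qed.

Lemma clamp_lip (a b x y : R) : Rabs (clamp a b x - clamp a b y) <= Rabs (x - y).
Proof.
  unfold clamp, Rmax, Rmin.
  repeat destruct Rle_dec; unfold Rabs; repeat destruct Rcase_abs; lra.
Qed.

(** A bump of class C^1 with Lipschitz derivative suffices: analyticity is sought in [lam] alone,
    and the kernel lemmas ask no more than Lipschitz dependence on T. *)
Lemma bump_exists (T0 d : R) : 0 < d <= 1 ->
  exists (phi dphi : R -> R) (q : R -> R -> R) (L : R),
    (forall t, is_derive phi t (dphi t)) /\ Cont dphi /\
    (forall t, Rabs (dphi t) <= 1) /\ (forall t, Rabs (phi t) <= 1) /\
    (forall t, t <= T0 - d \/ T0 + d <= t -> phi t = 0 /\ dphi t = 0) /\ 0 < phi T0 /\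
    (forall T t, phi T - phi t = (T - t) * q T t) /\ (forall T t, Rabs (q T t) <= 1) /\
    (forall T t, continuous (q T) t) /\
    (forall T T' t, Rabs (q T t - q T' t) <= L * Rabs (T - T')).
Proof.
  intros Hd.
  set (y := fun t => (t - T0) / d).
  (* The factor d / 4 turns the derivative into -y (1 - y^2)+, bounded by 1 whatever d is. *)
  set (phi := fun t => d / 4 * Rmax 0 (1 - y t ^ 2) ^ 2).
  set (dphi := fun t => - (y t * Rmax 0 (1 - y t ^ 2))).
  assert (Hcl : forall t, -1 <= clamp (-1) 1 (y t) <= 1) by (intros; apply clamp_in; lra).
  assert (Hder : forall t, is_derive phi t (dphi t)).
  { intros t. unfold phi, dphi.
    assert (H1 : is_derive (fun t => 1 - y t ^ 2) t (- (2 * y t / d))).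
    { unfold y. auto_derive; [exact I|]. field. lra. }
    assert (H2 := is_derive_comp (K := R_AbsRing) (V := R_NormedModule) (fun x => Rmax 0 x ^ 2) (fun t => 1 - y t ^ 2) t _ _ (pos_sq_derive (1 - y t ^ 2)) H1).
    assert (H3 := is_derive_scal (fun t => Rmax 0 (1 - y t ^ 2) ^ 2) t (d / 4) _ H2).
    unfold scal in H3; simpl in H3; unfold mult in H3; simpl in H3.
    match type of H3 with is_derive _ _ ?l => replace (- (y t * Rmax 0 (1 - y t ^ 2))) with l by (simpl; field; lra) end.
    exact H3. }
  assert (Hlip : forall s t, Rabs (dphi s - dphi t) <= (2 / d) * Rabs (s - t)).
  { intros s t. unfold dphi. rewrite (proj2 (bump_profile (y s))), (proj2 (bump_profile (y t))).
    pose proof (Hcl s) as Hs. pose proof (Hcl t) as Ht. pose proof (clamp_lip (-1) 1 (y s) (y t)) as Hl.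
    set (cs := clamp (-1) 1 (y s)) in *. set (ct := clamp (-1) 1 (y t)) in *.
    replace (- (cs * (1 - cs ^ 2)) - - (ct * (1 - ct ^ 2))) with ((cs - ct) * (cs ^ 2 + cs * ct + ct ^ 2 - 1)) by ring.
    rewrite Rabs_mult. replace (2 / d * Rabs (s - t)) with (Rabs (y s - y t) * 2).
    - apply Rmult_le_compat; [apply Rabs_pos | apply Rabs_pos | exact Hl|].
      apply Rabs_le. split; nra.
    - unfold y. replace ((s - T0) / d - (t - T0) / d) with ((s - t) * / d) by (field; lra).
      rewrite Rabs_mult, (Rabs_right (/ d)) by (left; apply Rinv_0_lt_compat; lra). field. lra. }
  assert (Hdc : Cont dphi).
  { intros t. apply (continuous_lipschitz _ (2 / d)). intros s. apply Hlip. }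
  assert (Hd1 : forall t, Rabs (dphi t) <= 1).
  { intros t. unfold dphi. rewrite (proj2 (bump_profile (y t))). specialize (Hcl t).
    set (ct := clamp (-1) 1 (y t)) in *. apply Rabs_le. assert (0 <= ct ^ 2 <= 1) by (split; nra). split; nra. }
  (* The divided difference of [phi], in the integral form that needs no separate value on the
     diagonal. *)
  set (q := fun T t => RInt (fun u => dphi (t + u * (T - t))) 0 1).
  assert (Hqi : forall T t x, continuous (fun u => dphi (t + u * (T - t))) x).
  { intros T t x. apply (cont_comp dphi (fun u => t + u * (T - t))); [|apply Hdc].
    apply cont_plus; [apply cont_const|]. cont. }
  assert (HqL : forall T t T' t', Rabs (q T t - q T' t') <= 2 / d * (Rabs (T - T') + Rabs (t - t'))).
  { intros T t T' t'. unfold q. rewrite <- RInt_minusR by apply Hqi.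
    replace (2 / d * (Rabs (T - T') + Rabs (t - t'))) with (RInt (fun _ => 2 / d * (Rabs (T - T') + Rabs (t - t'))) 0 1)
      by (rewrite RInt_const_R; ringR).
    apply RInt_abs_mono; [lra | | intros; apply cont_const|].
    - intros x. apply cont_minus; apply Hqi.
    - intros x Hx. eapply Rle_trans; [apply Hlip|].
      apply Rmult_le_compat_l; [left; apply Rdiv_lt_0_compat; lra|].
      replace (t + x * (T - t) - (t' + x * (T' - t'))) with (x * (T - T') + (1 - x) * (t - t')) by ring.
      eapply Rle_trans; [apply Rabs_triang|]. rewrite !Rabs_mult, (Rabs_right x), (Rabs_right (1 - x)) by lra.
      pose proof (Rabs_pos (T - T')). pose proof (Rabs_pos (t - t')). nra. }
  exists phi, dphi, q, (2 / d).
  refine (conj Hder (conj Hdc (conj Hd1 (conj _ (conj _ (conj _ (conj _ (conj _ (conj _ _))))))))).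
  - intros t. unfold phi. rewrite (proj1 (bump_profile (y t))). specialize (Hcl t).
    set (ct := clamp (-1) 1 (y t)) in *. assert (0 <= 1 - ct ^ 2 <= 1) by (split; nra).
    set (p := 1 - ct ^ 2) in *. assert (0 <= p ^ 2 <= 1) by (split; nra).
    set (z := p ^ 2) in *. apply Rabs_le. split; nra.
  - intros t H. assert (Hy : 1 <= y t ^ 2).
    { assert (E : t - T0 = d * y t) by (unfold y; field; lra). set (z := y t) in *. destruct H as [H|H].
      - assert (z <= -1) by (apply Rmult_le_reg_l with d; lra). nra.
      - assert (1 <= z) by (apply Rmult_le_reg_l with d; lra). nra. }
    unfold phi, dphi. rewrite Rmax_left by lra. lra.
  - unfold phi, y. replace ((T0 - T0) / d) with 0 by (field; lra).
    rewrite Rmax_right by lra. nra.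
  - intros T t. unfold q. rewrite <- RInt_scalR by apply Hqi.
    rewrite (RInt_is_derive (fun u => phi (t + u * (T - t)))).
    + f_equal; f_equal; ring.
    + intros u.
      assert (H1 : is_derive (fun u => t + u * (T - t)) u (T - t)) by (auto_derive; [exact I | ring]).
      exact (is_derive_comp (K := R_AbsRing) (V := R_NormedModule) phi (fun u => t + u * (T - t)) u _ _ (Hder _) H1).
    + intros u. cont.
  - intros T t. unfold q. apply Rle_trans with (RInt (fun _ => 1) 0 1); [|rewrite RInt_const_R; lra].
    apply RInt_abs_mono; [lra | apply Hqi | intros; apply cont_const | intros; apply Hd1].
  - intros T t. apply (continuous_lipschitz _ (2 / d)). intros s. eapply Rle_trans; [apply HqL|].
    rewrite Rminus_diag, Rabs_R0. right; ring.
  - intros T T' t. eapply Rle_trans; [apply HqL|]. rewrite Rminus_diag, Rabs_R0. right; ring.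
Qed.

(** * Analyticity in the variable [T = cot sigma] *)

(** [lreg] satisfies ln |x p| = ln |x| + ln p only approximately. With x = T - t the error has total
    mass O(4^-n) in t; both signs follow from ln y <= y - 1. *)
Lemma lreg_scale (n : nat) (x p : R) : 3 / 4 <= p <= 5 / 4 ->
  Rabs (lreg n (x * p) - lreg n x - ln p) <= (/ 16) ^ n / (x ^ 2 + (/ 16) ^ n).
Proof.
  intros Hp. assert (He : 0 < (/ 16) ^ n) by (apply pow_lt; lra).
  unfold lreg. set (e := (/ 16) ^ n) in *.
  assert (H1 : 0 < x ^ 2 + e) by nra.
  assert (Hp2 : 9 / 16 <= p ^ 2 <= 25 / 16) by (split; nra).
  assert (H2 : 0 < (x * p) ^ 2 + e) by nra.
  assert (H3 : 0 < p ^ 2 * (x ^ 2 + e)) by (apply Rmult_lt_0_compat; lra).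
  assert (El : ln p = / 2 * ln (p ^ 2)).
  { simpl. rewrite Rmult_1_r, ln_mult by lra. field. }
  replace (/ 2 * ln ((x * p) ^ 2 + e) - / 2 * ln (x ^ 2 + e) - ln p)
    with (/ 2 * ln (((x * p) ^ 2 + e) / (p ^ 2 * (x ^ 2 + e)))).
  2:{ rewrite El, ln_div, ln_mult by lra. ring. }
  assert (U := ln_le_minus (((x * p) ^ 2 + e) / (p ^ 2 * (x ^ 2 + e))) ltac:(now apply Rdiv_lt_0_compat)).
  assert (D := ln_le_minus ((p ^ 2 * (x ^ 2 + e)) / ((x * p) ^ 2 + e)) ltac:(now apply Rdiv_lt_0_compat)).
  rewrite ln_div in * by assumption.
  assert (Hf : 0 <= e / (x ^ 2 + e)) by (apply Rmult_le_pos; [lra | left; now apply Rinv_0_lt_compat]).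
  assert (U2 : ((x * p) ^ 2 + e) / (p ^ 2 * (x ^ 2 + e)) - 1 <= 2 * (e / (x ^ 2 + e))).
  { apply Rmult_le_reg_r with (p ^ 2 * (x ^ 2 + e)); [exact H3|].
    replace ((((x * p) ^ 2 + e) / (p ^ 2 * (x ^ 2 + e)) - 1) * (p ^ 2 * (x ^ 2 + e))) with (e * (1 - p ^ 2)) by (field; nra).
    replace (2 * (e / (x ^ 2 + e)) * (p ^ 2 * (x ^ 2 + e))) with (2 * e * p ^ 2) by (field; lra). nra. }
  assert (D2 : (p ^ 2 * (x ^ 2 + e)) / ((x * p) ^ 2 + e) - 1 <= 2 * (e / (x ^ 2 + e))).
  { apply Rmult_le_reg_r with (((x * p) ^ 2 + e) * (x ^ 2 + e)); [now apply Rmult_lt_0_compat|].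
    replace ((p ^ 2 * (x ^ 2 + e) / ((x * p) ^ 2 + e) - 1) * (((x * p) ^ 2 + e) * (x ^ 2 + e)))
      with (e * (p ^ 2 - 1) * (x ^ 2 + e)) by (field; lra).
    replace (2 * (e / (x ^ 2 + e)) * (((x * p) ^ 2 + e) * (x ^ 2 + e))) with (e * (2 * ((x * p) ^ 2 + e))) by (field; lra).
    rewrite Rmult_assoc. apply Rmult_le_compat_l; [lra|].
    rewrite Rpow_mult_distr. assert (0 <= x ^ 2) by nra. nra. }
  apply Rabs_le. split; lra.
Qed.

Lemma RInt_support (f : R -> R) (a b a' b' : R) :
  Cont f -> (forall t, t <= a \/ b <= t -> f t = 0) ->
  a' <= a -> b <= b' -> RInt f a' b' = RInt f a b.
Proof.
  intros Hf Hz Ha Hb.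
  assert (Z : forall x y, x <= y -> (y <= a \/ b <= x) -> RInt f x y = 0).
  { intros x y Hxy Hc. rewrite (RInt_ext_in f (fun _ => 0)); [rewrite RInt_const_R; ringR | exact Hxy|].
    intros t Ht. apply Hz. destruct Hc; [left | right]; lra. }
  rewrite <- (RInt_Chasles f a' a b') by now apply ex_RInt_cont.
  rewrite <- (RInt_Chasles f a b b') by now apply ex_RInt_cont.
  rewrite (Z a' a), (Z b b') by (try lra; auto; right; lra).
  unfold plus; simpl. ringR.
Qed.

Section Core.

(** In terms of T: [th] stands for theta, [Ih] for the primitive of zeta, [w] for the odd density.
    [Habs1] and [Habs2] bound the mass of [w] on unit shells by differences that telescope, in place
    of an improper integral. *)
Variables (c0 : R) (th Ih w : R -> R).
Hypothesis Hth : Cont th.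
Hypothesis HIc : Cont Ih.
Hypothesis HI0 : forall T, 0 <= Ih T.
Hypothesis HthB : forall T, 0 <= PI / 2 - atan T + th T <= PI.
Hypothesis Hw : forall T, w T = c0 * exp (- Ih T) * sin (PI / 2 - atan T + th T) * (T / (1 + T ^ 2)).
Hypothesis HI : forall x y, RInt w x y = Ih x - Ih y.
Hypothesis Habs1 : forall N, RInt (fun t => Rabs (w t)) (INR N) (INR (S N)) <= Ih (INR N) - Ih (INR (S N)).
Hypothesis Habs2 : forall N, RInt (fun t => Rabs (w t)) (- INR (S N)) (- INR N) <= Ih (INR N) - Ih (INR (S N)).
Hypothesis Hrep : forall T,
  is_lim_seq (fun n => RInt (fun t => lreg n (T - t) * w t) (- INR n) (INR n)) (- (3 * PI * th T)).

Lemma cont_atan (x : R) : continuous atan x.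
Proof. exact (cont_derive _ _ _ (is_derive_atan x)). Qed.

Lemma cont_S0 (x : R) : continuous (fun T => PI / 2 - atan T + th T) x.
Proof. apply cont_plus; [|apply Hth]. apply cont_minus; [apply cont_const | apply cont_atan]. Qed.

Lemma cont_rat (x : R) : continuous (fun T => T / (1 + T ^ 2)) x.
Proof.
  apply (cont_derive _ x ((1 - x ^ 2) / (1 + x ^ 2) ^ 2)). auto_derive; [nra|]. field. nra.
Qed.

Lemma cont_exp_Ih (x : R) : continuous (fun T => exp (- Ih T)) x.
Proof.
  apply (cont_comp exp (fun T => - Ih T)); [apply cont_opp, HIc|].
  exact (cont_derive _ _ _ (is_derive_exp _)).
Qed.

Lemma cont_w (x : R) : continuous w x.
Proof.
  apply (continuous_ext (fun T => c0 * exp (- Ih T) * sin (PI / 2 - atan T + th T) * (T / (1 + T ^ 2)))).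
  { intros; now rewrite Hw. }
  apply cont_mult; [|apply cont_rat]. apply cont_mult.
  - apply cont_mult; [apply cont_const | apply cont_exp_Ih].
  - apply (cont_comp sin (fun T => PI / 2 - atan T + th T)); [apply cont_S0|].
    exact (cont_derive _ _ _ (is_derive_sin _)).
Qed.

#[local] Hint Resolve cont_w cont_rat cont_atan cont_exp_Ih cont_S0 : cont.

Lemma exp_Ih_le (T : R) : 0 < exp (- Ih T) <= 1.
Proof. apply exp_opp_le, HI0. Qed.

Lemma rat_le (T : R) : Rabs (T / (1 + T ^ 2)) <= / 2.
Proof.
  pose proof (pow2_ge_0 (T - 1)). pose proof (pow2_ge_0 (T + 1)).
  apply Rabs_le. assert (0 < 1 + T ^ 2) by nra. split.
  - apply Rmult_le_reg_r with (1 + T ^ 2); [assumption|]. unfold Rdiv. rewrite Rmult_assoc, Rinv_l by lra. nra.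
  - apply Rmult_le_reg_r with (1 + T ^ 2); [assumption|]. unfold Rdiv. rewrite Rmult_assoc, Rinv_l by lra. nra.
Qed.

Lemma w_bound (T : R) : Rabs (w T) <= Rabs c0.
Proof.
  rewrite Hw, !Rabs_mult. pose proof (exp_Ih_le T). rewrite (Rabs_right (exp _)) by lra.
  pose proof (rat_le T). pose proof (Rabs_pos c0). pose proof (Rabs_pos (T / (1 + T ^ 2))).
  assert (Rabs (sin (PI / 2 - atan T + th T)) <= 1) by (apply Rabs_le, SIN_bound).
  pose proof (Rabs_pos (sin (PI / 2 - atan T + th T))).
  assert (Rabs c0 * exp (- Ih T) <= Rabs c0 * 1) by (apply Rmult_le_compat_l; lra).
  assert (0 <= Rabs c0 * exp (- Ih T)) by (apply Rmult_le_pos; lra).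
  assert (Rabs c0 * exp (- Ih T) * Rabs (sin (PI / 2 - atan T + th T)) <= Rabs c0 * 1 * 1) by (apply Rmult_le_compat; lra).
  rewrite <- (Rmult_1_r (Rabs c0)). rewrite !Rmult_1_r in *.
  rewrite <- (Rmult_1_r (Rabs c0)). apply Rmult_le_compat; try lra.
  apply Rmult_le_pos; lra.
Qed.

(** Norm bound for the argument of the sine in [G]: 4 for PI, 4 for the arctangent difference, 1 for
    the near field, 2 [Ih 0] for the far field. [Sq] is then the norm of the sine given by
    [AnF_sin]. *)
Definition Qc : R := 9 + 2 * Ih 0.
Definition Sq : R := Qc * exp (Qc * Qc).
(** Radius of the ball preserved by [G]; the last summand also makes room for the true [V lam],
    bounded by 3 |c0|. *)
Definition Rad : R := 12 * Rabs c0 * Sq + 3 * Rabs c0.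
(** Lipschitz constant of [G] divided by sqrt (2 d): 4 |c0| bounds the prefactor, 153 = 51 * 3
    belongs to the difference of sines, 9 [Sq] to that of exponentials. *)
Definition Kc : R := 4 * Rabs c0 * (153 * exp (Qc * Qc) + 9 * Sq).

Lemma Qc_pos : 9 <= Qc.
Proof. unfold Qc. specialize (HI0 0). lra. Qed.

Lemma Sq_pos : 0 < Sq.
Proof. unfold Sq. pose proof Qc_pos. apply Rmult_lt_0_compat; [lra | apply exp_pos]. Qed.

Lemma Rad_pos : 0 <= Rad.
Proof. unfold Rad. pose proof Sq_pos. pose proof (Rabs_pos c0). nra. Qed.

(** * The deformation near T0 and the fixed point equation for the density *)

Section Local.

Variables (T0 d L : R) (phi dphi : R -> R) (q : R -> R -> R).
Hypothesis Hd : 0 < d <= / 2.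
Hypothesis Hphi : forall t, is_derive phi t (dphi t).
Hypothesis Hdphi : Cont dphi.
Hypothesis Hdphi1 : forall t, Rabs (dphi t) <= 1.
Hypothesis Hphi1 : forall t, Rabs (phi t) <= 1.
Hypothesis Hphi0 : forall t, t <= T0 - d \/ T0 + d <= t -> phi t = 0 /\ dphi t = 0.
Hypothesis Hq : forall T t, phi T - phi t = (T - t) * q T t.
Hypothesis Hq1 : forall T t, Rabs (q T t) <= 1.
Hypothesis Hqc : forall T t, continuous (q T) t.
Hypothesis HqL : forall T T' t, Rabs (q T t - q T' t) <= L * Rabs (T - T').

Let a := T0 - d.
Let b := T0 + d.

Lemma ab_le : a <= b.
Proof. unfold a, b; lra. Qed.

#[local] Hint Resolve ab_le : core.

Definition psi (lam t : R) : R := t + lam * phi t.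
Definition dpsi (lam t : R) : R := 1 + lam * dphi t.
(** Subtracting [w] confines the unknown to [a, b], where the bump lives. *)
Definition V (lam t : R) : R := w (psi lam t) * dpsi lam t - w t.

Lemma phi_cont (t : R) : continuous phi t.
Proof. exact (cont_derive _ _ _ (Hphi t)). Qed.

#[local] Hint Resolve phi_cont Hdphi Hqc : cont.

Lemma psi_derive (lam t : R) : is_derive (psi lam) t (dpsi lam t).
Proof.
  unfold psi, dpsi. apply (is_derive_plus (K := R_AbsRing) (V := R_NormedModule) (fun t => t) (fun t => lam * phi t)).
  - apply (is_derive_id (K := R_AbsRing)).
  - apply is_derive_scal. apply Hphi.
Qed.

Lemma psi_cont (lam t : R) : continuous (psi lam) t.
Proof. exact (cont_derive _ _ _ (psi_derive lam t)). Qed.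

Lemma dpsi_cont (lam t : R) : continuous (dpsi lam) t.
Proof. apply cont_plus; [apply cont_const|]. cont. Qed.

#[local] Hint Resolve psi_cont dpsi_cont : cont.

Lemma wpsi_cont (lam t : R) : continuous (fun t => w (psi lam t) * dpsi lam t) t.
Proof. apply cont_mult; [apply (cont_comp w (psi lam)); [apply psi_cont | apply cont_w] | apply dpsi_cont]. Qed.

Lemma V_cont (lam t : R) : continuous (V lam) t.
Proof. apply cont_minus; [apply wpsi_cont | apply cont_w]. Qed.

#[local] Hint Resolve wpsi_cont V_cont : cont.

Lemma lam_mul_le (lam x : R) : Rabs lam <= / 4 -> Rabs x <= 1 -> Rabs (lam * x) <= / 4.
Proof. intros. rewrite Rabs_mult. pose proof (Rabs_pos lam). pose proof (Rabs_pos x). nra. Qed.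

Lemma dpsi_bound (lam t : R) : Rabs lam <= / 4 -> 3 / 4 <= dpsi lam t <= 5 / 4.
Proof.
  intros H. pose proof (lam_mul_le lam (dphi t) H (Hdphi1 t)) as H1. apply Rabs_le_between in H1.
  unfold dpsi. lra.
Qed.

Lemma q_bound (lam T t : R) : Rabs lam <= / 4 -> 3 / 4 <= 1 + lam * q T t <= 5 / 4.
Proof.
  intros H. pose proof (lam_mul_le lam (q T t) H (Hq1 T t)) as H1. apply Rabs_le_between in H1. lra.
Qed.

Lemma V_bound (lam t : R) : Rabs lam <= / 4 -> Rabs (V lam t) <= 3 * Rabs c0.
Proof.
  intros H. unfold V. pose proof (dpsi_bound lam t H). pose proof (w_bound (psi lam t)). pose proof (w_bound t).
  unfold Rminus. eapply Rle_trans; [apply Rabs_triang|]. rewrite Rabs_Ropp, Rabs_mult, (Rabs_right (dpsi lam t)) by lra.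
  pose proof (Rabs_pos (w (psi lam t))). nra.
Qed.

Lemma V_support (lam t : R) : t <= a \/ b <= t -> V lam t = 0.
Proof.
  intros H. destruct (Hphi0 t H) as [E1 E2]. unfold V, psi, dpsi. rewrite E1, E2, !Rmult_0_r, !Rplus_0_r. ring.
Qed.

Lemma psi_out (lam t : R) : t <= a \/ b <= t -> psi lam t = t.
Proof. intros H. destruct (Hphi0 t H) as [E1 E2]. unfold psi. rewrite E1. ring. Qed.

Lemma psi_subst (f : R -> R) (lam x y : R) :
  Cont f ->
  RInt (fun t => f (psi lam t) * dpsi lam t) x y = RInt f (psi lam x) (psi lam y).
Proof.
  intros Hf. rewrite <- (RInt_comp (V := R_CompleteNormedModule) f (psi lam) (dpsi lam) x y).
  - apply RInt_eq. intros t. unfold scal; simpl; unfold mult; simpl. ring.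
  - intros; apply Hf.
  - intros t _. split; [apply psi_derive | apply dpsi_cont].
Qed.

Lemma ln_q_cont (lam T t : R) : Rabs lam <= / 4 -> continuous (fun t => ln (1 + lam * q T t)) t.
Proof.
  intros H. apply (cont_comp ln (fun t => 1 + lam * q T t)).
  - apply cont_plus; [apply cont_const|]. cont.
  - apply continuous_ln. pose proof (q_bound lam T t H). lra.
Qed.

(** The factor 1 keeps the shape [g t * u t mu] of [AnF_logker]; the [1 * V lam t] further on has
    the same origin. *)
Definition gfar (lam T t : R) : R := ln (1 + lam * q T t) * (w t * 1).

#[local] Hint Resolve ln_q_cont : cont.

Lemma gfar_cont (lam T t : R) : Rabs lam <= / 4 -> continuous (gfar lam T) t.
Proof.
  intros H. apply cont_mult; [now apply ln_q_cont|]. cont.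
Qed.

#[local] Hint Resolve gfar_cont : cont.

(** Summing over the symmetric shells N <= |t| <= N + 1 turns the integral over the line into a
    series of families. *)
Definition shell (lam T : R) (N : nat) : R :=
  RInt (gfar lam T) (INR N) (INR (S N)) + RInt (gfar lam T) (- INR (S N)) (- INR N).

Definition Efar (lam T : R) : R := Series (shell lam T).

Lemma shell_sum (lam T : R) (n : nat) : Rabs lam <= / 4 ->
  sum_f_R0 (shell lam T) n = RInt (gfar lam T) (- INR (S n)) (INR (S n)).
Proof.
  intros H. assert (Hc : Cont (gfar lam T)) by (intros; now apply gfar_cont).
  induction n as [|n IH].
  - simpl sum_f_R0. unfold shell. rewrite <- (RInt_Chasles (gfar lam T) (- INR 1) (INR 0) (INR 1)) by now apply ex_RInt_cont.
    simpl INR. rewrite Ropp_0. unfold plus; simpl. ring.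
  - rewrite tech5, IH. unfold shell.
    rewrite <- (RInt_Chasles (gfar lam T) (- INR (S (S n))) (- INR (S n)) (INR (S (S n)))) by now apply ex_RInt_cont.
    rewrite <- (RInt_Chasles (gfar lam T) (- INR (S n)) (INR (S n)) (INR (S (S n)))) by now apply ex_RInt_cont.
    unfold plus; simpl plus. change (Hierarchy.plus ?x ?y) with (x + y). cbn. ring.
Qed.

Section Gen.
(* [l] is either the identity or a constant: the same contraction estimate gives
   convergence of the Picard iterates as power series, and pointwise. *)
Variables (r : R) (l : R -> R).
Hypothesis Hr : 0 < r.
Hypothesis Hl : AnF a b r (fun _ mu => l mu) (/ 4).

Lemma l_bound (mu : R) : Rabs mu < r -> Rabs (l mu) <= / 4.
Proof. intros H. exact (AnF_bound a b r Hr _ _ a mu Hl ltac:(pose proof ab_le; lra) H). Qed.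

Lemma shell_series : exists M, is_series (fun N => 2 * (Ih (INR N) - Ih (INR (S N)))) M /\ M <= 2 * Ih 0.
Proof.
  assert (Hpos : forall N, 0 <= Ih (INR N) - Ih (INR (S N))).
  { intros N. eapply Rle_trans; [|apply Habs1].
    apply RInt_nonneg; [rewrite S_INR; lra | intros; apply continuous_Rabs_comp, cont_w | intros; apply Rabs_pos]. }
  destruct (ser_pos_bdd (fun N => 2 * (Ih (INR N) - Ih (INR (S N)))) (2 * Ih 0)) as (E & HE & HEb).
  { intros N. specialize (Hpos N). lra. }
  { intros N. rewrite sum_scal. apply Rmult_le_compat_l; [lra|].
    assert (E : sum_f_R0 (fun N => Ih (INR N) - Ih (INR (S N))) N = Ih 0 - Ih (INR (S N))).
    { clear. induction N as [|N IH]; [simpl; ring | rewrite tech5, IH; ring]. }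
    rewrite E. specialize (HI0 (INR (S N))). lra. }
  exists E. tauto.
Qed.

Lemma AnF_shell (N : nat) : AnF a b r (fun T mu => shell (l mu) T N) (2 * (Ih (INR N) - Ih (INR (S N)))).
Proof.
  pose proof ab_le as ab_le.
  replace (2 * (Ih (INR N) - Ih (INR (S N)))) with ((Ih (INR N) - Ih (INR (S N))) * 1 + (Ih (INR N) - Ih (INR (S N))) * 1) by ring.
  assert (H1 : forall a' b', a' <= b' -> AnF a' b' r (fun _ _ => 1) 1).
  { intros. apply AnF_const; auto. rewrite Rabs_R1; lra. }
  apply AnF_plus; auto;
    (apply (AnF_logker a b r _ _ L _ 1 q (fun _ _ => 1) w l); auto; try (rewrite S_INR; lra); try apply cont_w;
     apply H1; rewrite S_INR; lra).
Qed.

Lemma Efar_series (T mu : R) : a <= T <= b -> Rabs mu < r -> is_series (shell (l mu) T) (Efar (l mu) T).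
Proof.
  intros HT Hmu. destruct shell_series as (M & HM & _).
  destruct (ser_dom (shell (l mu) T) (fun N => 2 * (Ih (INR N) - Ih (INR (S N)))) M) as (x & Hx & _); [|exact HM|].
  - intros N. exact (AnF_bound a b r Hr _ _ T mu (AnF_shell N) HT Hmu).
  - unfold Efar. rewrite (is_series_unique _ _ Hx). exact Hx.
Qed.

Lemma AnF_Efar : AnF a b r (fun T mu => Efar (l mu) T) (2 * Ih 0).
Proof.
  destruct shell_series as (M & HM & HM2). apply AnF_le with M; [exact HM2|].
  apply (AnF_series a b r ab_le Hr (fun N T mu => shell (l mu) T N) _ (fun N => 2 * (Ih (INR N) - Ih (INR (S N))))).
  - apply AnF_shell.
  - exact HM.
  - intros T mu HT Hmu. now apply Efar_series.
Qed.

End Gen.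

Lemma AnF_cst (lam : R) : Rabs lam <= / 4 -> AnF a b 1 (fun _ _ => lam) (/ 4).
Proof. intros H. now apply AnF_const. Qed.

Lemma Efar_lim (lam T : R) : Rabs lam <= / 4 -> a <= T <= b ->
  is_lim_seq (fun n => RInt (gfar lam T) (- INR n) (INR n)) (Efar lam T).
Proof.
  intros H HT. apply is_lim_seq_incr_1. apply is_lim_seq_spec. intros eps.
  (* Pointwise use of a statement on families: [l] is constant, and mu = 0 is any admissible
     value. *)
  assert (Hs := Efar_series 1 (fun _ => lam) Rlt_0_1 (AnF_cst lam H) T 0 HT ltac:(rewrite Rabs_R0; lra)).
  destruct (proj1 (ser_eps _ _) Hs eps (cond_pos eps)) as [N HN].
  exists N. intros n Hn. specialize (HN n Hn). now rewrite shell_sum in HN.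
Qed.

Lemma psi_diff (lam T t : R) : psi lam T - psi lam t = (T - t) * (1 + lam * q T t).
Proof. unfold psi. replace (T + lam * phi T - (t + lam * phi t)) with (T - t + lam * (phi T - phi t)) by ring. rewrite Hq. ring. Qed.

Lemma pow4_lim (C : R) : is_lim_seq (fun n => C * (/ 4) ^ n) 0.
Proof.
  replace 0 with (C * 0) by ring. apply (is_lim_seq_scal_l (fun n => (/ 4) ^ n) C 0).
  apply is_lim_seq_geom. rewrite Rabs_right; lra.
Qed.

(** Substituting t = psi(t') in the potential at psi(T) leaves the ends -n and n fixed, and
    [lreg_scale] separates the kernel into its old value and ln (1 + lam q). The error is at most 2
    |c0| times the mass 4 4^-n of the scaling error. *)
Lemma deform_error (lam T : R) (n : nat) : Rabs lam <= / 4 -> - INR n <= a -> b <= INR n ->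
  Rabs (RInt (fun t => lreg n (psi lam T - t) * w t) (- INR n) (INR n) -
        RInt (fun t => lreg n (T - t) * w t) (- INR n) (INR n) -
        (RInt (fun t => lreg n (T - t) * V lam t) a b +
         RInt (fun t => ln (1 + lam * q T t) * (1 * V lam t)) a b +
         RInt (gfar lam T) (- INR n) (INR n))) <= (8 * Rabs c0) * (/ 4) ^ n.
Proof.
  intros H Ha Hb. set (N := INR n) in *. pose proof ab_le as ab_le.
  assert (HN : - N <= N) by lra.
  assert (Cl := fun x t => lreg_shift_cont n x t).
  assert (Cw := wpsi_cont lam). assert (CV := V_cont lam).
  assert (Clq : Cont (fun t => ln (1 + lam * q T t))) by (intros; now apply ln_q_cont).
  assert (E1 : RInt (fun t => lreg n (psi lam T - t) * w t) (- N) N =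
     RInt (fun t => lreg n (psi lam T - psi lam t) * (w (psi lam t) * dpsi lam t)) (- N) N :> R).
  { rewrite <- (psi_out lam (- N)) at 1 by (left; exact Ha). rewrite <- (psi_out lam N) at 2 by (right; exact Hb).
    rewrite <- psi_subst.
    - apply RInt_eq. intros; ring.
    - cont. }
  assert (E2 : RInt (fun t => lreg n (T - t) * V lam t) a b = RInt (fun t => lreg n (T - t) * V lam t) (- N) N).
  { symmetry. apply RInt_support; auto.
    - cont.
    - intros t Ht. rewrite V_support by exact Ht. ring. }
  assert (E3 : RInt (fun t => ln (1 + lam * q T t) * (1 * V lam t)) a b = RInt (fun t => ln (1 + lam * q T t) * (1 * V lam t)) (- N) N).
  { symmetry. apply RInt_support; auto.
    - cont.
    - intros t Ht. rewrite V_support by exact Ht. ring. }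
  rewrite E1, E2, E3.
  assert (C1 : Cont (fun t => lreg n (psi lam T - psi lam t) * (w (psi lam t) * dpsi lam t))).
  { intros. apply cont_mult; [|apply Cw].
    apply (cont_comp (fun t => lreg n (psi lam T - t)) (psi lam)); [apply psi_cont | apply Cl]. }
  assert (C2 : Cont (fun t => lreg n (T - t) * w t)) by (cont).
  assert (C3 : Cont (fun t => lreg n (T - t) * V lam t)) by (intros; apply cont_mult; auto).
  assert (C4 : Cont (fun t => ln (1 + lam * q T t) * (1 * V lam t)))
    by (cont).
  assert (C5 : Cont (gfar lam T)) by (intros; now apply gfar_cont).
  rewrite <- RInt_minusR by assumption. rewrite <- RInt_plusR by assumption.
  assert (C34 : Cont (fun t => lreg n (T - t) * V lam t + ln (1 + lam * q T t) * (1 * V lam t)))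
    by (intros; apply cont_plus; auto).
  rewrite <- RInt_plusR by assumption.
  rewrite <- RInt_minusR by (intros; first [apply cont_minus; auto | apply cont_plus; auto]).
  set (e := (/ 4) ^ n). assert (He : 0 < e) by (apply pow_lt; lra).
  assert (Hk : Cont (fun t => (2 * Rabs c0 * e ^ 2) / ((T - t) ^ 2 + e ^ 2))).
  { intros t. apply cont_cauchy. now apply pow_lt. }
  apply Rle_trans with (RInt (fun t => (2 * Rabs c0 * e ^ 2) / ((T - t) ^ 2 + e ^ 2)) (- N) N).
  - apply RInt_abs_mono; auto.
    + intros. apply cont_minus; [apply cont_minus; auto | apply cont_plus; auto].
    + intros t _. rewrite psi_diff. pose proof (q_bound lam T t H) as Hqb.
      assert (Hs := lreg_scale n (T - t) (1 + lam * q T t) Hqb).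
      rewrite pow16_4 in Hs. fold e in Hs.
      replace (e * e) with (e ^ 2) in Hs by ring.
      pose proof (w_bound (psi lam t)) as Hwb. pose proof (dpsi_bound lam t H) as Hdb.
      unfold gfar, V.
      (* As [w t + V lam t] is the pulled-back density, all the terms collapse to the scaling error
         times that density. *)
      match goal with |- Rabs ?x <= _ => replace x with ((lreg n ((T - t) * (1 + lam * q T t)) - lreg n (T - t) - ln (1 + lam * q T t)) * (w (psi lam t) * dpsi lam t)) by ring end.
      rewrite !Rabs_mult. rewrite (Rabs_right (dpsi lam t)) by lra.
      replace (2 * Rabs c0 * e ^ 2 / ((T - t) ^ 2 + e ^ 2)) with (e ^ 2 / ((T - t) ^ 2 + e ^ 2) * (Rabs c0 * 2)).
      * apply Rmult_le_compat; [apply Rabs_pos | | exact Hs|].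
        -- apply Rmult_le_pos; [apply Rabs_pos | lra].
        -- apply Rmult_le_compat; [apply Rabs_pos | lra | exact Hwb | lra].
      * field. pose proof (pow2_ge_0 (T - t)). nra.
  - eapply Rle_trans; [apply RInt_atan_kernel; auto|].
    + pose proof (Rabs_pos c0). nra.
    + right. field. lra.
Qed.

(** One sequence, two limits: termwise by [Hrep], [Lop_lim] and [Efar_lim], and 0 by
    [deform_error]. *)
Lemma theta_identity (lam T : R) : Rabs lam <= / 4 -> a <= T <= b ->
  th (psi lam T) - th T = - / (3 * PI) *
    (Lop a b (V lam) T + RInt (fun t => ln (1 + lam * q T t) * (1 * V lam t)) a b + Efar lam T).
Proof.
  intros H HT. pose proof PI_RGT_0 as HPI.
  set (X := RInt (fun t => ln (1 + lam * q T t) * (1 * V lam t)) a b).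
  assert (L1 : is_lim_seq (fun n => RInt (fun t => lreg n (psi lam T - t) * w t) (- INR n) (INR n) -
        RInt (fun t => lreg n (T - t) * w t) (- INR n) (INR n) -
        (RInt (fun t => lreg n (T - t) * V lam t) a b + X +
         RInt (gfar lam T) (- INR n) (INR n)))
     (- (3 * PI * th (psi lam T)) - - (3 * PI * th T) - (Lop a b (V lam) T + X + Efar lam T))).
  { apply is_lim_seq_minus'; [apply is_lim_seq_minus'; apply Hrep|].
    apply is_lim_seq_plus'; [|now apply Efar_lim].
    apply is_lim_seq_plus'; [|apply is_lim_seq_const].
    apply Lop_lim; [apply ab_le | apply V_cont]. }
  assert (L2 : is_lim_seq (fun n => RInt (fun t => lreg n (psi lam T - t) * w t) (- INR n) (INR n) -
        RInt (fun t => lreg n (T - t) * w t) (- INR n) (INR n) -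
        (RInt (fun t => lreg n (T - t) * V lam t) a b + X +
         RInt (gfar lam T) (- INR n) (INR n))) 0).
  { apply is_lim_seq_abs_0.
    destruct (INR_unbounded (Rabs a + Rabs b)) as [N HN].
    apply (is_lim_seq_le_le_loc (fun _ => 0) _ (fun n => (8 * Rabs c0) * (/ 4) ^ n)).
    - exists N. intros n Hn. split; [apply Rabs_pos|].
      apply le_INR in Hn.
      assert (- INR n <= a /\ b <= INR n).
      { pose proof (Rle_abs (- a)). rewrite Rabs_Ropp in H0. pose proof (Rle_abs b).
        pose proof (Rabs_pos a). pose proof (Rabs_pos b). lra. }
      now apply deform_error.
    - apply is_lim_seq_const.
    - apply pow4_lim. }
  apply is_lim_seq_unique in L1. apply is_lim_seq_unique in L2. rewrite L1 in L2. injection L2 as L2.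
  apply Rmult_eq_reg_l with (3 * PI); [|lra].
  replace (3 * PI * (- / (3 * PI) * (Lop a b (V lam) T + X + Efar lam T))) with (- (Lop a b (V lam) T + X + Efar lam T)) by (field; lra).
  lra.
Qed.

(** Argument of the sine at [psi lam T], with [th (psi lam T)] expressed through the density [v].
    The arctangent is split so that the first bracket lies in [0, PI] by [HthB]. *)
Definition Yarg (lam : R) (v : R -> R) (T : R) : R :=
  (PI / 2 - atan T + th T) + (atan T - atan (psi lam T)) +
  - / (3 * PI) * (Lop a b v T + RInt (fun t => ln (1 + lam * q T t) * (1 * v t)) a b + Efar lam T).

(** Equation [Hw] at [psi lam T] times the Jacobian, minus [w T], with [th] and [Ih] at the deformed
    point eliminated in favour of [v]. *)
Definition G (lam : R) (v : R -> R) (T : R) : R :=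
  c0 * exp (- Ih T) * (psi lam T * dpsi lam T / (1 + psi lam T ^ 2)) *
    (sin (Yarg lam v T) * exp (RInt v a T)) - w T.

Lemma Ih_identity (lam T : R) : Ih (psi lam T) = Ih T - RInt (V lam) a T.
Proof.
  assert (E : RInt (V lam) a T = (Ih a - Ih (psi lam T)) - (Ih a - Ih T) :> R).
  { unfold V. rewrite RInt_minusR by (intros; first [apply wpsi_cont | apply cont_w]).
    rewrite psi_subst by apply cont_w. rewrite (psi_out lam a) by (left; unfold a; lra).
    now rewrite !HI. }
  rewrite E. ring.
Qed.

Lemma G_fix (lam T : R) : Rabs lam <= / 4 -> a <= T <= b -> V lam T = G lam (V lam) T.
Proof.
  intros H HT. unfold G, Yarg. rewrite <- theta_identity by assumption.
  unfold V at 1. rewrite Hw. f_equal.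
  replace (- Ih (psi lam T)) with (- Ih T + RInt (V lam) a T) by (rewrite Ih_identity; ring).
  rewrite exp_plus.
  replace (PI / 2 - atan T + th T + (atan T - atan (psi lam T)) + (th (psi lam T) - th T))
    with (PI / 2 - atan (psi lam T) + th (psi lam T)) by ring.
  field. nra.
Qed.

(** Linearity is read off the limit of [Lop_lim], where it is that of an ordinary integral. *)
Lemma Lop_minus (v v' : R -> R) (T : R) :
  Cont v -> Cont v' ->
  Lop a b v T - Lop a b v' T = Lop a b (fun t => v t - v' t) T.
Proof.
  intros Hv Hv'.
  assert (L1 := is_lim_seq_minus' _ _ _ _ (Lop_lim a b v T ab_le Hv) (Lop_lim a b v' T ab_le Hv')).
  assert (L2 := Lop_lim a b (fun t => v t - v' t) T ab_le ltac:(intros; now apply cont_minus)).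
  apply is_lim_seq_ext with (v := fun n => RInt (fun t => lreg n (T - t) * (v t - v' t)) a b) in L1.
  - apply is_lim_seq_unique in L1. apply is_lim_seq_unique in L2. rewrite L1 in L2. now injection L2.
  - intros n. rewrite <- RInt_minusR by (cont).
    apply RInt_eq. intros; ring.
Qed.

(** * Norm estimates: [G] preserves a ball and contracts by 1/2 *)

Hypothesis Hd2 : 17 * sqrt (2 * d) * Rad <= 1.
Hypothesis Hd3 : Kc * sqrt (2 * d) <= / 2.

Lemma ba_eq : b - a = 2 * d.
Proof. unfold a, b; ring. Qed.

Lemma ba_sqrt : 2 * d <= sqrt (2 * d).
Proof. apply sq_le_le; [apply sqrt_pos|]. rewrite sqrt_sqrt by lra. nra. Qed.

Section Gen2.
Variables (r : R) (l : R -> R).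
Hypothesis Hr : 0 < r.
Hypothesis Hl : AnF a b r (fun _ mu => l mu) (/ 4).

Notation An := (AnF a b r).
Notation Y v := (fun T mu => Yarg (l mu) (fun t => v t mu) T).
Notation zl := (fun T mu => 2 * (T / (1 + T ^ 2)) * (l mu * phi T) + / (1 + T ^ 2) * (l mu * phi T * (l mu * phi T))).

Lemma AnF_phi_l : An (fun T mu => l mu * phi T) (/ 4).
Proof.
  replace (/ 4) with (/ 4 * 1) by ring. apply AnF_mult; [apply ab_le | exact Hr | exact Hl|].
  apply AnF_fun; [exact phi_cont | intros; apply Hphi1].
Qed.

Lemma AnF_dpsi : An (fun T mu => dpsi (l mu) T) (5 / 4).
Proof.
  replace (5 / 4) with (1 + / 4 * 1) by field. apply AnF_plus; auto.
  - apply AnF_const. rewrite Rabs_R1; lra.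
  - apply AnF_mult; [apply ab_le | exact Hr | exact Hl|].
    apply AnF_fun; [exact Hdphi | intros; apply Hdphi1].
Qed.

Lemma inv1_cont (x : R) : continuous (fun T => / (1 + T ^ 2)) x.
Proof. apply (cont_derive _ x (- (2 * x) / (1 + x ^ 2) ^ 2)). auto_derive; [nra|]. field. nra. Qed.

#[local] Hint Resolve inv1_cont : cont.

Lemma inv1_le (T : R) : Rabs (/ (1 + T ^ 2)) <= 1.
Proof.
  assert (1 <= 1 + T ^ 2) by nra. rewrite Rabs_right by (left; apply Rinv_0_lt_compat; lra).
  rewrite <- Rinv_1. apply Rinv_le_contravar; lra.
Qed.

Lemma AnF_inv1 : An (fun T _ => / (1 + T ^ 2)) 1.
Proof. apply (AnF_fun a b r (fun T => / (1 + T ^ 2))); [exact inv1_cont | intros; apply inv1_le]. Qed.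

(** [zl] is defined by 1 + psi^2 = (1 + T^2) (1 + zl). Its coefficients are bounded uniformly in T,
    so its norm is at most 1/4 + 1/16 wherever T0 lies, and the geometric series applies. *)
Lemma AnF_invpsi : An (fun T mu => / (1 + zl T mu)) 2.
Proof.
  apply AnF_inv; [apply ab_le | exact Hr|].
  apply AnF_le with (1 * / 4 + 1 * (/ 4 * / 4)); [lra|].
  apply AnF_plus; auto.
  - apply AnF_mult; [apply ab_le | exact Hr | | apply AnF_phi_l].
    apply (AnF_fun a b r (fun T => 2 * (T / (1 + T ^ 2)))).
    + cont.
    + intros t _. rewrite Rabs_mult, Rabs_right by lra. pose proof (rat_le t). lra.
  - apply AnF_mult; auto.
    + apply AnF_inv1.
    + apply AnF_mult; [apply ab_le | exact Hr | apply AnF_phi_l | apply AnF_phi_l].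
Qed.

Lemma invpsi_eq (T x : R) :
  / (1 + (T + x) ^ 2) = / (1 + T ^ 2) * / (1 + (2 * (T / (1 + T ^ 2)) * x + / (1 + T ^ 2) * (x * x))).
Proof. rewrite <- Rinv_mult. f_equal. field. nra. Qed.

Lemma AnF_jac : An (fun T mu => dpsi (l mu) T / (1 + psi (l mu) T ^ 2)) (5 / 2).
Proof.
  apply AnF_ext with (fun T mu => dpsi (l mu) T * (/ (1 + T ^ 2) * / (1 + zl T mu))).
  { intros T mu _ _. rewrite <- invpsi_eq. reflexivity. }
  replace (5 / 2) with (5 / 4 * (1 * 2)) by field.
  apply AnF_mult; [apply ab_le | exact Hr | apply AnF_dpsi|].
  apply AnF_mult; [apply ab_le | exact Hr | | apply AnF_invpsi].
  apply AnF_inv1.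
Qed.

Lemma AnF_rational : An (fun T mu => psi (l mu) T * dpsi (l mu) T / (1 + psi (l mu) T ^ 2)) 4.
Proof.
  apply AnF_ext with (fun T mu => (T / (1 + T ^ 2) + / (1 + T ^ 2) * (l mu * phi T)) * (dpsi (l mu) T * / (1 + zl T mu))).
  { intros T mu _ _.
    transitivity (psi (l mu) T * dpsi (l mu) T * / (1 + (T + l mu * phi T) ^ 2)); [|reflexivity].
    rewrite invpsi_eq. unfold psi, Rdiv. ring. }
  apply AnF_le with ((/ 2 + 1 * / 4) * (5 / 4 * 2)); [lra|].
  apply AnF_mult; auto.
  - apply AnF_plus; auto.
    + apply (AnF_fun a b r (fun T => T / (1 + T ^ 2))); [exact cont_rat | intros; apply rat_le].
    + apply AnF_mult; [apply ab_le | exact Hr | | apply AnF_phi_l].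
      apply AnF_inv1.
  - apply AnF_mult; [apply ab_le | exact Hr | apply AnF_dpsi | apply AnF_invpsi].
Qed.

(** Written as an integral from [a], where [psi] is the identity, the arctangent needs only rational
    families and no power series of its own. *)
Lemma atan_identity (lam T : R) :
  RInt (fun t => / (1 + t ^ 2) - dpsi lam t / (1 + psi lam t ^ 2)) a T = atan T - atan (psi lam T).
Proof.
  assert (Hc : Cont (fun t => / (1 + psi lam t ^ 2))).
  { intros x. apply (cont_comp (fun t => / (1 + t ^ 2)) (psi lam)); [apply psi_cont | apply inv1_cont]. }
  rewrite (RInt_is_derive (fun t => atan t - atan (psi lam t))).
  - rewrite (psi_out lam a) by (left; unfold a; lra). ringR.
  - intros x.
    assert (H2 := is_derive_comp (K := R_AbsRing) (V := R_NormedModule) atan (psi lam) x _ _ (is_derive_atan _) (psi_derive lam x)).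
    assert (H3 := is_derive_minus (K := R_AbsRing) (V := R_NormedModule) _ _ _ _ _ (is_derive_atan x) H2).
    match type of H3 with is_derive _ _ ?z => replace (/ (1 + x ^ 2) - dpsi lam x / (1 + psi lam x ^ 2)) with z end.
    + exact H3.
    + unfold minus, plus, opp, scal; simpl; unfold mult; simpl. unfold Rsqr, Rdiv. rewrite !Rmult_1_r. ring.
  - intros x. cont. apply cont_mult; [apply dpsi_cont | apply Hc].
Qed.

Lemma AnF_atan : An (fun T mu => atan T - atan (psi (l mu) T)) 4.
Proof.
  apply AnF_ext with (fun T mu => RInt (fun t => / (1 + t ^ 2) - dpsi (l mu) t / (1 + psi (l mu) t ^ 2)) a T).
  { intros T mu _ _. apply atan_identity. }
  apply AnF_le with ((b - a) * (1 + 5 / 2)); [rewrite ba_eq; lra|].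
  apply (AnF_volterra a b r ab_le Hr (fun t mu => / (1 + t ^ 2) - dpsi (l mu) t / (1 + psi (l mu) t ^ 2))).
  apply AnF_minus; [exact ab_le | exact Hr | | apply AnF_jac].
  apply AnF_inv1.
Qed.

(** 16 comes from [Lop]; the smooth logarithm costs the length 2 d <= sqrt (2 d), whence 17. *)
Lemma AnF_near (v : R -> R -> R) (M : R) : An v M ->
  An (fun T mu => Lop a b (fun t => v t mu) T + RInt (fun t => ln (1 + l mu * q T t) * (1 * v t mu)) a b)
    (17 * sqrt (2 * d) * M).
Proof.
  intros Hv. pose proof (AnF_nonneg a b r ab_le v M Hv) as HM. pose proof ba_sqrt as Hs.
  apply AnF_le with (16 * sqrt (b - a) * M + 2 * d * M); [rewrite ba_eq; nra|].
  apply AnF_plus; auto.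
  - apply AnF_Lop; [exact ab_le | rewrite ba_eq; lra | exact Hr | exact Hv].
  - apply (AnF_logker a b r a b L (2 * d) M q v (fun _ => 1) l ab_le Hr ab_le); auto.
    + intros; apply cont_const.
    + rewrite RInt_const_R, Rabs_R1, ba_eq. lra.
Qed.

Lemma inv3PI : 0 < / (3 * PI) <= 1.
Proof.
  pose proof PI2_1. split; [apply Rinv_0_lt_compat; lra|]. rewrite <- Rinv_1. apply Rinv_le_contravar; lra.
Qed.

Lemma AnF_Yarg (v : R -> R -> R) (M : R) : An v M -> 17 * sqrt (2 * d) * M <= 1 ->
  An (Y v) Qc.
Proof.
  intros Hv HM. pose proof inv3PI as H3. pose proof (HI0 0) as HI00.
  pose proof (AnF_nonneg a b r ab_le v M Hv) as HM0. pose proof (sqrt_pos (2 * d)).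
  assert (0 <= 17 * sqrt (2 * d) * M) by (apply Rmult_le_pos; lra).
  apply AnF_le with (PI + 4 + Rabs (- / (3 * PI)) * (17 * sqrt (2 * d) * M + 2 * Ih 0)).
  - rewrite Rabs_Ropp, Rabs_right by lra. unfold Qc. pose proof PI_4. nra.
  - unfold Yarg. apply AnF_plus; auto.
    + apply AnF_plus; [exact Hr | | apply AnF_atan].
      apply (AnF_fun a b r (fun T => PI / 2 - atan T + th T)); [exact cont_S0|].
      intros t _. specialize (HthB t). rewrite Rabs_right; lra.
    + apply AnF_scal; [exact ab_le | exact Hr|]. apply AnF_plus; [exact Hr | now apply AnF_near|].
      now apply AnF_Efar.
Qed.

(** Only the near field depends on the density, and it does so linearly; the far field and the
    arctangents cancel. *)
Lemma AnF_Yarg_diff (v v' : R -> R -> R) (M M' D : R) :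
  An v M -> An v' M' -> An (fun t mu => v t mu - v' t mu) D ->
  An (fun T mu => Y v T mu - Y v' T mu) (17 * sqrt (2 * d) * D).
Proof.
  intros Hv Hv' HD. pose proof inv3PI as H3.
  pose proof (AnF_nonneg a b r ab_le _ _ HD) as HD0. pose proof (sqrt_pos (2 * d)).
  assert (0 <= 17 * sqrt (2 * d) * D) by (apply Rmult_le_pos; lra).
  apply AnF_le with (Rabs (- / (3 * PI)) * (17 * sqrt (2 * d) * D)).
  { rewrite Rabs_Ropp, Rabs_right by lra. nra. }
  assert (HN := AnF_scal a b r ab_le Hr (- / (3 * PI)) _ _ (AnF_near _ _ HD)).
  revert HN. apply AnF_ext. intros T mu HT Hmu.
  destruct (AnF_continuous a b r ab_le Hr v M mu Hv Hmu) as (u & Hu & Eu).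
  destruct (AnF_continuous a b r ab_le Hr v' M' mu Hv' Hmu) as (u' & Hu' & Eu').
  assert (Hlm := l_bound r l Hr Hl mu Hmu).
  rewrite (Lop_ext a b (fun t => v t mu - v' t mu) (fun t => u t - u' t) T ab_le) by (intros; now rewrite Eu, Eu').
  rewrite (RInt_ext_in (fun t => ln (1 + l mu * q T t) * (1 * (v t mu - v' t mu))) (fun t => ln (1 + l mu * q T t) * (1 * u t) - ln (1 + l mu * q T t) * (1 * u' t)) a b ab_le)
    by (intros; rewrite Eu, Eu' by assumption; ring).
  rewrite <- Lop_minus by assumption.
  rewrite RInt_minusR by (cont).
  unfold Yarg.
  rewrite (Lop_ext a b (fun t => v t mu) u T ab_le) by (intros; now rewrite Eu).
  rewrite (Lop_ext a b (fun t => v' t mu) u' T ab_le) by (intros; now rewrite Eu').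
  rewrite (RInt_ext_in (fun t => ln (1 + l mu * q T t) * (1 * v t mu)) (fun t => ln (1 + l mu * q T t) * (1 * u t)) a b ab_le)
    by (intros; now rewrite Eu).
  rewrite (RInt_ext_in (fun t => ln (1 + l mu * q T t) * (1 * v' t mu)) (fun t => ln (1 + l mu * q T t) * (1 * u' t)) a b ab_le)
    by (intros; now rewrite Eu').
  ring.
Qed.

Lemma exp_le_3' (x : R) : x <= 1 -> exp x <= 3.
Proof.
  intros H. apply Rle_trans with (exp 1); [|apply exp_le_3].
  destruct H as [H| ->]; [left; now apply exp_increasing | lra].
Qed.

Lemma AnF_pref : An (fun T _ => c0 * exp (- Ih T)) (Rabs c0).
Proof.
  apply (AnF_fun a b r (fun T => c0 * exp (- Ih T))).
  - cont.
  - intros t _. rewrite Rabs_mult. pose proof (exp_Ih_le t). rewrite (Rabs_right (exp _)) by lra.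
    pose proof (Rabs_pos c0). nra.
Qed.

Lemma AnF_expint (v : R -> R -> R) : An v Rad -> An (fun T mu => exp (RInt (fun t => v t mu) a T)) 3.
Proof.
  intros Hv. apply AnF_le with (exp ((b - a) * Rad)).
  (* [Hd2] makes (b - a) [Rad] at most 1. *)
  - apply exp_le_3'. rewrite ba_eq. pose proof ba_sqrt. pose proof Rad_pos. nra.
  - apply AnF_exp; [exact ab_le | exact Hr|]. now apply (AnF_volterra a b r ab_le Hr).
Qed.

Lemma AnF_sinY (v : R -> R -> R) : An v Rad -> An (fun T mu => sin (Y v T mu)) Sq.
Proof.
  intros Hv. apply (AnF_sin a b r ab_le Hr (Y v)).
  now apply (AnF_Yarg v Rad).
Qed.

Lemma AnF_G (v : R -> R -> R) : An v Rad -> An (fun T mu => G (l mu) (fun t => v t mu) T) Rad.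
Proof.
  intros Hv. unfold G.
  apply AnF_le with (Rabs c0 * 4 * (Sq * 3) + Rabs c0).
  { unfold Rad. pose proof (Rabs_pos c0). lra. }
  apply AnF_minus; auto.
  - apply AnF_mult; auto.
    + apply AnF_mult; [exact ab_le | exact Hr | apply AnF_pref | apply AnF_rational].
    + apply AnF_mult; [exact ab_le | exact Hr | now apply AnF_sinY | now apply AnF_expint].
  - apply (AnF_fun a b r w); [exact cont_w | intros; apply w_bound].
Qed.

(** Product rule for sine times exponential, with [Hd3] supplying the factor 1/2. The restriction
    [D <= 2 * Rad], together with [Hd2], keeps the inner exponentials below 3. *)
Lemma AnF_G_diff (v v' : R -> R -> R) (D : R) :
  An v Rad -> An v' Rad -> D <= 2 * Rad -> An (fun t mu => v t mu - v' t mu) D ->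
  An (fun T mu => G (l mu) (fun t => v t mu) T - G (l mu) (fun t => v' t mu) T) (D / 2).
Proof.
  intros Hv Hv' HDR HD. pose proof (AnF_nonneg a b r ab_le _ _ HD) as HD0.
  pose proof (sqrt_pos (2 * d)) as Hs0. pose proof ba_sqrt as Hs. pose proof Rad_pos as HR.
  set (s := sqrt (2 * d)) in *. pose proof (exp_pos (Qc * Qc)) as HQ. pose proof Sq_pos as HS.
  assert (HsD : 17 * s * D <= 2) by nra.
  assert (Hsd0 : 0 <= s * D) by (apply Rmult_le_pos; lra).
  assert (HdY := AnF_Yarg_diff v v' Rad Rad D Hv Hv' HD). fold s in HdY.
  assert (HY := AnF_Yarg v Rad Hv Hd2). assert (HY' := AnF_Yarg v' Rad Hv' Hd2).
  assert (Hsin : An (fun T mu => sin (Y v T mu) - sin (Y v' T mu)) (51 * exp (Qc * Qc) * (s * D))).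
  { apply AnF_le with (Rabs 2 * (exp ((Rabs (/ 2) * (Qc + Qc)) * (Rabs (/ 2) * (Qc + Qc))) *
      ((Rabs (/ 2) * (17 * s * D)) * exp ((Rabs (/ 2) * (17 * s * D)) * (Rabs (/ 2) * (17 * s * D)))))).
    { rewrite !Rabs_right by lra. replace (/ 2 * (Qc + Qc)) with Qc by field.
      assert (He := exp_le_3' (/ 2 * (17 * s * D) * (/ 2 * (17 * s * D))) ltac:(assert (0 <= / 2 * (17 * s * D) <= 1) by lra; nra)).
      pose proof (exp_pos (/ 2 * (17 * s * D) * (/ 2 * (17 * s * D)))).
      set (e := exp (/ 2 * (17 * s * D) * (/ 2 * (17 * s * D)))) in *.
      replace (2 * (exp (Qc * Qc) * (/ 2 * (17 * s * D) * e))) with (exp (Qc * Qc) * (17 * (s * D)) * e) by field.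
      replace (51 * exp (Qc * Qc) * (s * D)) with (exp (Qc * Qc) * (17 * (s * D)) * 3) by ring.
      apply Rmult_le_compat_l; [apply Rmult_le_pos; lra | exact He]. }
    (* sin x - sin y = 2 cos ((x + y) / 2) sin ((x - y) / 2) exhibits the small factor; 51 = 17 *
       3. *)
    apply AnF_ext with (fun T mu => 2 * (cos (/ 2 * (Y v T mu + Y v' T mu)) *
       sin (/ 2 * (Y v T mu - Y v' T mu)))).
    { intros T mu _ _. set (x := Yarg _ _ _). set (y := Yarg _ (fun t => v' t mu) _).
      replace x with (/ 2 * (x + y) + / 2 * (x - y)) at 3 by field.
      replace y with (/ 2 * (x + y) - / 2 * (x - y)) at 5 by field.
      rewrite sin_plus, sin_minus. ring. }
    apply AnF_scal; [exact ab_le | exact Hr|]. apply AnF_mult; auto.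
    - apply (AnF_cos a b r ab_le Hr (fun T mu => / 2 * (Y v T mu + Y v' T mu))).
      apply AnF_scal; [exact ab_le | exact Hr|]. now apply AnF_plus.
    - apply (AnF_sin a b r ab_le Hr (fun T mu => / 2 * (Y v T mu - Y v' T mu))).
      apply AnF_scal; auto. }
  (* Here exp x - exp y = exp y (exp (x - y) - 1), each of the two factors contributing a 3. *)
  assert (Hexp : An (fun T mu => exp (RInt (fun t => v t mu) a T) - exp (RInt (fun t => v' t mu) a T)) (9 * (s * D))).
  { assert (HI1 := AnF_volterra a b r ab_le Hr _ _ HD). rewrite ba_eq in HI1.
    assert (HE := AnF_expm1 a b r ab_le Hr _ _ HI1).
    assert (HM := AnF_mult a b r ab_le Hr _ _ _ _ (AnF_expint v' Hv') HE).
    apply AnF_le with (M' := 9 * (s * D)) in HM.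
    - revert HM. apply AnF_ext. intros T mu HT Hmu.
      destruct (AnF_continuous a b r ab_le Hr v Rad mu Hv Hmu) as (u & Hu & Eu).
      destruct (AnF_continuous a b r ab_le Hr v' Rad mu Hv' Hmu) as (u' & Hu' & Eu').
      rewrite (RInt_ext_in (fun t => v t mu - v' t mu) (fun t => u t - u' t)) by (try lra; intros; rewrite Eu, Eu'; lra).
      rewrite (RInt_ext_in (fun t => v t mu) u) by (try lra; intros; rewrite Eu; lra).
      rewrite (RInt_ext_in (fun t => v' t mu) u') by (try lra; intros; rewrite Eu'; lra).
      rewrite RInt_minusR by assumption.
      rewrite Rmult_minus_distr_l, <- exp_plus, Rmult_1_r. f_equal. f_equal. ring.
    - assert (2 * d * D <= s * D) by (apply Rmult_le_compat_r; lra).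
      assert (0 <= 2 * d * D) by (apply Rmult_le_pos; lra).
      assert (He := exp_le_3' (2 * d * D) ltac:(lra)). pose proof (exp_pos (2 * d * D)). nra. }
  apply AnF_le with (Rabs c0 * 4 * (51 * exp (Qc * Qc) * (s * D) * 3 + Sq * (9 * (s * D)))).
  { unfold Kc in Hd3. fold s in Hd3.
    replace (Rabs c0 * 4 * (51 * exp (Qc * Qc) * (s * D) * 3 + Sq * (9 * (s * D))))
      with (4 * Rabs c0 * (153 * exp (Qc * Qc) + 9 * Sq) * s * D) by ring.
    replace (D / 2) with (/ 2 * D) by field. apply Rmult_le_compat_r; [exact HD0 | exact Hd3]. }
  apply AnF_ext with (fun T mu => c0 * exp (- Ih T) * (psi (l mu) T * dpsi (l mu) T / (1 + psi (l mu) T ^ 2)) *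
    ((sin (Y v T mu) - sin (Y v' T mu)) * exp (RInt (fun t => v t mu) a T) +
     sin (Y v' T mu) * (exp (RInt (fun t => v t mu) a T) - exp (RInt (fun t => v' t mu) a T)))).
  { intros T mu _ _. unfold G. ring. }
  apply AnF_mult; auto.
  - apply AnF_mult; [exact ab_le | exact Hr | apply AnF_pref | apply AnF_rational].
  - apply AnF_plus; auto.
    + apply AnF_mult; [exact ab_le | exact Hr | exact Hsin | now apply AnF_expint].
    + apply AnF_mult; [exact ab_le | exact Hr | now apply AnF_sinY | exact Hexp].
Qed.

(** * Picard iterates and the analytic dependence of the solution on [lam] *)

Fixpoint iterG (lam : R) (n : nat) : R -> R :=
  match n with O => fun _ => 0 | S n => G lam (iterG lam n) end.

Lemma AnF_iter (n : nat) : An (fun t mu => iterG (l mu) n t) Rad.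
Proof.
  induction n as [|n IH]; simpl.
  - apply AnF_const. rewrite Rabs_R0. apply Rad_pos.
  - apply (AnF_G (fun t mu => iterG (l mu) n t)). exact IH.
Qed.

Lemma AnF_iter_diff (n : nat) : An (fun t mu => iterG (l mu) (S n) t - iterG (l mu) n t) (2 * Rad * (/ 2) ^ n).
Proof.
  pose proof Rad_pos as HR. induction n as [|n IH].
  - simpl pow. rewrite Rmult_1_r. replace (2 * Rad) with (Rad + Rad) by ring.
    apply AnF_minus; [exact ab_le | exact Hr | apply (AnF_iter 1) | apply (AnF_iter 0)].
  - replace (2 * Rad * (/ 2) ^ S n) with (2 * Rad * (/ 2) ^ n / 2) by (simpl; field).
    apply (AnF_G_diff (fun t mu => iterG (l mu) (S n) t) (fun t mu => iterG (l mu) n t)); try apply AnF_iter; [|exact IH].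
    assert (0 <= (/ 2) ^ n <= 1) by (split; [apply pow_le; lra | rewrite <- (pow1 n); apply pow_incr; lra]). nra.
Qed.

End Gen2.

(** The contraction estimate with constant [l = lam], applied to an iterate and to the fixed point
    [V lam] itself. This ties the formal iteration to the given solution. *)
Lemma iter_limit (lam T : R) (n : nat) : Rabs lam <= / 4 -> a <= T <= b ->
  Rabs (iterG lam n T - V lam T) <= 2 * Rad * (/ 2) ^ n.
Proof.
  intros H HT. pose proof Rad_pos as HR.
  assert (Hl := AnF_cst lam H).
  assert (HV : AnF a b 1 (fun t _ => V lam t) Rad).
  { apply AnF_fun; [apply V_cont|]. intros t _. pose proof (V_bound lam t H). pose proof Sq_pos. pose proof (Rabs_pos c0).
    unfold Rad. nra. }
  assert (HA : AnF a b 1 (fun t _ => iterG lam n t - V lam t) (2 * Rad * (/ 2) ^ n)).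
  { induction n as [|n IH].
    - simpl pow. rewrite Rmult_1_r. replace (2 * Rad) with (Rad + Rad) by ring.
      apply (AnF_minus a b 1 ab_le Rlt_0_1 (fun t _ => iterG lam 0 t)); [|exact HV].
      exact (AnF_iter 1 (fun _ => lam) Rlt_0_1 Hl 0).
    - replace (2 * Rad * (/ 2) ^ S n) with (2 * Rad * (/ 2) ^ n / 2) by (simpl; field).
      apply AnF_ext with (fun T _ => G lam (iterG lam n) T - G lam (V lam) T).
      { intros t _ Ht _. simpl. now rewrite <- (G_fix lam t H Ht). }
      apply (AnF_G_diff 1 (fun _ => lam) Rlt_0_1 Hl (fun t _ => iterG lam n t) (fun t _ => V lam t)); [| exact HV | | exact IH].
      + exact (AnF_iter 1 (fun _ => lam) Rlt_0_1 Hl n).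
      + assert (0 <= (/ 2) ^ n <= 1) by (split; [apply pow_le; lra | rewrite <- (pow1 n); apply pow_incr; lra]). nra. }
  exact (AnF_bound a b 1 Rlt_0_1 _ _ T 0 HA HT ltac:(rewrite Rabs_R0; lra)).
Qed.

Lemma quarter_pos : 0 < / 4.
Proof. lra. Qed.

Lemma AnF_lam : AnF a b (/ 4) (fun _ mu => mu) (/ 4).
Proof. apply AnF_id. lra. Qed.

Lemma AnF_V : AnF a b (/ 4) (fun t mu => V mu t) (2 * Rad / (1 - / 2)).
Proof.
  apply (AnF_series a b (/ 4) ab_le quarter_pos (fun n t mu => iterG mu (S n) t - iterG mu n t) _ (fun n => 2 * Rad * (/ 2) ^ n)).
  - intros n. exact (AnF_iter_diff (/ 4) (fun mu => mu) quarter_pos AnF_lam n).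
  - apply ser_geom. lra.
  - intros t mu Ht Hmu. apply (ser_geom_bound _ _ (2 * Rad * / 2) (/ 2)); [lra|]. intros n.
    (* Telescoping leaves no constant, since the iteration starts from 0. *)
    assert (E : sum_f_R0 (fun n => iterG mu (S n) t - iterG mu n t) n = iterG mu (S n) t).
    { clear. induction n as [|n IH]; [simpl; ring | rewrite tech5, IH; ring]. }
    rewrite E. eapply Rle_trans; [apply iter_limit; [lra | exact Ht]|]. right; simpl; ring.
Qed.

Lemma analytic_local : exists M M',
  AnF a b (/ 4) (fun T mu => th (T + mu * phi T)) M /\ AnF a b (/ 4) (fun T mu => Ih (T + mu * phi T)) M'.
Proof.
  pose proof AnF_V as HV. pose proof quarter_pos as Hq4. pose proof ab_le as ab_le'.
  destruct (cont_bounded th a b ab_le Hth) as [Kt HKt]. destruct (cont_bounded Ih a b ab_le HIc) as [Ki HKi].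
  eexists; eexists; split.
  - apply AnF_ext with (fun T mu => th T + - / (3 * PI) *
       (Lop a b (fun t => V mu t) T + RInt (fun t => ln (1 + mu * q T t) * (1 * V mu t)) a b + Efar mu T)).
    { intros T mu HT Hmu. change (fun t => V mu t) with (V mu). rewrite <- theta_identity by (auto; lra). unfold psi. ring. }
    apply AnF_plus; [exact Hq4 | apply (AnF_fun a b (/ 4) th Kt Hth HKt)|].
    apply AnF_scal; [exact ab_le | exact Hq4|]. apply AnF_plus; auto.
    + apply (AnF_near (/ 4) (fun mu => mu) Hq4 AnF_lam (fun t mu => V mu t)). exact HV.
    + apply (AnF_Efar (/ 4) (fun mu => mu) Hq4 AnF_lam).
  - apply AnF_ext with (fun T mu => Ih T - RInt (fun t => V mu t) a T).
    { intros T mu HT Hmu. symmetry. apply Ih_identity. }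
    apply AnF_minus; [exact ab_le | exact Hq4 | apply (AnF_fun a b (/ 4) Ih Ki HIc HKi)|].
    apply (AnF_volterra a b (/ 4) ab_le Hq4). exact HV.
Qed.

End Local.

(** The base interval collapses to T0, where [p = phi T0 > 0] makes mu p sweep a full neighbourhood
    of 0. *)
Lemma analytic_T (T0 : R) : exists p M, 0 < p /\ AnF T0 T0 (/ 4) (fun _ mu => th (T0 + mu * p)) M /\ AnF T0 T0 (/ 4) (fun _ mu => Ih (T0 + mu * p)) M.
Proof.
  pose proof Rad_pos as HR. pose proof Sq_pos as HS. pose proof (exp_pos (Qc * Qc)) as HQ. pose proof (Rabs_pos c0) as Hc.
  assert (HK : 0 <= Kc) by (unfold Kc; nra).
  (* [s] will be sqrt (2 d); the summands give in turn s <= 1, 17 s [Rad] <= 1 and [Kc] s <= 1/2. *)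
  set (s := / (1 + 17 * Rad + 2 * Kc)).
  assert (Hs : 0 < s <= 1).
  { unfold s. split; [apply Rinv_0_lt_compat; lra|]. rewrite <- Rinv_1. apply Rinv_le_contravar; lra. }
  assert (Es : s * (1 + 17 * Rad + 2 * Kc) = 1) by (unfold s; field; lra).
  set (d := s ^ 2 / 2).
  assert (Hd : 0 < d <= / 2) by (unfold d; nra).
  assert (Hsq : sqrt (2 * d) = s).
  { unfold d. replace (2 * (s ^ 2 / 2)) with (s ^ 2) by field. apply sqrt_pow2. lra. }
  destruct (bump_exists T0 d ltac:(lra)) as (phi & dphi & q & L & H1 & H2 & H3 & H4 & H5 & H6 & H7 & H8 & H9 & H10).
  destruct (analytic_local T0 d L phi dphi q) as (M & M' & HM & HM'); auto.
  { rewrite Hsq. nra. }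
  { rewrite Hsq. nra. }
  exists (phi T0), (Rmax M M'). split; [exact H6|].
  assert (Hsub : forall (u : R -> R -> R) N, AnF (T0 - d) (T0 + d) (/ 4) u N -> AnF T0 T0 (/ 4) (fun _ mu => u T0 mu) N).
  { intros u N (c & A1 & A2 & A3). exists c. split; [exact A1|]. split.
    - intros t n Ht. apply A2. lra.
    - intros t mu Ht Hmu. replace t with T0 by lra. apply A3; [lra | exact Hmu]. }
  split.
  - apply AnF_le with M; [apply Rmax_l|]. exact (Hsub _ _ HM).
  - apply AnF_le with M'; [apply Rmax_r|]. exact (Hsub _ _ HM').
Qed.

End Core.

(** * Regularity of the solution and change of variables *)

(** A division of [0, x] is prolonged by one of [x, y]; integrability over [x, y] is never
    invoked. *)
Lemma HK_incr (f : R -> R) (x y M I J : R) :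
  0 <= x <= y -> (forall s, x <= s <= y -> 0 <= f s <= M) ->
  HK_integral f 0 x I -> HK_integral f 0 y J -> 0 <= J - I <= M * (y - x).
Proof.
  intros Hxy Hf [_ HI] [_ HJ].
  assert (Key : forall eps, 0 < eps -> - eps <= J - I <= M * (y - x) + eps).
  { intros eps Heps.
    destruct (HI (eps / 2)) as (d1 & Hd1 & H1); [lra|].
    destruct (HJ (eps / 2)) as (d2 & Hd2 & H2); [lra|].
    destruct (gauge_min d1 d2 Hd1 Hd2) as (e & He & L1 & L2).
    destruct (cousin e 0 x He ltac:(lra)) as [P HP].
    destruct (cousin e x y He ltac:(lra)) as [Q HQ].
    specialize (H1 P (fine_mono _ _ _ _ _ L1 HP)).
    specialize (H2 (P ++ Q) (fine_mono _ _ _ _ _ L2 (fine_app _ _ _ _ _ _ HP HQ))).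
    rewrite (rsum_app _ f P Q 0 x HP) in H2.
    assert (Hc : forall (c : R) (Q : list (R * R)) x, fine e x y Q -> rsum (fun _ => c) x Q = c * (y - x)).
    { intros c. induction Q0 as [|[t z] Q0 IH]; simpl; intros x0 HQ0; [subst; ring|].
      destruct HQ0 as (_ & _ & _ & _ & H5). rewrite (IH z H5). ring. }
    pose proof (rsum_le e (fun _ => 0) f Q x y HQ ltac:(intros s Hs; apply Hf; exact Hs)) as B1.
    pose proof (rsum_le e f (fun _ => M) Q x y HQ ltac:(intros s Hs; apply Hf; exact Hs)) as B2.
    rewrite Hc in B1, B2 by exact HQ.
    apply Rabs_def2 in H1. apply Rabs_def2 in H2. lra. }
  split; apply le_epsilon; intros eps Heps; specialize (Key eps Heps); lra.
Qed.

Lemma sqrt_le_2 (x : R) : x <= 4 -> sqrt x <= 2.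
Proof.
  intros H. replace 2 with (sqrt 4); [now apply sqrt_le_1_alt|].
  replace 4 with (2 * 2) by ring. apply sqrt_square. lra.
Qed.

Lemma HK_inv_sqrt (p : R) : 0 <= p <= 2 ->
  forall b, 0 <= b <= 2 -> exists l, l <= 8 /\ HK_integral (fun s => / sqrt (Rabs (s - p))) 0 b l.
Proof.
  intros Hp b Hb.
  (* [sqrt] vanishes on negative numbers, so one formula is a primitive on both sides of [p]. Being
     increasing, it also serves as its own majorant. *)
  set (F := fun s => 2 * sqrt (s - p) - 2 * sqrt (p - s)).
  exists (F b - F 0). split.
  - unfold F. pose proof (sqrt_pos (p - b)). pose proof (sqrt_pos (0 - p)).
    pose proof (sqrt_le_2 (b - p) ltac:(lra)). pose proof (sqrt_le_2 (p - 0) ltac:(lra)). lra.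
  - apply (HK_FTC_except F _ F 0 b p); [lra | | |].
    + intros x _ Hx. destruct (Rtotal_order x p) as [H|[H|H]]; [|contradiction|].
      * apply (is_derive_ext_loc (fun s => - 2 * sqrt (p - s))).
        -- assert (Hp0 : 0 < p - x) by lra. exists (mkposreal _ Hp0). intros y Hy.
           unfold ball in Hy; simpl in Hy; unfold AbsRing_ball, abs, minus, plus, opp in Hy; simpl in Hy.
           apply Rabs_def2 in Hy. unfold F. rewrite (sqrt_neg_0 (y - p)) by lra. ringR.
        -- rewrite Rabs_left by lra. replace (- (x - p)) with (p - x) by ring.
           auto_derive; [lra|]. change (p + - x) with (p - x). field. apply Rgt_not_eq, sqrt_lt_R0. lra.
      * apply (is_derive_ext_loc (fun s => 2 * sqrt (s - p))).
        -- assert (Hp0 : 0 < x - p) by lra. exists (mkposreal _ Hp0). intros y Hy.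
           unfold ball in Hy; simpl in Hy; unfold AbsRing_ball, abs, minus, plus, opp in Hy; simpl in Hy.
           apply Rabs_def2 in Hy. unfold F. rewrite (sqrt_neg_0 (p - y)) by lra. ringR.
        -- rewrite Rabs_right by lra. auto_derive; [lra|]. change (x + - p) with (x - p). field. apply Rgt_not_eq, sqrt_lt_R0. lra.
    + intros x y Hxy. unfold F.
      pose proof (sqrt_le_1_alt (x - p) (y - p) ltac:(lra)). pose proof (sqrt_le_1_alt (p - y) (p - x) ltac:(lra)).
      rewrite Rabs_right; lra.
    + assert (Hs : Cont sqrt) by (intros; apply continuous_sqrt).
      unfold F. apply cont_minus; (cont).
      * apply (cont_comp sqrt (fun s => s - p)); [cont | apply Hs].
      * apply (cont_comp sqrt (fun s => p - s)); [cont | apply Hs].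
Qed.

(** * Modulus of continuity of the kernel *)

Definition qr (x : R) : R := sqrt (sqrt x).

Lemma qr_pos (x : R) : 0 <= qr x.
Proof. apply sqrt_pos. Qed.

Lemma qr_sq (x : R) : qr x * qr x = sqrt x.
Proof. apply sqrt_sqrt, sqrt_pos. Qed.

Lemma qr_mult (x y : R) : 0 <= x -> 0 <= y -> qr (x * y) = qr x * qr y.
Proof. intros. unfold qr. rewrite sqrt_mult by assumption. apply sqrt_mult; apply sqrt_pos. Qed.

Lemma qr_le (x y : R) : x <= y -> qr x <= qr y.
Proof. intros. apply sqrt_le_1_alt, sqrt_le_1_alt; assumption. Qed.

Lemma qr_4 : qr 4 <= 2.
Proof. unfold qr. apply sqrt_le_2. apply Rle_trans with 2; [apply sqrt_le_2; lra | lra]. Qed.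

Lemma ln1p_qr (y : R) : 0 <= y -> ln (1 + y) <= 4 * qr y.
Proof.
  intros Hy. pose proof (qr_pos y) as Hs. set (s := qr y) in *.
  assert (E : y = s ^ 4).
  { replace (s ^ 4) with ((s * s) * (s * s)) by ring. unfold s. rewrite qr_sq. symmetry. now apply sqrt_sqrt. }
  apply Rle_trans with (ln ((1 + s) ^ 4)).
  - apply ln_le; [lra|]. rewrite E.
    replace ((1 + s) ^ 4) with (1 + s ^ 4 + s * (4 + 6 * s + 4 * s ^ 2)) by ring.
    assert (0 <= s * (4 + 6 * s + 4 * s ^ 2)) by (apply Rmult_le_pos; nra). lra.
  - rewrite ln_pow by lra. simpl INR. pose proof (ln_le_minus (1 + s) ltac:(lra)). lra.
Qed.

Lemma ln_diff_qr (x y : R) : 0 < x -> 0 < y ->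
  Rabs (ln x - ln y) <= 4 * (qr (Rabs (x - y) * / x) + qr (Rabs (x - y) * / y)).
Proof.
  assert (W : forall x y, 0 < x -> x <= y -> Rabs (ln x - ln y) <= 4 * qr (Rabs (x - y) * / x)).
  { clear. intros x y Hx Hxy. rewrite (Rabs_left1 (x - y)) by lra.
    pose proof (ln_le x y Hx Hxy). rewrite Rabs_left1 by lra.
    replace (- (ln x - ln y)) with (ln (1 + - (x - y) * / x)).
    - apply ln1p_qr. apply Rmult_le_pos; [lra | left; now apply Rinv_0_lt_compat].
    - replace (1 + - (x - y) * / x) with (y / x) by (field; lra). rewrite ln_div by lra. ring. }
  intros Hx Hy. pose proof (qr_pos (Rabs (x - y) * / x)). pose proof (qr_pos (Rabs (x - y) * / y)).
  destruct (Rle_or_lt x y) as [Hc|Hc].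
  - specialize (W x y Hx Hc). lra.
  - specialize (W y x Hy ltac:(lra)). rewrite (Rabs_minus_sym (ln x)), (Rabs_minus_sym x). 
    rewrite (Rabs_minus_sym y) in W. rewrite (Rabs_minus_sym y). lra.
Qed.

(** Up to PI/3 the cosine stays above 1/2; beyond, sin u >= 1/2 and u <= 2. *)
Lemma sin_ge_quarter (u : R) : 0 <= u <= PI / 2 -> u / 4 <= sin u.
Proof.
  intros Hu. pose proof PI2_1 as HP1. pose proof PI_4 as HP4.
  destruct (Rle_or_lt u (PI / 3)) as [H|H].
  - destruct (MVT_gen (fun u => sin u - u / 4) 0 u (fun u => cos u - / 4)) as (c & Hc & E).
    + intros x _. auto_derive; [exact I | field].
    + intros x _. apply continuity_pt_filterlim. apply (cont_derive (fun u => sin u - u / 4) x (cos x - / 4)). auto_derive; [exact I | field].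
    + rewrite Rmin_left, Rmax_right in Hc by lra. rewrite sin_0 in E.
      assert (cos (PI / 3) <= cos c) by (apply cos_decr_1; lra). rewrite cos_PI3 in H0. nra.
  - assert (sin (PI / 6) <= sin u) by (apply sin_incr_1; lra). rewrite sin_PI6 in H0. lra.
Qed.

Lemma sin_minus_lower (s p : R) : 0 <= s <= PI / 2 -> 0 <= p <= PI / 2 -> Rabs (s - p) / 4 <= Rabs (sin (s - p)).
Proof.
  intros Hs Hp. pose proof PI_RGT_0. destruct (Rle_or_lt p s) as [H1|H1].
  - rewrite (Rabs_right (s - p)) by lra. eapply Rle_trans; [apply sin_ge_quarter; lra | apply Rle_abs].
  - rewrite (Rabs_left (s - p)) by lra. replace (s - p) with (- (p - s)) at 2 by ring.
    rewrite sin_neg, Rabs_Ropp. replace (- (s - p)) with (p - s) by ring.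
    eapply Rle_trans; [apply sin_ge_quarter; lra | apply Rle_abs].
Qed.

(** |s - p| is at most both s + p and PI - (s + p), whichever lies in [0, PI/2]. *)
Lemma sin_plus_lower (s p : R) : 0 <= s <= PI / 2 -> 0 <= p <= PI / 2 -> Rabs (s - p) / 4 <= Rabs (sin (s + p)).
Proof.
  intros Hs Hp. pose proof PI_RGT_0.
  assert (Hle : forall u, Rabs (s - p) <= u -> 0 <= u <= PI / 2 -> Rabs (s - p) / 4 <= Rabs (sin u)).
  { intros u H1 H2. pose proof (sin_ge_quarter u H2). pose proof (Rle_abs (sin u)). lra. }
  destruct (Rle_or_lt (s + p) (PI / 2)) as [H1|H1].
  - apply Hle; [apply Rabs_le; lra | lra].
  - rewrite <- sin_PI_x. apply Hle; [apply Rabs_le; lra | lra].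
Qed.

Lemma sin_lip (x y : R) : Rabs (Rabs (sin x) - Rabs (sin y)) <= Rabs (x - y).
Proof.
  eapply Rle_trans; [apply Rabs_triang_inv2|]. rewrite <- (Rmult_1_l (Rabs (x - y))).
  apply (lipschitz_derive sin cos); [intros; apply is_derive_sin|]. intros; apply Rabs_le, COS_bound.
Qed.

Lemma Rabs_pos_of_lower (x y : R) : x <> y -> forall z, Rabs (x - y) / 4 <= Rabs z -> 0 < Rabs z.
Proof. intros H z Hz. assert (0 < Rabs (x - y)) by (apply Rabs_pos_lt; lra). lra. Qed.

Lemma Kker_split (s p : R) : 0 <= s <= PI / 2 -> 0 <= p <= PI / 2 -> s <> p ->
  Kker s p = ln (Rabs (sin (s + p))) - ln (Rabs (sin (s - p))).
Proof.
  intros Hs Hp Hn. unfold Kker.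
  pose proof (Rabs_pos_of_lower s p Hn _ (sin_plus_lower s p Hs Hp)).
  pose proof (Rabs_pos_of_lower s p Hn _ (sin_minus_lower s p Hs Hp)).
  unfold Rdiv. rewrite Rabs_mult, Rabs_inv, <- ln_div by assumption. reflexivity.
Qed.

Lemma qr_ratio (h x y : R) : 0 <= h -> 0 < x -> x / 4 <= y -> qr (h * / y) <= 2 * qr h * qr (/ x).
Proof.
  intros Hh Hx Hy. assert (0 < / x) by now apply Rinv_0_lt_compat.
  apply Rle_trans with (qr (4 * (h * / x))).
  - apply qr_le. replace (4 * (h * / x)) with (h * / (x / 4)) by (field; lra).
    apply Rmult_le_compat_l; [exact Hh|]. apply Rinv_le_contravar; lra.
  - assert (0 <= h * / x) by (apply Rmult_le_pos; lra).
    rewrite qr_mult, qr_mult by lra. pose proof qr_4. pose proof (qr_pos h). pose proof (qr_pos (/ x)).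
    assert (0 <= qr h * qr (/ x)) by now apply Rmult_le_pos. nra.
Qed.

(* Plays the role of the Cauchy-Schwarz inequality in [L^2]. *)
Lemma young_qr (h D z X : R) : 0 < h -> 0 <= z -> 0 <= X -> Rabs D <= 16 * qr h * X ->
  Rabs (D * z) <= 128 * qr h * (z ^ 2 + X ^ 2).
Proof.
  intros Hh Hz HX HD. rewrite Rabs_mult, (Rabs_right z) by lra.
  pose proof (qr_pos h). apply Rle_trans with (16 * qr h * X * z); [now apply Rmult_le_compat_r|].
  replace (16 * qr h * X * z) with (qr h * (16 * (X * z))) by ring.
  replace (128 * qr h * (z ^ 2 + X ^ 2)) with (qr h * (128 * (z ^ 2 + X ^ 2))) by ring.
  apply Rmult_le_compat_l; [assumption | nra].
Qed.

(** The two logarithms are treated alike, because |sin (s + p)| is also at least |s - p| / 4.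
    Exponent 1/4 is small enough that the squared weights |s - p|^(-1/2) remain integrable, as
    pairing with a square integrable function requires. *)
Lemma Kker_modulus (s p p' : R) :
  0 <= s <= PI / 2 -> 0 <= p <= PI / 2 -> 0 <= p' <= PI / 2 -> s <> p -> s <> p' ->
  Rabs (Kker s p - Kker s p') <= 16 * qr (Rabs (p - p')) * (qr (/ Rabs (s - p)) + qr (/ Rabs (s - p'))).
Proof.
  intros Hs Hp Hp' Hn Hn'. rewrite !Kker_split by assumption.
  set (h := Rabs (p - p')).
  assert (Half : forall u u', Rabs (s - p) / 4 <= Rabs (sin u) -> Rabs (s - p') / 4 <= Rabs (sin u') -> Rabs (u - u') = h ->
    Rabs (ln (Rabs (sin u)) - ln (Rabs (sin u'))) <= 8 * qr h * (qr (/ Rabs (s - p)) + qr (/ Rabs (s - p')))).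
  { intros u u' Hu Hu' Huu.
    pose proof (Rabs_pos_of_lower s p Hn _ Hu) as P1. pose proof (Rabs_pos_of_lower s p' Hn' _ Hu') as P2.
    pose proof (ln_diff_qr _ _ P1 P2) as HL. pose proof (sin_lip u u') as Hsl. rewrite Huu in Hsl.
    assert (Hh : 0 <= h) by apply Rabs_pos.
    assert (Q1 := qr_ratio h (Rabs (s - p)) (Rabs (sin u)) Hh ltac:(apply Rabs_pos_lt; lra) Hu).
    assert (Q2 := qr_ratio h (Rabs (s - p')) (Rabs (sin u')) Hh ltac:(apply Rabs_pos_lt; lra) Hu').
    assert (R1 : qr (Rabs (Rabs (sin u) - Rabs (sin u')) * / Rabs (sin u)) <= qr (h * / Rabs (sin u))).
    { apply qr_le, Rmult_le_compat_r; [left; now apply Rinv_0_lt_compat | exact Hsl]. }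
    assert (R2 : qr (Rabs (Rabs (sin u) - Rabs (sin u')) * / Rabs (sin u')) <= qr (h * / Rabs (sin u'))).
    { apply qr_le, Rmult_le_compat_r; [left; now apply Rinv_0_lt_compat | exact Hsl]. }
    lra. }
  assert (H1 := Half (s + p) (s + p') (sin_plus_lower s p Hs Hp) (sin_plus_lower s p' Hs Hp')
    ltac:(unfold h; f_equal; ring)).
  assert (H2 := Half (s - p) (s - p') (sin_minus_lower s p Hs Hp) (sin_minus_lower s p' Hs Hp')
    ltac:(unfold h; rewrite Rabs_minus_sym; f_equal; ring)).
  apply Rabs_le_between in H1. apply Rabs_le_between in H2. apply Rabs_le. lra.
Qed.

Lemma qr_inv_sq (x : R) : 0 < x -> qr (/ x) ^ 2 = / sqrt x.
Proof. intros H. simpl. rewrite Rmult_1_r, qr_sq. now apply sqrt_inv. Qed.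

Lemma inv_sqrt_nonneg (x : R) : 0 <= / sqrt x.
Proof.
  destruct (sqrt_pos x) as [H|H]; [left; now apply Rinv_0_lt_compat|].
  rewrite <- H, Rinv_0. lra.
Qed.

Lemma qr_continuous_0 (C eps : R) : 0 < eps -> exists d, 0 < d /\ forall x, x < d -> C * qr x < eps.
Proof.
  intros He. set (K := Rabs C + 1). assert (HK : 0 < K) by (unfold K; pose proof (Rabs_pos C); lra).
  exists ((eps / K) ^ 4). split; [apply pow_lt; now apply Rdiv_lt_0_compat|].
  intros x Hx. assert (Hq : 0 < eps / K) by now apply Rdiv_lt_0_compat.
  assert (qr x < eps / K).
  { destruct (Rle_or_lt x 0) as [H0|H0].
    - unfold qr. rewrite (sqrt_neg_0 x) by exact H0. rewrite sqrt_0. exact Hq.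
    - apply Rnot_le_lt. intros H1.
      assert ((eps / K) ^ 4 <= qr x ^ 4) by (apply pow_incr; lra).
      replace (qr x ^ 4) with ((qr x * qr x) * (qr x * qr x)) in H by ring.
      rewrite qr_sq, sqrt_sqrt in H by lra. lra. }
  pose proof (qr_pos x). pose proof (Rle_abs C).
  assert (C * qr x <= K * qr x) by (apply Rmult_le_compat_r; [assumption | unfold K; lra]).
  assert (K * qr x < K * (eps / K)) by (apply Rmult_lt_compat_l; assumption).
  replace (K * (eps / K)) with eps in * by (field; lra). lra.
Qed.

(** * Substitution of the cotangent *)

Lemma atan_lip (x y : R) : Rabs (atan x - atan y) <= Rabs (x - y).
Proof.
  rewrite <- (Rmult_1_l (Rabs (x - y))). apply (lipschitz_derive atan (fun x => / (1 + x ^ 2))).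
  - intros z. replace (/ (1 + z ^ 2)) with (/ (1 + Rsqr z)) by (unfold Rsqr; f_equal; ring). apply is_derive_atan.
  - intros z. apply inv1_le.
Qed.

Lemma acot_range (T : R) : 0 <= T -> 0 < PI / 2 - atan T <= PI / 2.
Proof.
  intros H. pose proof (atan_bound T). split; [lra|].
  destruct H as [H| <-]; [pose proof (atan_increasing 0 T H); rewrite atan_0 in *; lra | rewrite atan_0; lra].
Qed.

Lemma cot_acot (T : R) : cos (PI / 2 - atan T) / sin (PI / 2 - atan T) = T.
Proof. rewrite cos_shift, sin_shift. exact (tan_atan T). Qed.

Lemma atan_mono (x y : R) : x <= y -> atan x <= atan y.
Proof. intros [H| ->]; [left; now apply atan_increasing | lra]. Qed.

#[local] Hint Resolve inv1_cont cont_atan : cont.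

Lemma HK_cot (F : R -> R) (x y : R) : Cont F -> x <= y ->
  HK_integral (fun s => F (tan (PI / 2 - s))) (PI / 2 - atan y) (PI / 2 - atan x) (RInt (fun t => F t / (1 + t ^ 2)) x y).
Proof.
  intros HF Hxy. pose proof (atan_mono x y Hxy) as Ha.
  pose proof (atan_bound x) as Bx. pose proof (atan_bound y) as By.
  set (sy := PI / 2 - atan y). set (sx := PI / 2 - atan x).
  (* Clamping keeps the argument of [tan] away from its poles; x and y being finite, sy > 0 and sx <
     PI. *)
  set (g := fun s => F (tan (PI / 2 - clamp sy sx s))).
  assert (Hg : Cont g).
  { intros s. unfold g. apply (cont_comp F (fun s => tan (PI / 2 - clamp sy sx s))); [|apply HF].
    apply (cont_comp tan (fun s => PI / 2 - clamp sy sx s)).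
    - cont.
    - apply continuous_tan. apply Rgt_not_eq, cos_gt_0;
        pose proof (clamp_in sy sx s ltac:(unfold sx, sy; lra)); unfold sx, sy in *; lra. }
  apply HK_ext with g.
  { intros s Hs. unfold g. now rewrite clamp_id. }
  replace (RInt (fun t => F t / (1 + t ^ 2)) x y) with (RInt g sy sx).
  { apply HK_continuous; [unfold sx, sy; lra | exact Hg]. }
  rewrite <- (opp_RInt_swap (V := R_CompleteNormedModule) g sx sy) by now apply ex_RInt_cont.
  assert (E : RInt (fun t => - / (1 + t ^ 2) * g (PI / 2 - atan t)) x y = RInt g sx sy).
  { refine (RInt_comp (V := R_CompleteNormedModule) g (fun t => PI / 2 - atan t) (fun t => - / (1 + t ^ 2)) x y _ _).
    - intros; apply Hg.
    - intros t _. split; [|apply cont_opp, inv1_cont].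
      auto_derive; [exact I|]. unfold Rsqr. field. nra. }
  rewrite <- E.
  transitivity (- 1 * RInt (fun t => - / (1 + t ^ 2) * g (PI / 2 - atan t)) x y); [unfold opp; simpl; ringR|].
  rewrite <- RInt_scalR.
  - apply RInt_ext_in; [exact Hxy|]. intros t Ht. unfold g.
    pose proof (atan_mono x t ltac:(lra)). pose proof (atan_mono t y ltac:(lra)).
    rewrite clamp_id by (unfold sx, sy; lra).
    replace (PI / 2 - (PI / 2 - atan t)) with (atan t) by ring. rewrite tan_atan. unfold Rdiv. ring.
  - intros t. cont.
    apply (cont_comp g (fun t => PI / 2 - atan t)); [|apply Hg]. cont.
Qed.

Lemma RInt_reflect (f : R -> R) (x y : R) :
  Cont f -> RInt (fun t => f (- t)) x y = RInt f (- y) (- x).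
Proof.
  intros Hf. rewrite <- (opp_RInt_swap (V := R_CompleteNormedModule) f (- x) (- y)) by now apply ex_RInt_cont.
  assert (E : RInt (fun t => -1 * f (- t)) x y = RInt f (- x) (- y)).
  { refine (RInt_comp (V := R_CompleteNormedModule) f (fun t => - t) (fun _ => -1) x y _ _).
    - intros; apply Hf.
    - intros t _. split; [auto_derive; [exact I | ring] | apply cont_const]. }
  rewrite <- E.
  transitivity (- 1 * RInt (fun t => -1 * f (- t)) x y); [|unfold opp; simpl; ringR].
  assert (Hc : Cont (fun t => f (- t))).
  { intros t. apply (cont_comp f (fun t => - t)); [apply cont_opp, cont_id | apply Hf]. }
  rewrite RInt_scalR by exact Hc. ringR.
Qed.

(** * The solution as a function of T on the whole line *)

Section Physical.

Variables (alpha N2 : R) (z tau theta : R -> R).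
Hypothesis Hz : forall s, 0 <= s <= PI / 2 -> 0 <= z s.
Hypothesis HN2 : HK_integral (fun s => z s ^ 2) 0 (PI / 2) N2.
Hypothesis Htau : forall sigma, 0 <= sigma <= PI / 2 ->
  exists I : R, HK_integral z 0 sigma I /\ tau sigma = ln (PI / 2) + I / 3.
Hypothesis Htheta : forall sigma, 0 <= sigma <= PI / 2 ->
  exists J : R, HK_integral (fun s => Kker s sigma * z s) 0 (PI / 2) J /\ theta sigma = J / (3 * PI).
Hypothesis Hrange : forall sigma, 0 <= sigma <= PI / 2 -> 0 <= sigma + theta sigma <= PI.
Hypothesis Hfix : forall sigma, 0 < sigma <= PI / 2 ->
  exists I : R, HK_integral z 0 sigma I /\
    z sigma = 3 / (alpha * PI) * (sin (sigma + theta sigma) * (cos sigma / sin sigma)) / exp I.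
Hypothesis Hrefl : forall sigma, 0 <= sigma <= PI / 2 ->
  tau (PI / 2 + sigma) = tau (PI / 2 - sigma) /\ theta (PI / 2 + sigma) = - theta (PI / 2 - sigma).

Definition Iz (sigma : R) : R := 3 * (tau sigma - ln (PI / 2)).

Lemma HK_Iz (sigma : R) : 0 <= sigma <= PI / 2 -> HK_integral z 0 sigma (Iz sigma).
Proof.
  intros H. destruct (Htau sigma H) as (I & HI & E). unfold Iz. rewrite E.
  replace (3 * (ln (PI / 2) + I / 3 - ln (PI / 2))) with I by field. exact HI.
Qed.

Lemma HK_theta (sigma : R) : 0 <= sigma <= PI / 2 ->
  HK_integral (fun s => Kker s sigma * z s) 0 (PI / 2) (3 * PI * theta sigma).
Proof.
  intros H. destruct (Htheta sigma H) as (J & HJ & E). rewrite E. pose proof PI_RGT_0.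
  replace (3 * PI * (J / (3 * PI))) with J by (field; lra). exact HJ.
Qed.

Lemma theta_modulus (p p' : R) : 0 <= p <= PI / 2 -> 0 <= p' <= PI / 2 ->
  Rabs (theta p - theta p') <= (128 * (Rabs N2 + 32)) * qr (Rabs (p - p')).
Proof.
  intros Hp Hp'. pose proof PI_4 as HP4. pose proof PI2_1 as HP1.
  destruct (Req_dec p p') as [->|Hne].
  { rewrite !Rminus_diag, Rabs_R0. apply Rmult_le_pos; [pose proof (Rabs_pos N2); lra | apply qr_pos]. }
  set (h := Rabs (p - p')). assert (Hh : 0 < h) by (apply Rabs_pos_lt; lra).
  destruct (HK_inv_sqrt p ltac:(lra) (PI / 2) ltac:(lra)) as (l & Hl & HKl).
  destruct (HK_inv_sqrt p' ltac:(lra) (PI / 2) ltac:(lra)) as (l' & Hl' & HKl').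
  set (g := fun s => 1 * (Kker s p * z s) + (-1) * (Kker s p' * z s)).
  assert (Hg : HK_integral g 0 (PI / 2) (1 * (3 * PI * theta p) + (-1) * (3 * PI * theta p'))).
  { apply HK_lin; now apply HK_theta. }
  (* [Kker_modulus] says nothing at [s = p] and [s = p']; the integrand is reset to 0 at both
     points. *)
  set (g1 := fun s => if Req_dec_T s p then 0 else g s).
  apply (HK_except_point g g1 0 (PI / 2) p) in Hg.
  2:{ intros x _ Hx. unfold g1. now destruct (Req_dec_T x p). }
  set (g2 := fun s => if Req_dec_T s p' then 0 else g1 s).
  apply (HK_except_point g1 g2 0 (PI / 2) p') in Hg.
  2:{ intros x _ Hx. unfold g2. now destruct (Req_dec_T x p'). }
  (* 128 is the constant of [young_qr], doubled for the singular weights by (X + X')^2 <= 2 (X^2 +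
     X'^2). *)
  assert (Hdom := HK_lin _ _ 0 (PI / 2) (128 * qr h) (256 * qr h) _ _ HN2
    (HK_lin _ _ 0 (PI / 2) 1 1 _ _ HKl HKl')).
  assert (HB2 : Rabs (1 * (3 * PI * theta p) + -1 * (3 * PI * theta p')) <= 128 * qr h * N2 + 256 * qr h * (1 * l + 1 * l')).
  { refine (HK_abs_le g2 _ 0 (PI / 2) _ _ _ Hg Hdom). intros s Hs. pose proof (qr_pos h) as Hq.
    pose proof (inv_sqrt_nonneg (Rabs (s - p))) as B1. pose proof (inv_sqrt_nonneg (Rabs (s - p'))) as B2.
    assert (B0 : 0 <= 128 * qr h * z s ^ 2 + 256 * qr h * (1 * / sqrt (Rabs (s - p)) + 1 * / sqrt (Rabs (s - p')))).
    { apply Rplus_le_le_0_compat; (apply Rmult_le_pos; [lra|]); [apply pow2_ge_0 | lra]. }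
    unfold g2, g1, g. destruct (Req_dec_T s p') as [E'|Hn']; [rewrite Rabs_R0; exact B0|].
    destruct (Req_dec_T s p) as [E|Hn]; [rewrite Rabs_R0; exact B0|].
    replace (1 * (Kker s p * z s) + -1 * (Kker s p' * z s)) with ((Kker s p - Kker s p') * z s) by ring.
    eapply Rle_trans.
    - apply (young_qr h _ _ (qr (/ Rabs (s - p)) + qr (/ Rabs (s - p'))) Hh (Hz s Hs)).
      + apply Rplus_le_le_0_compat; apply qr_pos.
      + now apply Kker_modulus.
    - rewrite <- !qr_inv_sq by (apply Rabs_pos_lt; lra).
      set (X := qr (/ Rabs (s - p))). set (X' := qr (/ Rabs (s - p'))).
      assert (0 <= qr h * (X - X') ^ 2) by (apply Rmult_le_pos; [exact Hq | apply pow2_ge_0]). nra. }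
  replace (1 * (3 * PI * theta p) + -1 * (3 * PI * theta p')) with ((3 * PI) * (theta p - theta p')) in HB2 by ring.
  rewrite Rabs_mult, (Rabs_right (3 * PI)) in HB2 by lra.
  pose proof (Rabs_pos (theta p - theta p')). pose proof (qr_pos h). pose proof (Rle_abs N2).
  assert (Rabs (theta p - theta p') <= 3 * PI * Rabs (theta p - theta p')) by nra.
  assert (qr h * N2 <= qr h * Rabs N2) by (apply Rmult_le_compat_l; lra).
  assert (qr h * (l + l') <= qr h * 16) by (apply Rmult_le_compat_l; lra).
  nra.
Qed.

Let c0 := 3 / (alpha * PI).
(** PI/2 - atan T is the inverse cotangent with values in (0, PI), so negative T reach the reflected
    half and the reflection becomes a parity. *)
Definition thh (T : R) : R := theta (PI / 2 - atan T).
Definition Ihat (T : R) : R := Iz (PI / 2 - atan T).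
(** The right-hand side of the fixed point equation times the Jacobian 1 / (1 + T^2); unlike zeta
    itself it makes sense for every real T. *)
Definition wh (T : R) : R := c0 * exp (- Ihat T) * sin (PI / 2 - atan T + thh T) * (T / (1 + T ^ 2)).

Lemma atan_range (T : R) : 0 <= T -> 0 <= atan T <= PI / 2.
Proof. intros H. pose proof (acot_range T H). pose proof (atan_bound T). lra. Qed.

Lemma thh_odd (T : R) : thh (- T) = - thh T.
Proof.
  assert (P : forall T, 0 <= T -> thh (- T) = - thh T).
  { intros S HS. unfold thh. rewrite atan_opp. replace (PI / 2 - - atan S) with (PI / 2 + atan S) by ring.
    apply Hrefl. now apply atan_range. }
  destruct (Rle_or_lt 0 T) as [H|H]; [now apply P|].
  rewrite <- (Ropp_involutive T) at 2. rewrite (P (- T)) by lra. ring.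
Qed.

Lemma Ihat_even (T : R) : Ihat (- T) = Ihat T.
Proof.
  assert (P : forall T, 0 <= T -> Ihat (- T) = Ihat T).
  { intros S HS. unfold Ihat, Iz. rewrite atan_opp. replace (PI / 2 - - atan S) with (PI / 2 + atan S) by ring.
    now rewrite (proj1 (Hrefl (atan S) (atan_range S HS))). }
  destruct (Rle_or_lt 0 T) as [H|H]; [now apply P|].
  rewrite <- (Ropp_involutive T) at 2. now rewrite (P (- T)) by lra.
Qed.

Lemma wh_odd (T : R) : wh (- T) = - wh T.
Proof.
  unfold wh. rewrite Ihat_even, thh_odd, atan_opp.
  replace (PI / 2 - - atan T + - thh T) with (PI - (PI / 2 - atan T + thh T)) by field.
  rewrite sin_PI_x. field. nra.
Qed.

Lemma thh_range (T : R) : 0 <= PI / 2 - atan T + thh T <= PI.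
Proof.
  assert (P : forall T, 0 <= T -> 0 <= PI / 2 - atan T + thh T <= PI).
  { intros S HS. apply Hrange. pose proof (acot_range S HS). lra. }
  destruct (Rle_or_lt 0 T) as [H|H]; [now apply P|].
  specialize (P (- T) ltac:(lra)). rewrite thh_odd, atan_opp in P. lra.
Qed.

Lemma thh_abs_cont (T : R) : continuous (fun T => thh (Rabs T)) T.
Proof.
  apply continuous_eps. intros eps Heps.
  destruct (qr_continuous_0 (128 * (Rabs N2 + 32)) eps Heps) as (d & Hd & Hq).
  exists d. split; [exact Hd|]. intros y Hy. unfold thh.
  pose proof (acot_range _ (Rabs_pos y)). pose proof (acot_range _ (Rabs_pos T)).
  eapply Rle_lt_trans; [apply theta_modulus; lra|]. apply Hq.
  replace (PI / 2 - atan (Rabs y) - (PI / 2 - atan (Rabs T))) with (- (atan (Rabs y) - atan (Rabs T))) by ring.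
  rewrite Rabs_Ropp. eapply Rle_lt_trans; [apply atan_lip|].
  eapply Rle_lt_trans; [apply Rabs_triang_inv2 | exact Hy].
Qed.

Lemma thh_0 : thh 0 = 0.
Proof. pose proof (thh_odd 0) as H. rewrite Ropp_0 in H. lra. Qed.

(** Continuity on the half line is glued through positive and negative parts; [thh 0 = 0], forced by
    oddness, removes the inactive part. *)
Lemma thh_cont (T : R) : continuous thh T.
Proof.
  apply (continuous_ext (fun T => thh (Rabs (Rmax 0 T)) - thh (Rabs (Rmax 0 (- T))))).
  { intros S. rewrite !(Rabs_right (Rmax 0 _)) by apply Rle_ge, Rmax_l.
    destruct (Rle_or_lt 0 S) as [H|H].
    - rewrite (Rmax_right 0 S), (Rmax_left 0 (- S)), thh_0 by lra. ringR.
    - rewrite (Rmax_left 0 S), (Rmax_right 0 (- S)), thh_0, thh_odd by lra. ringR. }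
  assert (Hm : Cont (Rmax 0)).
  { intros x. apply (continuous_lipschitz _ 1). intros y. rewrite Rmult_1_l. unfold Rmax.
    repeat destruct Rle_dec; unfold Rabs; repeat destruct Rcase_abs; lra. }
  apply cont_minus.
  - apply (cont_comp (fun T => thh (Rabs T)) (Rmax 0)); [apply Hm | apply thh_abs_cont].
  - apply (cont_comp (fun T => thh (Rabs T)) (fun T => Rmax 0 (- T))); [|apply thh_abs_cont].
    apply (cont_comp (Rmax 0) Ropp); [apply cont_opp, cont_id | apply Hm].
Qed.

Lemma Iz_nonneg (sigma : R) : 0 <= sigma <= PI / 2 -> 0 <= Iz sigma.
Proof.
  intros H. pose proof (HK_Iz sigma H) as HI.
  assert (H0 := HK_lin z z 0 sigma 0 0 _ _ HI HI).
  assert (0 * Iz sigma + 0 * Iz sigma <= Iz sigma); [|lra].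
  refine (HK_le _ z 0 sigma _ _ _ H0 HI). intros s Hs. pose proof (Hz s ltac:(lra)). lra.
Qed.

Lemma Ihat_nonneg (T : R) : 0 <= Ihat T.
Proof.
  assert (P : forall T, 0 <= T -> 0 <= Ihat T).
  { intros S HS. apply Iz_nonneg. pose proof (acot_range S HS). lra. }
  destruct (Rle_or_lt 0 T) as [H|H]; [now apply P|]. rewrite <- Ihat_even. apply P. lra.
Qed.

Lemma z_formula (sigma : R) : 0 < sigma <= PI / 2 ->
  z sigma = c0 * exp (- Iz sigma) * sin (sigma + theta sigma) * (cos sigma / sin sigma).
Proof.
  intros H. destruct (Hfix sigma H) as (I & HI & E).
  rewrite (HK_unique _ _ _ _ _ HI (HK_Iz sigma ltac:(lra))) in E. rewrite E, exp_Ropp. fold c0. unfold Rdiv. ring.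
Qed.

Lemma z_bound (sigma s1 : R) : 0 < s1 <= sigma -> sigma <= PI / 2 -> z sigma <= Rabs c0 / sin s1.
Proof.
  intros H H'. assert (Hs1 : 0 < sin s1) by (apply sin_gt_0; pose proof PI_RGT_0; lra).
  assert (Hs : sin s1 <= sin sigma) by (apply sin_incr_1; pose proof PI_RGT_0; lra).
  eapply Rle_trans; [apply Rle_abs|]. rewrite z_formula by lra. unfold Rdiv. rewrite !Rabs_mult.
  rewrite (Rabs_right (exp _)) by (left; apply exp_pos).
  rewrite (Rabs_right (/ sin sigma)) by (left; apply Rinv_0_lt_compat; lra).
  pose proof (exp_opp_le _ (Iz_nonneg sigma ltac:(lra))) as E1.
  assert (E2 : Rabs (sin (sigma + theta sigma)) <= 1) by apply Rabs_le, SIN_bound.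
  assert (E3 : Rabs (cos sigma) <= 1) by apply Rabs_le, COS_bound.
  assert (E4 : / sin sigma <= / sin s1) by now apply Rinv_le_contravar.
  pose proof (Rabs_pos c0). pose proof (exp_pos (- Iz sigma)). pose proof (Rabs_pos (sin (sigma + theta sigma))).
  pose proof (Rabs_pos (cos sigma)). assert (0 < / sin sigma) by (apply Rinv_0_lt_compat; lra).
  replace (Rabs c0 * / sin s1) with (Rabs c0 * 1 * 1 * (1 * / sin s1)) by ring.
  apply Rmult_le_compat.
  - apply Rmult_le_pos; [apply Rmult_le_pos; lra | lra].
  - apply Rmult_le_pos; lra.
  - apply Rmult_le_compat; [apply Rmult_le_pos; lra | lra | apply Rmult_le_compat_l; lra | exact E2].
  - apply Rmult_le_compat; lra.
Qed.

(** For bounded T the angle stays away from 0, where the cotangent blows up, so zeta is bounded and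
    its primitive locally Lipschitz. *)
Lemma Ihat_abs_diff (x y s1 : R) : 0 <= x <= y -> 0 < s1 <= PI / 2 - atan y ->
  Rabs (Ihat x - Ihat y) <= Rabs c0 / sin s1 * Rabs (x - y).
Proof.
  intros Hxy Hs1. pose proof (acot_range x ltac:(lra)). pose proof (acot_range y ltac:(lra)).
  pose proof (atan_mono x y ltac:(lra)).
  assert (Hs : 0 < sin s1) by (apply sin_gt_0; pose proof PI_RGT_0; lra).
  assert (HC : 0 <= Rabs c0 / sin s1).
  { apply Rmult_le_pos; [apply Rabs_pos | left; now apply Rinv_0_lt_compat]. }
  assert (HI := HK_incr z (PI / 2 - atan y) (PI / 2 - atan x) (Rabs c0 / sin s1) _ _ ltac:(lra)
    ltac:(intros s Hss; split; [apply Hz; lra | apply z_bound; lra]) (HK_Iz (PI / 2 - atan y) ltac:(lra)) (HK_Iz (PI / 2 - atan x) ltac:(lra))).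
  fold (Ihat x) (Ihat y) in HI. rewrite Rabs_right by lra. eapply Rle_trans; [apply HI|].
  apply Rmult_le_compat_l; [exact HC|].
  pose proof (atan_lip x y) as Hl. rewrite (Rabs_left1 (atan x - atan y)) in Hl by lra. lra.
Qed.

Lemma Ihat_cont (T : R) : continuous Ihat T.
Proof.
  apply (continuous_ext (fun T => Ihat (Rabs T))).
  { intros S. unfold Rabs. destruct Rcase_abs; [apply Ihat_even | reflexivity]. }
  set (s1 := PI / 2 - atan (Rabs T + 1)).
  assert (Hs1 : 0 < s1 <= PI / 2) by (apply acot_range; pose proof (Rabs_pos T); lra).
  set (C := Rabs c0 / sin s1).
  assert (Hloc : forall y, Rabs (y - T) < 1 -> Rabs (Ihat (Rabs y) - Ihat (Rabs T)) <= C * Rabs (y - T)).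
  { intros y Hy. pose proof (Rabs_pos y). pose proof (Rabs_pos T).
    pose proof (Rabs_triang_inv2 y T) as Htr.
    assert (Hy2 : Rabs y <= Rabs T + 1) by (pose proof (Rle_abs (Rabs y - Rabs T)); lra).
    assert (HC : 0 <= C).
    { apply Rmult_le_pos; [apply Rabs_pos | left; apply Rinv_0_lt_compat, sin_gt_0; pose proof PI_RGT_0; lra]. }
    apply Rle_trans with (C * Rabs (Rabs y - Rabs T)); [|now apply Rmult_le_compat_l].
    destruct (Rle_or_lt (Rabs y) (Rabs T)) as [Hc|Hc].
    - apply Ihat_abs_diff; [lra|]. pose proof (atan_mono (Rabs T) (Rabs T + 1) ltac:(lra)). unfold s1 in *. lra.
    - rewrite Rabs_minus_sym, (Rabs_minus_sym (Rabs y)).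
      apply Ihat_abs_diff; [lra|]. pose proof (atan_mono (Rabs y) (Rabs T + 1) ltac:(lra)). unfold s1 in *. lra. }
  apply continuous_eps. intros eps Heps.
  assert (HC1 : 0 < Rabs C + 1) by (pose proof (Rabs_pos C); lra).
  exists (Rmin 1 (eps / (Rabs C + 1))). split; [apply Rmin_pos; [lra | now apply Rdiv_lt_0_compat]|].
  intros y Hy. pose proof (Rmin_l 1 (eps / (Rabs C + 1))). pose proof (Rmin_r 1 (eps / (Rabs C + 1))).
  eapply Rle_lt_trans; [apply Hloc; lra|]. pose proof (Rabs_pos (y - T)). pose proof (Rle_abs C).
  assert (eps = (Rabs C + 1) * (eps / (Rabs C + 1))) by (field; lra). nra.
Qed.

Lemma wh_cont (T : R) : continuous wh T.
Proof. apply (cont_w c0 thh Ihat wh); [exact thh_cont | exact Ihat_cont | reflexivity]. Qed.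

#[local] Hint Resolve wh_cont : cont.

Definition Zh (T : R) : R := c0 * exp (- Ihat T) * sin (PI / 2 - atan T + thh T) * T.

Lemma Zh_cont (T : R) : continuous Zh T.
Proof.
  apply (continuous_ext (fun T => wh T * (1 + T ^ 2))).
  { intros S. change (wh S * (1 + S ^ 2) = Zh S :> R). unfold wh, Zh. field. nra. }
  apply cont_mult; [apply wh_cont|]. apply cont_plus; [apply cont_const | apply cont_pow, cont_id].
Qed.

#[local] Hint Resolve Zh_cont : cont.

Lemma acot_tan (s : R) : 0 < s <= PI / 2 -> PI / 2 - atan (tan (PI / 2 - s)) = s.
Proof. intros H. rewrite atan_tan by (pose proof PI_RGT_0; lra). ring. Qed.

Lemma z_Zh (s : R) : 0 < s <= PI / 2 -> z s = Zh (tan (PI / 2 - s)).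
Proof.
  intros H. rewrite z_formula by exact H. unfold Zh, Ihat, thh. rewrite acot_tan by exact H.
  f_equal. unfold tan. rewrite sin_shift, cos_shift. reflexivity.
Qed.

Lemma wh_nonneg (T : R) : 0 <= T -> 0 <= wh T.
Proof.
  intros H. pose proof (acot_range T H) as Hr.
  assert (E : wh T = z (PI / 2 - atan T) / (1 + T ^ 2)).
  { rewrite z_formula, cot_acot by exact Hr. unfold wh, Ihat, thh. field. nra. }
  rewrite E. apply Rmult_le_pos; [apply Hz; lra | left; apply Rinv_0_lt_compat; nra].
Qed.

(** For y >= 0 the gauge integral of zeta is split at the angle of y: the piece next to 0 stays
    abstract, the other has a continuous integrand and is transported by [HK_cot]. Parity does the
    rest. *)
Lemma RInt_wh (x y : R) : RInt wh x y = Ihat x - Ihat y.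
Proof.
  assert (P : forall y, 0 <= y -> RInt wh 0 y = Ihat 0 - Ihat y).
  { clear x y. intros y Hy. pose proof (acot_range y Hy) as Hr. pose proof (acot_range 0 ltac:(lra)) as Hr0.
    assert (H1 := HK_cot Zh 0 y Zh_cont Hy).
    apply HK_ext with (g := z) in H1; [|intros s Hs; symmetry; apply z_Zh; lra].
    assert (E := HK_Chasles z 0 _ _ _ _ _ (HK_Iz (PI / 2 - atan y) ltac:(lra)) H1 (HK_Iz (PI / 2 - atan 0) ltac:(lra))).
    fold (Ihat y) (Ihat 0) in E. rewrite (RInt_eq wh (fun t => Zh t / (1 + t ^ 2))).
    - apply (Rplus_eq_reg_l (Ihat y)). rewrite <- E. ring.
    - intros t. unfold wh, Zh. field. nra. }
  assert (P' : forall y, RInt wh 0 y = Ihat 0 - Ihat y).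
  { intros y'. destruct (Rle_or_lt 0 y') as [H|H]; [now apply P|].
    rewrite <- (Ihat_even y'), <- (P (- y')) by lra.
    rewrite <- (opp_RInt_swap (V := R_CompleteNormedModule) wh y' 0) by (apply ex_RInt_cont, wh_cont).
    assert (E := RInt_reflect wh 0 (- y') wh_cont). rewrite Ropp_involutive, Ropp_0 in E.
    change (opp (RInt wh y' 0)) with (- RInt wh y' 0). rewrite <- E.
    rewrite (RInt_eq (fun t => wh (- t)) (fun t => -1 * wh t)) by (intros; rewrite wh_odd; ring).
    rewrite RInt_scalR by exact wh_cont. ringR. }
  rewrite <- (RInt_Chasles_minus wh 0 x y wh_cont), !P'. ringR.
Qed.

Lemma RInt_abs_wh_pos (N : nat) :
  RInt (fun t => Rabs (wh t)) (INR N) (INR (S N)) <= Ihat (INR N) - Ihat (INR (S N)).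
Proof.
  rewrite <- RInt_wh. right. apply RInt_ext_in; [rewrite S_INR; lra|].
  intros t Ht. apply Rabs_right, Rle_ge, wh_nonneg. pose proof (pos_INR N). lra.
Qed.

Lemma RInt_abs_wh_neg (N : nat) :
  RInt (fun t => Rabs (wh t)) (- INR (S N)) (- INR N) <= Ihat (INR N) - Ihat (INR (S N)).
Proof.
  rewrite <- RInt_reflect by (intros; apply continuous_Rabs_comp, wh_cont).
  rewrite (RInt_eq _ (fun t => Rabs (wh t))) by (intros; now rewrite wh_odd, Rabs_Ropp).
  apply RInt_abs_wh_pos.
Qed.

(** With e = 4^-n the regularised argument lies between x^2 and (|x| + e)^2. *)
Lemma lreg_ln (n : nat) (x : R) : x <> 0 -> Rabs (ln (Rabs x) - lreg n x) <= 4 * qr ((/ 4) ^ n * / Rabs x).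
Proof.
  intros Hx. assert (Hp : 0 < Rabs x) by now apply Rabs_pos_lt.
  assert (He : 0 < (/ 4) ^ n) by (apply pow_lt; lra). set (e := (/ 4) ^ n) in *.
  unfold lreg. rewrite pow16_4. fold e. rewrite <- (pow2_abs x). set (y := Rabs x) in *.
  assert (E : forall u, 0 < u -> ln u = / 2 * ln (u ^ 2)).
  { intros u Hu. simpl. rewrite Rmult_1_r, ln_mult by lra. field. }
  assert (H1 : ln (y ^ 2) <= ln (y ^ 2 + e * e)) by (apply ln_le; nra).
  assert (H2 : ln (y ^ 2 + e * e) <= ln ((y + e) ^ 2)) by (apply ln_le; nra).
  rewrite (E y Hp). rewrite Rabs_left1 by lra.
  assert (H3 : ln (y + e) - ln y <= 4 * qr (e * / y)).
  { rewrite <- ln_div by lra. replace ((y + e) / y) with (1 + e * / y) by (field; lra).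
    apply ln1p_qr. apply Rmult_le_pos; [lra | left; now apply Rinv_0_lt_compat]. }
  rewrite (E (y + e)), (E y) in H3 by lra. lra.
Qed.

(** sin (s + p) and sin (s - p) equal sin s sin p (T + t) and sin s sin p (T - t); as sin s sin p <=
    1, the lower bounds on the sines pass to T + t and T - t. *)
Lemma Kker_cot (s T : R) : 0 < s <= PI / 2 -> 0 <= T -> s <> PI / 2 - atan T ->
  let t := tan (PI / 2 - s) in let p := PI / 2 - atan T in
  Kker s p = ln (Rabs (T + t)) - ln (Rabs (T - t)) /\
  Rabs (s - p) / 4 <= Rabs (T + t) /\ Rabs (s - p) / 4 <= Rabs (T - t).
Proof.
  intros Hs HT Hn t p. pose proof (acot_range T HT) as Hp. fold p in Hp, Hn. pose proof PI_RGT_0.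
  assert (Ss : 0 < sin s <= 1) by (split; [apply sin_gt_0; lra | apply SIN_bound]).
  assert (Sp : 0 < sin p <= 1) by (split; [apply sin_gt_0; lra | apply SIN_bound]).
  assert (Et : cos s = t * sin s).
  { unfold t, tan. rewrite sin_shift, cos_shift. field. lra. }
  assert (ET : cos p = T * sin p).
  { rewrite <- (cot_acot T) at 1. fold p. field. lra. }
  assert (E1 : sin (s + p) = sin s * sin p * (T + t)) by (rewrite sin_plus, Et, ET; ring).
  assert (E2 : sin (s - p) = sin s * sin p * (T - t)) by (rewrite sin_minus, Et, ET; ring).
  assert (Hss : 0 < sin s * sin p <= 1) by (split; [apply Rmult_lt_0_compat; lra | nra]).
  pose proof (sin_plus_lower s p ltac:(lra) ltac:(lra)) as L1. pose proof (sin_minus_lower s p ltac:(lra) ltac:(lra)) as L2.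
  pose proof (Rabs_pos_of_lower s p Hn _ L1) as P1. pose proof (Rabs_pos_of_lower s p Hn _ L2) as P2.
  rewrite Kker_split by lra. rewrite E1, E2, !Rabs_mult, (Rabs_right (sin s)), (Rabs_right (sin p)) in * by lra.
  assert (Q1 : 0 < Rabs (T + t)) by (pose proof (Rabs_pos (T + t)); nra).
  assert (Q2 : 0 < Rabs (T - t)) by (pose proof (Rabs_pos (T - t)); nra).
  split; [|split; nra]. rewrite !(ln_mult (sin s * sin p)) by lra. ring.
Qed.

Lemma pow4_qr_lim (C eps : R) : 0 < eps -> exists n0, forall n, (n0 <= n)%nat -> C * qr ((/ 4) ^ n) < eps.
Proof.
  intros He. destruct (qr_continuous_0 C eps He) as (d & Hd & Hq).
  destruct (pow_lt_1_zero (/ 4) ltac:(rewrite Rabs_right; lra) d Hd) as [n0 Hn].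
  exists n0. intros n Hnn. apply Hq. specialize (Hn n ltac:(lia)).
  rewrite Rabs_right in Hn; [exact Hn | left; apply pow_lt; lra].
Qed.

(** [HK_approx] removes the cut-off t <= n, that is s >= PI/2 - atan n, together with the
    regularisation. The dominating function is zeta^2 + |s - p|^(-1/2), with factor 128 [qr]
    (4^-n). *)
Lemma representation_pos (T : R) : 0 <= T ->
  is_lim_seq (fun n => RInt (fun t => (lreg n (T + t) - lreg n (T - t)) * wh t) 0 (INR n)) (3 * PI * thh T).
Proof.
  intros HT. pose proof (acot_range T HT) as Hp. set (p := PI / 2 - atan T) in *.
  pose proof PI_4 as HP4. pose proof PI2_1 as HP1.
  destruct (HK_inv_sqrt p ltac:(lra) (PI / 2) ltac:(lra)) as (l & Hl & HKl).
  assert (Hh := HK_lin _ _ 0 (PI / 2) 1 1 _ _ HN2 HKl).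
  set (H := 1 * N2 + 1 * l) in Hh.
  assert (Hh0 : forall s, 0 <= s <= PI / 2 -> 0 <= 1 * z s ^ 2 + 1 * / sqrt (Rabs (s - p))).
  { intros s _. pose proof (inv_sqrt_nonneg (Rabs (s - p))). pose proof (pow2_ge_0 (z s)). lra. }
  apply is_lim_seq_spec. intros eps. pose proof (cond_pos eps) as Heps.
  destruct (HK_approx _ _ 0 (PI / 2) _ _ (HK_theta p ltac:(lra)) Hh Hh0 (eps / 2) ltac:(lra)) as (eta & Heta & Happ).
  destruct (pow4_qr_lim (128 * (H + eps / 2)) (eps / 2) ltac:(lra)) as [n0 Hn0].
  assert (HN : exists N1, forall n, (N1 <= n)%nat -> PI / 2 - atan (INR n) < eta).
  { destruct (Rle_or_lt (PI / 2) eta) as [Hc|Hc].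
    - exists 1%nat. intros n Hn. assert (0 < INR n) by (apply lt_0_INR; lia).
      pose proof (atan_increasing 0 (INR n) H0). rewrite atan_0 in H1. lra.
    - destruct (INR_unbounded (tan (PI / 2 - eta / 2))) as [N1 HN1]. exists N1. intros n Hn. apply le_INR in Hn.
      assert (tan (PI / 2 - eta / 2) < INR n) by lra.
      apply atan_increasing in H0. rewrite atan_tan in H0 by lra. lra. }
  destruct HN as [N1 HN1].
  exists (n0 + N1)%nat. intros n Hn. specialize (Hn0 n ltac:(lia)). specialize (HN1 n ltac:(lia)).
  pose proof (pos_INR n) as Hn1. pose proof (acot_range (INR n) Hn1) as Hsn.
  set (sn := PI / 2 - atan (INR n)) in *.
  set (F := fun t => (lreg n (T + t) - lreg n (T - t)) * Zh t).
  assert (HFk : Cont (fun t => lreg n (T + t) - lreg n (T - t))).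
  { intros t. cont.
    apply (cont_comp (lreg n) (fun t => T + t)); [|apply lreg_cont]. cont. }
  assert (HF : Cont F) by (intros; apply cont_mult; [apply HFk | apply Zh_cont]).
  assert (HG := HK_cot F 0 (INR n) HF Hn1). rewrite atan_0, Rminus_0_r in HG. fold sn in HG.
  rewrite (RInt_eq (fun t => F t / (1 + t ^ 2)) (fun t => (lreg n (T + t) - lreg n (T - t)) * wh t)) in HG
    by (intros t; unfold F, wh, Zh; field; nra).
  set (Gv := RInt (fun t => (lreg n (T + t) - lreg n (T - t)) * wh t) 0 (INR n)) in *.
  (* At [p] the regularised integrand is given the value of the limit integrand, so the comparison
     is trivial there. *)
  set (g := fun s => if Req_dec_T s p then Kker p p * z p else F (tan (PI / 2 - s))).
  apply (HK_except_point _ g sn (PI / 2) p) in HG.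
  2:{ intros x _ Hx. unfold g. now destruct (Req_dec_T x p). }
  set (e := (/ 4) ^ n) in *. assert (He : 0 < e) by (apply pow_lt; lra). pose proof (qr_pos e) as Hqe.
  assert (HB := Happ sn g Gv (128 * qr e) ltac:(lra) ltac:(lra) ltac:(lra) HG).
  rewrite Rabs_minus_sym. fold (thh T). eapply Rle_lt_trans; [apply HB|].
  - intros s Hs. unfold g. destruct (Req_dec_T s p) as [->|Hnp].
    + rewrite Rminus_diag, Rabs_R0. apply Rmult_le_pos; [lra | apply Hh0; lra].
    + unfold F. rewrite <- z_Zh by lra.
      destruct (Kker_cot s T ltac:(lra) HT Hnp) as (EK & B1 & B2). fold p in EK, B1, B2.
      set (t := tan (PI / 2 - s)) in *. rewrite <- Rmult_minus_distr_r, EK.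
      assert (Hd0 : 0 < Rabs (s - p)) by (apply Rabs_pos_lt; lra).
      assert (N1' : T + t <> 0) by (intros E0; rewrite E0, Rabs_R0 in B1; lra).
      assert (N2' : T - t <> 0) by (intros E0; rewrite E0, Rabs_R0 in B2; lra).
      pose proof (lreg_ln n _ N1') as D1. pose proof (lreg_ln n _ N2') as D2. fold e in D1, D2.
      pose proof (qr_ratio e _ _ ltac:(lra) Hd0 B1) as R1. pose proof (qr_ratio e _ _ ltac:(lra) Hd0 B2) as R2.
      assert (HX := qr_pos (/ Rabs (s - p))).
      replace (1 * z s ^ 2 + 1 * / sqrt (Rabs (s - p))) with (z s ^ 2 + qr (/ Rabs (s - p)) ^ 2) by (rewrite qr_inv_sq by exact Hd0; ring).
      apply young_qr; [exact He | apply Hz; lra | exact HX|].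
      apply Rabs_le_between in D1. apply Rabs_le_between in D2. apply Rabs_le. lra.
  - lra.
Qed.

(** Oddness of [wh] folds the symmetric interval onto [0, n]; negative T follow by parity of
    [lreg]. *)
Lemma representation (T : R) :
  is_lim_seq (fun n => RInt (fun t => lreg n (T - t) * wh t) (- INR n) (INR n)) (- (3 * PI * thh T)).
Proof.
  assert (Cp : forall n S x, continuous (fun t => lreg n (S + t) * wh t) x).
  { intros n S x. cont. apply (cont_comp (lreg n) (fun t => S + t)); [|apply lreg_cont].
    cont. }
  assert (Cm : forall n S x, continuous (fun t => lreg n (S - t) * wh t) x).
  { intros n S x. cont. }
  assert (Hodd : forall n S x y, RInt (fun t => lreg n (S - t) * wh t) (- y) (- x) = - RInt (fun t => lreg n (S + t) * wh t) x y :> R).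
  { intros n S x y. rewrite <- (RInt_reflect (fun t => lreg n (S - t) * wh t)) by apply Cm.
    rewrite (RInt_eq _ (fun t => -1 * (lreg n (S + t) * wh t))).
    - rewrite RInt_scalR by apply Cp. ringR.
    - intros t. rewrite wh_odd. replace (S - - t) with (S + t) by ring. ring. }
  assert (P : forall T, 0 <= T -> is_lim_seq (fun n => RInt (fun t => lreg n (T - t) * wh t) (- INR n) (INR n)) (- (3 * PI * thh T))).
  { clear T. intros T HT. apply is_lim_seq_ext with (fun n => - RInt (fun t => (lreg n (T + t) - lreg n (T - t)) * wh t) 0 (INR n)).
    - intros n. rewrite (RInt_eq _ (fun t => lreg n (T + t) * wh t - lreg n (T - t) * wh t)) by (intros; ring).
      rewrite RInt_minusR by auto.
      rewrite <- (RInt_Chasles (fun t => lreg n (T - t) * wh t) (- INR n) 0 (INR n)) by (apply ex_RInt_cont; apply Cm).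
      rewrite <- Ropp_0 at 3. rewrite Hodd. change (@plus R_AbelianGroup) with Rplus. unfold plus; simpl. ring.
    - apply (is_lim_seq_opp _ (3 * PI * thh T)). now apply representation_pos. }
  destruct (Rle_or_lt 0 T) as [H|H]; [now apply P|].
  specialize (P (- T) ltac:(lra)). rewrite thh_odd in P.
  apply is_lim_seq_opp in P.
  replace (Rbar_opp (- (3 * PI * - thh T))) with (Finite (- (3 * PI * thh T))) in P by (simpl; f_equal; ring).
  revert P. apply is_lim_seq_ext. intros n.
  rewrite <- (Ropp_involutive (INR n)) at 2. rewrite Hodd, Ropp_involutive.
  apply RInt_eq. intros t. f_equal. unfold lreg. f_equal. f_equal. ring.
Qed.

Lemma analytic_cot (T0 : R) : exists p M, 0 < p /\
  AnF T0 T0 (/ 4) (fun _ mu => thh (T0 + mu * p)) M /\ AnF T0 T0 (/ 4) (fun _ mu => Ihat (T0 + mu * p)) M.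
Proof.
  apply (analytic_T c0 thh Ihat wh).
  - exact thh_cont.
  - exact Ihat_cont.
  - exact Ihat_nonneg.
  - exact thh_range.
  - reflexivity.
  - exact RInt_wh.
  - exact RInt_abs_wh_pos.
  - exact RInt_abs_wh_neg.
  - exact representation.
Qed.

End Physical.

(** * Return from T to the angle *)

Lemma analytic_comp_cot (f : R -> R) (s0 p M : R) : 0 < s0 < PI -> 0 < p ->
  let T0 := cos s0 / sin s0 in
  AnF T0 T0 (/ 4) (fun _ mu => f (T0 + mu * p)) M ->
  exists rho, 0 < rho /\ exists c : nat -> R, forall mu, Rabs mu < rho ->
    is_series (fun k => c k * mu ^ k) (f (cos (s0 + mu) / sin (s0 + mu))).
Proof.
  intros Hs Hp T0 (c & _ & Hc2 & Hc3).
  assert (Hsin : 0 < sin s0) by (apply sin_gt_0; lra).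
  set (K := / (p * sin s0 ^ 2)).
  assert (HK : 0 < K) by (apply Rinv_0_lt_compat, Rmult_lt_0_compat; [exact Hp | now apply pow_lt]).
  pose proof (Rabs_pos T0) as HT.
  (* 10 and 6 |T0| keep the norm of [v] within 1/2; 48 [K] keeps that of [u] within 1/8, inside the
     disc of radius 1/4. *)
  set (rho := / (10 + 6 * Rabs T0 + 48 * K)).
  assert (Hrho : 0 < rho) by (apply Rinv_0_lt_compat; lra).
  assert (Er : rho * (10 + 6 * Rabs T0 + 48 * K) = 1) by (unfold rho; field; lra).
  assert (HrT : 0 <= rho * Rabs T0) by (apply Rmult_le_pos; lra).
  assert (HrK : 0 < rho * K) by (apply Rmult_lt_0_compat; lra).
  assert (Hrho1 : rho <= / 10) by lra.
  assert (H00 : 0 <= 0) by lra.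
  (* sin (s0 + mu) = sin s0 (1 + v). Half angles write cos mu - 1 without a constant term, so its
     norm is visibly small. *)
  set (v := fun mu => -2 * (sin (/ 2 * mu) * sin (/ 2 * mu)) + T0 * sin mu).
  assert (Hsn : AnF 0 0 rho (fun _ mu => sin mu) (3 * rho)).
  { apply AnF_le with (rho * exp (rho * rho)).
    - pose proof (exp_le_3' (rho * rho) ltac:(nra)). nra.
    - apply (AnF_sin 0 0 rho H00 Hrho (fun _ mu => mu)). now apply AnF_id. }
  assert (Hsh : AnF 0 0 rho (fun _ mu => sin (/ 2 * mu)) (3 * rho)).
  { apply AnF_le with (Rabs (/ 2) * rho * exp (Rabs (/ 2) * rho * (Rabs (/ 2) * rho))).
    - rewrite (Rabs_right (/ 2)) by lra. pose proof (exp_le_3' (/ 2 * rho * (/ 2 * rho)) ltac:(nra)).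
      pose proof (exp_pos (/ 2 * rho * (/ 2 * rho))). nra.
    - apply (AnF_sin 0 0 rho H00 Hrho (fun _ mu => / 2 * mu)). apply AnF_scal; auto. now apply AnF_id. }
  assert (Hv : AnF 0 0 rho (fun _ mu => v mu) (/ 2)).
  { apply AnF_le with (Rabs (-2) * (3 * rho * (3 * rho)) + Rabs T0 * (3 * rho)).
    - rewrite (Rabs_left (-2)) by lra. nra.
    - apply AnF_plus; auto; apply AnF_scal; auto. now apply AnF_mult. }
  (* The increment of the cotangent from s0 to s0 + mu, divided by p. *)
  set (u := fun mu => - K * (sin mu * / (1 + v mu))).
  assert (Hu : AnF 0 0 rho (fun _ mu => u mu) (/ 8)).
  { apply AnF_le with (Rabs (- K) * (3 * rho * 2)).
    - rewrite Rabs_Ropp, Rabs_right by lra. nra.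
    - apply AnF_scal; auto. apply AnF_mult; auto. now apply (AnF_inv 0 0 rho H00 Hrho (fun _ mu => v mu)). }
  assert (Hcot : forall mu, Rabs mu < rho -> T0 + u mu * p = cos (s0 + mu) / sin (s0 + mu)).
  { intros mu Hmu.
    assert (Hvb := AnF_bound 0 0 rho Hrho _ _ 0 mu Hv ltac:(lra) Hmu). apply Rabs_le_between in Hvb.
    assert (Ec : cos mu = 1 - 2 * (sin (/ 2 * mu) * sin (/ 2 * mu))).
    { replace mu with (2 * (/ 2 * mu)) at 1 by field. rewrite cos_2a_sin. ring. }
    assert (E0 : cos s0 = T0 * sin s0) by (unfold T0; field; lra).
    assert (Es : sin (s0 + mu) = sin s0 * (1 + v mu)).
    { rewrite sin_plus, E0, Ec. unfold v. ring. }
    assert (Ecc : cos (s0 + mu) = T0 * sin s0 * cos mu - sin s0 * sin mu) by (rewrite cos_plus, E0; ring).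
    assert (Ev : cos mu = 1 + v mu - T0 * sin mu) by (unfold v; rewrite Ec; ring).
    assert (E2 : (1 + T0 ^ 2) * sin s0 ^ 2 = 1).
    { pose proof (sin2_cos2 s0) as H2. unfold Rsqr in H2. rewrite E0 in H2.
      replace ((1 + T0 ^ 2) * sin s0 ^ 2) with (sin s0 * sin s0 + T0 * sin s0 * (T0 * sin s0)) by ring. exact H2. }
    rewrite Es, Ecc, Ev. unfold u, K.
    apply Rmult_eq_reg_r with (sin s0 ^ 2 * (1 + v mu)); [|apply Rgt_not_eq, Rmult_lt_0_compat; [now apply pow_lt | lra]].
    transitivity (T0 * sin s0 ^ 2 * (1 + v mu) - sin mu * ((1 + T0 ^ 2) * sin s0 ^ 2)); [rewrite E2 | ]; field; lra. }
  destruct (ser_pos_bdd (fun n => Rabs (c n T0) * (/ 4) ^ n) M) as (S & HS & _).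
  { intros n. apply Rmult_le_pos; [apply Rabs_pos | apply pow_le; lra]. }
  { intros n. apply Hc2. lra. }
  assert (HA : AnF 0 0 rho (fun _ mu => f (T0 + u mu * p)) S).
  { apply (AnF_series 0 0 rho H00 Hrho (fun n _ mu => c n T0 * u mu ^ n) _ (fun n => Rabs (c n T0) * (/ 4) ^ n)).
    - intros n. apply AnF_scal; auto. apply AnF_le with ((/ 8) ^ n); [apply pow_incr; lra|].
      now apply (AnF_pow 0 0 rho H00 Hrho (fun _ mu => u mu)).
    - exact HS.
    - intros t mu Ht Hmu. apply (Hc3 T0 (u mu)); [lra|].
      pose proof (AnF_bound 0 0 rho Hrho _ _ 0 mu Hu ltac:(lra) Hmu). lra. }
  destruct HA as (c' & _ & _ & H3).
  exists rho. split; [exact Hrho|]. exists (fun k => c' k 0). intros mu Hmu.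
  rewrite <- Hcot by exact Hmu. apply (H3 0 mu); [lra | exact Hmu].
Qed.

Lemma real_analytic_cot (f g : R -> R) :
  (forall s, 0 < s < PI -> g s = f (cos s / sin s)) ->
  (forall T0, exists p M, 0 < p /\ AnF T0 T0 (/ 4) (fun _ mu => f (T0 + mu * p)) M) ->
  real_analytic_on g 0 PI.
Proof.
  intros Hg Hf x Hx. destruct (Hf (cos x / sin x)) as (p & M & Hp & HM).
  destruct (analytic_comp_cot f x p M Hx Hp HM) as (rho & Hrho & c & Hc).
  exists (Rmin rho (Rmin x (PI - x))). split; [repeat apply Rmin_pos; lra|].
  exists c. intros y Hy.
  pose proof (Rmin_l rho (Rmin x (PI - x))). pose proof (Rmin_r rho (Rmin x (PI - x))).
  pose proof (Rmin_l x (PI - x)). pose proof (Rmin_r x (PI - x)).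
  assert (Hy2 : 0 < y < PI) by (apply Rabs_def2 in Hy; lra).
  specialize (Hc (y - x) ltac:(lra)). replace (x + (y - x)) with y in Hc by ring.
  rewrite Hg by exact Hy2. apply is_series_Reals in Hc. exact Hc.
Qed.

Lemma acot_cot (s : R) : 0 < s < PI -> PI / 2 - atan (cos s / sin s) = s.
Proof.
  intros H. replace (cos s / sin s) with (tan (PI / 2 - s)) by (unfold tan; now rewrite sin_shift, cos_shift).
  rewrite atan_tan by lra. ring.
Qed.

Theorem theorem4p5 (alpha : R) (zeta tau theta : R -> R) :
  (* alpha >= (2/pi)(1 + 1/(3 sqrt pi)) *)
  alpha >= 2 / PI * (1 + 1 / (3 * sqrt PI)) ->
  (* zeta_star is non-negative *)
  (forall s, 0 < s <= PI / 2 -> 0 <= zeta s) ->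
  (* zeta_star in L^2(0,pi/2) with ||zeta_star|| <= 9 sqrt(pi)/2 *)
  (exists N2 : R, HK_integral (fun s => zeta s ^ 2) 0 (PI / 2) N2 /\
                  sqrt N2 <= 9 * sqrt PI / 2) ->
  (* tau(sigma) = log(pi/2) + (1/3) int_0^sigma zeta_star, on [0,pi/2] *)
  (forall sigma, 0 <= sigma <= PI / 2 ->
     exists I : R, HK_integral zeta 0 sigma I /\ tau sigma = ln (PI / 2) + I / 3) ->
  (* theta = (1/3) H zeta_star, on [0,pi/2] *)
  (forall sigma, 0 <= sigma <= PI / 2 ->
     exists J : R, HK_integral (fun s => Kker s sigma * zeta s) 0 (PI / 2) J /\
                   theta sigma = J / (3 * PI)) ->
  (* 0 <= sigma + (1/3)(H zeta_star)(sigma) <= pi *)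
  (forall sigma, 0 <= sigma <= PI / 2 -> 0 <= sigma + theta sigma <= PI) ->
  (* fixed point zeta_star = Phi(zeta_star) on (0,pi/2] *)
  (forall sigma, 0 < sigma <= PI / 2 ->
     exists I : R, HK_integral zeta 0 sigma I /\
       zeta sigma = 3 / (alpha * PI) *
                    (sin (sigma + theta sigma) * (cos sigma / sin sigma)) / exp I) ->
  (* extension to [0,pi] by reflection about pi/2 *)
  (forall sigma, 0 <= sigma <= PI / 2 ->
     tau (PI / 2 + sigma) = tau (PI / 2 - sigma) /\
     theta (PI / 2 + sigma) = - theta (PI / 2 - sigma)) ->
  real_analytic_on tau 0 PI /\ real_analytic_on theta 0 PI.
Proof.
  intros _ Hpos (N2 & HN2 & _) Htau Htheta Hrange Hfix Hrefl.
  (* Sign and equation are given only for s > 0; resetting the value at 0 gives a non-negative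
     function on the closed interval without changing any integral. *)
  set (z := fun s => if Req_dec_T s 0 then 0 else zeta s).
  assert (Ez : forall s, s <> 0 -> zeta s = z s) by (intros s Hs; unfold z; now destruct (Req_dec_T s 0)).
  assert (HKz : forall b I, HK_integral zeta 0 b I -> HK_integral z 0 b I).
  { intros b I. apply HK_except_point with 0. intros x _ Hx. now apply Ez. }
  assert (Hcot : forall T0, exists p M, 0 < p /\
    AnF T0 T0 (/ 4) (fun _ mu => thh theta (T0 + mu * p)) M /\
    AnF T0 T0 (/ 4) (fun _ mu => Ihat tau (T0 + mu * p)) M).
  { apply (analytic_cot alpha N2 z).
    - intros s Hs. unfold z. destruct (Req_dec_T s 0); [lra|]. apply Hpos. lra.
    - revert HN2. apply HK_except_point with 0. intros x _ Hx. now rewrite Ez.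
    - intros s Hs. destruct (Htau s Hs) as (I & HI & E). exists I. auto.
    - intros s Hs. destruct (Htheta s Hs) as (J & HJ & E). exists J. split; [|exact E].
      revert HJ. apply HK_except_point with 0. intros x _ Hx. now rewrite Ez.
    - exact Hrange.
    - intros s Hs. destruct (Hfix s Hs) as (I & HI & E). exists I. split; [auto|]. now rewrite <- Ez by lra.
    - exact Hrefl. }
  split.
  - apply (real_analytic_cot (fun T => ln (PI / 2) + / 3 * Ihat tau T)).
    + intros s Hs. unfold Ihat, Iz. rewrite acot_cot by exact Hs. field.
    + intros T0. destruct (Hcot T0) as (p & M & Hp & _ & HM).
      exists p, (Rabs (ln (PI / 2)) + Rabs (/ 3) * M). split; [exact Hp|].
      apply AnF_plus; [lra | apply AnF_const; lra|]. apply AnF_scal; [lra | lra | exact HM].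
  - apply (real_analytic_cot (thh theta)).
    + intros s Hs. unfold thh. now rewrite acot_cot.
    + intros T0. destruct (Hcot T0) as (p & M & Hp & HM & _). now exists p, M.
Qed.
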